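(* Let $0<\lambda<\mu$ and consider the Poisson matching problem $PM(\lambda,\mu)$ (defined in the context), with stable matching $\mathcal{M}_s$. Let $X$ be the matching distance in $\mathcal{M}_s$ of an arbitrary (typical) blue point. Then there exist random variables $B_1,B_2,\dots$, $B_1',B_2',\dots$, $N$, $N'$ on the same probability space such that the $B_i$ and $B_i'$ are i.i.d. with distribution $B(\lambda,\mu)$, $N$ and $N'$ are i.i.d. geometric random variables with parameter $1-\lambda/\mu$, and $$\min\{B_1,B_1'\}\le X\le\max\Bigl\{\sum_{i=1}^{2N-1}B_i,\ \sum_{i=1}^{2N'-1}B_i'\Bigr\}.$$
   Context: Poisson matching problem $PM(\lambda,\mu)$: $\mathcal{B}$ (blue points) and $\mathcal{R}$ (red points) are independent homogeneous Poisson point processes on $\mathbb{R}$ of intensities $\lambda$ and $\mu$ respectively. A matching is a map $\mathcal{M}:\mathcal{B}\cup\mathcal{R}\to\mathcal{B}\cup\mathcal{R}\cup\{\infty\}$ with $\mathcal{M}(r)\in\mathcal{B}\cup\{\infty\}$ for red $r$, $\mathcal{M}(b)\in\mathcal{R}\cup\{\infty\}$ for blue $b$, and $\mathcal{M}(r)=b$ iff $\mathcal{M}(b)=r$; $x$ is unmatched if $\mathcal{M}(x)=\infty$. A matching is stable if there is no pair $(b,r)\in\mathcal{B}\times\mathcal{R}$ with $b\ne\mathcal{M}(r)$ and $|r-b|<\min(|r-\mathcal{M}(r)|,|b-\mathcal{M}(b)|)$. $\mathcal{M}_s$ is the stable matching produced by the following procedure: every blue point simultaneously emits two rays, one in each direction,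 each at distance $t$ from its emitter at time $t$; when a ray hits an unmatched red point $r$, the emitter $b$ is matched to $r$ and both leave the system. The matching distance of $x$ in a matching $\mathcal{M}$ is $|x-\mathcal{M}(x)|$. $B(\lambda,\mu)$ denotes the distribution of the busy cycle (busy period) of a last-come-first-served preemptive-resume single-server queue with Poisson arrivals of rate $\lambda$ and i.i.d. exponential service times of rate $\mu$. A geometric random variable with parameter $p$ takes value $j\in\{1,2,\dots\}$ with probability $(1-p)^{j-1}p$. *)

(* Defs.v *)
From HB Require Import structures.
From mathcomp Require Import all_boot all_order all_algebra.
From mathcomp Require Import all_classical all_reals all_analysis measurable_realfun.
From mathcomp Require Import finmap.
Set Implicit Arguments. Unset Strict Implicit. Unset Printing Implicit Defensive.
Import Order.TTheory GRing.Theory Num.Theory.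
Local Open Scope classical_set_scope.
Local Open Scope ring_scope.

Section Defs.
Context {R : realType}.

Definition cnt (S : set R) : \bar R :=
  if `[< finite_set S >] then ((#|` fset_set S|)%fset%:R)%:E else +oo%E.

(* matching distance: None encodes "unmatched" (partner = infinity) *)
Definition mdist (o : option R) (x : R) : \bar R :=
  if o is Some y then (`|x - y|)%:E else +oo%E.

Definition is_matching (Bl Rd : set R) (MB MR : R -> option R) : Prop :=
  (forall b r, Bl b -> MB b = Some r -> Rd r /\ MR r = Some b) /\
  (forall r b, Rd r -> MR r = Some b -> Bl b /\ MB b = Some r).

Definition is_stable_matching (Bl Rd : set R) (MB MR : R -> option R) : Prop :=
  is_matching Bl Rd MB MR /\
  ~ (exists b r, Bl b /\ Rd r /\ MR r <> Some b /\
       ((`|r - b|)%:E < mdist (MR r) r)%E /\ ((`|r - b|)%:E < mdist (MB b) b)%E).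

Definition bounded_set_R (A : set R) : Prop :=
  exists M : R, A `<=` [set x | `|x| <= M].

Definition poisson_pmf_R (m : R) (k : nat) : R :=
  expR (- m) * m ^+ k / (k`!)%:R.

Definition indep_poisson_pair {d} {Omega : measurableType d}
  (P : probability Omega R) (lam mu : R) (Bl Rd : Omega -> set R) : Prop :=
  let N (c : bool) (w : Omega) (A : set R) :=
    cnt ((if c then Bl w else Rd w) `&` A) in
  (forall (c : bool) (A : set R) (k : nat),
     measurable A -> bounded_set_R A ->
     measurable [set w | N c w A = (k%:R)%:E]) /\
  forall (n : nat) (c : 'I_n -> bool) (A : 'I_n -> set R) (k : 'I_n -> nat),
    (forall i, measurable (A i)) -> (forall i, bounded_set_R (A i)) ->
    (forall i j, i != j -> c i = c j -> A i `&` A j = set0) ->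
    P (\bigcap_(i in [set: 'I_n]) [set w | N (c i) w (A i) = ((k i)%:R)%:E]) =
    (\prod_(i < n)
       poisson_pmf_R ((if c i then lam else mu) * fine (lebesgue_measure (A i))) (k i))%:E.

Definition mutual_indep {d} {T : measurableType d} (P : probability T R)
  {I : eqType} {d'} {V : measurableType d'} (X : I -> T -> V) : Prop :=
  (forall i, measurable_fun setT (X i)) /\
  forall (s : seq I) (A : I -> set V), uniq s -> (forall i, measurable (A i)) ->
    P (\big[setI/setT]_(i <- s) (X i @^-1` A i)) =
    (\prod_(i <- s) P (X i @^-1` A i))%E.

Definition exp_law {d} {T : measurableType d} (P : probability T R)
  (rate : R) (Y : T -> R) : Prop :=
  measurable_fun setT Y /\
  forall t : R, 0 <= t -> P [set w | t < Y w] = (expR (- (rate * t)))%:E.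

Definition geom_law {d} {T : measurableType d} (P : probability T R)
  (p : R) (N : T -> nat) : Prop :=
  measurable_fun setT N /\
  forall j : nat, P [set w | N w = j.+1] = ((1 - p) ^+ j * p)%:E.

(* Busy period of a single-server queue started by a customer (number 0) at
   time 0: E j = interarrival time before arrival j+1, S j = service time of
   customer j.  The busy period ends at S_0+..+S_k for the least k with
   S_0+..+S_k <= E_0+..+E_k (all work done before arrival k+1); +oo if none.
   (Work-conserving, so this is the busy cycle for the LCFS-PR discipline.) *)
Definition busy_time (E S : nat -> R) : \bar R :=
  ereal_inf [set ((\sum_(j < k.+1) S j)%:E) | k in
              [set k : nat | \sum_(j < k.+1) S j <= \sum_(j < k.+1) E j]].

Definition ES_family {T : Type} (E S : nat -> T -> R) (i : nat + nat) : T -> R :=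
  match i with inl n => E n | inr n => S n end.

Definition busy_law (lam mu : R) (Q : set (\bar R) -> \bar R) : Prop :=
  exists (d : measure_display) (T : measurableType d) (P : probability T R)
         (E S : nat -> T -> R),
    mutual_indep P (ES_family E S) /\
    (forall n, exp_law P lam (E n)) /\ (forall n, exp_law P mu (S n)) /\
    forall A : set (\bar R), measurable A ->
      P ((fun w => busy_time (E ^~ w) (S ^~ w)) @^-1` A) = Q A.

Definition pair_family {T V : Type} (B B' : nat -> T -> V) (i : nat + nat) : T -> V :=
  match i with inl n => B n | inr n => B' n end.

Definition blue_in_window (Bl : set R) (MB : R -> option R) (A : set (\bar R)) : set R :=
  [set b | Bl b /\ 0 <= b <= 1 /\ A (mdist (MB b) b)].

(* Palm law of the matching distance of the typical blue point:
   Q(A) = E[#{b in Bl cap [0,1] : dist(b) in A}] / lam. *)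
Definition typical_dist_law {d} {Omega : measurableType d} (P : probability Omega R)
  (lam : R) (Bl : Omega -> set R) (MB : Omega -> R -> option R)
  (A : set (\bar R)) : \bar R :=
  ((lam^-1)%:E * \int[P]_w cnt (blue_in_window (Bl w) (MB w) A))%E.

End Defs.

(* Main.v *)
(* Let b be a blue point and call excess at a point s > b the number of red minus
   the number of blue points in (b, s].  If b is matched to r > b then stability
   forces every blue point of (b, r] to be matched inside (b, r), so the excess at
   r is positive; conversely, if the excess stays positive from b + t on, a partner
   of b at distance more than t would leave a blocking pair, so |b - M(b)| <= t.
   Seen from b, the excess is a random walk along an i.i.d. sequence of gaps, with
   steps +1 (red, probability mu / (lam + mu)) and -1 (blue).  The time of its first
   visit to 1 is a busy period, blue points being arrivals and red points services,
   and successive ladder times split the walk into i.i.d. busy periods B_1, B_2, ...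
   This gives min(B_1, B_1') <= X.  Let N be the first k >= 1 such that after the
   k-th ladder time the walk never loses its k units; it is geometric because the
   walk reaches -k with probability (lam / mu)^k, and X <= B_1 + ... + B_N.  So
   already the right half-line yields the upper bound, with N terms instead of
   2N - 1.  All this happens on the Palm space of pairs (omega, k) with k indexing
   the blue points of (0, 1]; the independence of the two half-lines under the Palm
   measure follows by cutting (0, 1] into small cells. *)

From HB Require Import structures.
From mathcomp Require Import all_boot all_order all_algebra.
From mathcomp Require Import all_classical all_reals all_analysis measurable_realfun.
From mathcomp Require Import finmap.
From mathcomp Require Import lra ring zify.
Require Import Defs.
Set Implicit Arguments. Unset Strict Implicit. Unset Printing Implicit Defensive.
Import Order.TTheory GRing.Theory Num.Theory.
Import numFieldNormedType.Exports.
Local Open Scope classical_set_scope.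
Local Open Scope ring_scope.

(** * Counting points *)

Section Counting.
Context {R : realType}.
Implicit Types (S A B : set R) (D : bool -> set R) (x y z : R).

(** The hypotheses give probabilities of finitely many counts and, for the matching, only the
    measurability of counts over the window. This shapes the proof twice. First, whatever concerns
    points is recovered from counts: a gap is located on finer and finer grids, by events that
    stabilise at each sample point. In place of conditioning on a random position, an arbitrary
    event [A] is carried along ([pois_at]), so that [A] may later describe the other half-line or
    the other colour. Second, the distance of the [k]-th blue point need not be measurable, so [X]
    is a rearrangement of the distances among the blue points of the window. This keeps the number
    of distances in any set, hence the Palm law, but it needs the bounds for all blue points of the
    window at once. The queue is found on the Palm space as well: the gaps of each colour alone are
    its interarrival and service times, and the two-coloured walk first reaches 1 when its busy
    period ends. One signed real per point carries colour and distance, which makes the gaps an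
    i.i.d. real sequence. *)

Definition ncard S : nat := #|` fset_set S|%fset.

Lemma cntE S : finite_set S -> cnt S = ((ncard S)%:R)%:E.
Proof. by move=> fS; rewrite /cnt asboolT. Qed.

Lemma cnt_eqE S k : finite_set S -> (cnt S = (k%:R)%:E) = (ncard S = k).
Proof.
move=> fS; rewrite cntE//; apply/propext; split => [[/eqP]|->//].
by rewrite eqr_nat => /eqP.
Qed.

Lemma ncard0 : ncard set0 = 0%N. Proof. by rewrite /ncard fset_set0 cardfs0. Qed.

Lemma ncard1 x : ncard [set x] = 1%N.
Proof. by rewrite /ncard fset_set1 cardfs1. Qed.

Lemma ncard_eq0 S : finite_set S -> (ncard S = 0%N) -> S = set0.
Proof. by move=> fS /eqP; rewrite cardfs_eq0 => /eqP; exact: fset_set_set0. Qed.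

Lemma ncardU A B : finite_set A -> finite_set B -> A `&` B = set0 ->
  ncard (A `|` B) = (ncard A + ncard B)%N.
Proof.
move=> fA fB AB0; rewrite /ncard fset_setU// cardfsU -fset_setI// AB0.
by rewrite fset_set0 cardfs0 subn0.
Qed.

Lemma ncard_le A B : finite_set B -> A `<=` B -> (ncard A <= ncard B)%N.
Proof.
move=> fB AB; apply: fsubset_leq_card; rewrite -fset_set_sub//.
exact: sub_finite_set fB.
Qed.

Lemma ncard_inj_le (f : R -> R) A B : finite_set A -> finite_set B ->
  (forall x, A x -> B (f x)) -> (forall x y, A x -> A y -> f x = f y -> x = y) ->
  (ncard A <= ncard B)%N.
Proof.
move=> fA fB fAB finj; rewrite /ncard.
have -> : #|` fset_set A| = #|` [fset f x | x in fset_set A]|%fset.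
  by rewrite card_in_imfset//= => x y; rewrite !in_fset_set// => /set_mem ? /set_mem ?; exact: finj.
apply: fsubset_leq_card; apply/fsubsetP => y /imfsetP[x /= xA ->].
by move: xA; rewrite !in_fset_set// => /set_mem/fAB ?; exact: mem_set.
Qed.

Lemma ncard_eq1 S : finite_set S -> ncard S = 1%N -> exists x, S = [set x].
Proof.
move=> fS /eqP; rewrite /ncard => /cardfs1P[x Hx]; exists x.
by apply: fset_set_inj => //; rewrite fset_set1.
Qed.

(* A configuration [D] has blue points [D true] and red points [D false]. *)
Definition locfin D := forall c a b, finite_set (D c `&` `]a, b]).

(** Windows open on the left tile without overlap, and a window that starts at a point does not
    count that point; counts can therefore start at a blue point. *)
Definition num D (c : bool) a b := ncard (D c `&` `]a, b]).

Lemma numD D c a b e : locfin D -> a <= b -> b <= e ->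
  num D c a e = (num D c a b + num D c b e)%N.
Proof.
move=> lfD ab be; rewrite /num -ncardU//; last first.
  apply/seteqP; split => // x [[_ +] [_]] /=; rewrite !in_itv/= => /andP[_ xb].
  by move=> /andP[/lt_le_trans/(_ xb)]; rewrite ltxx.
congr ncard; rewrite -setIUr; congr (_ `&` _).
by rewrite -itv_bndbnd_setU.
Qed.

Lemma num_eq0 D c a b : locfin D -> num D c a b = 0%N ->
  forall z, D c z -> a < z -> z <= b -> False.
Proof.
move=> lfD /(ncard_eq0 (lfD _ _ _)) D0 z Dz az zb.
by have : set0 z by rewrite -D0; split => //=; rewrite in_itv/= az zb.
Qed.

Lemma num0 D c a b : (forall z, D c z -> a < z -> z <= b -> False) ->
  num D c a b = 0%N.
Proof.
move=> H; rewrite /num (_ : _ `&` _ = set0) ?ncard0//.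
by apply/seteqP; split => // z [Dz]; rewrite /= in_itv/= => /andP[az zb]; apply: H Dz az zb.
Qed.

Lemma num1 D c a b z : D c z -> a < z -> z <= b ->
  (forall u, D c u -> a < u -> u <= b -> u = z) -> num D c a b = 1%N.
Proof.
move=> Dz az zb H; rewrite /num (_ : _ `&` _ = [set z]) ?ncard1//.
apply/seteqP; split => [u [Du]|u ->] /=; rewrite in_itv/=.
  by move=> /andP[au ub]; exact: H.
by rewrite az zb.
Qed.

Lemma num_eq1 D c a b : locfin D -> num D c a b = 1%N ->
  exists z, [/\ D c z, a < z, z <= b &
   forall u, D c u -> a < u -> u <= b -> u = z].
Proof.
move=> lfD /(ncard_eq1 (lfD _ _ _))[z Hz]; exists z.
have : (D c `&` `]a, b]) z by rewrite Hz.
move=> [Dz]; rewrite /= in_itv/= => /andP[az zb]; split => // u Du au ub.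
have : (D c `&` `]a, b]) u by split => //=; rewrite in_itv/= au ub.
by rewrite Hz.
Qed.

Lemma num_leq D c a b a' b' : locfin D -> a' <= a -> b <= b' ->
  (num D c a b <= num D c a' b')%N.
Proof.
move=> lfD aa bb; apply: ncard_le; first exact: lfD.
move=> z [Dz]; rewrite /= in_itv/= => /andP[az zb].
by split => //; rewrite /= in_itv/= (le_lt_trans aa az) (le_trans zb bb).
Qed.

Lemma finite_min S x : finite_set S -> S x ->
  exists2 z, S z & forall u, S u -> z <= u.
Proof.
move=> fS Sx; pose l := fset_set S.
have xl : x \in l by rewrite in_fset_set//; exact: mem_set.
have [z zl zmin] : exists2 z, z \in l & forall u, u \in l -> z <= u.
  elim/finSet_rect: l x xl {fS Sx} => X IH x xX.
  have [X0|/fset0Pn[y yX']] := eqVneq (X `\ x)%fset fset0.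
    exists x => // u uX; have [->//|ux] := eqVneq u x.
    have : u \in (X `\ x)%fset by rewrite !inE ux.
    by rewrite X0 inE.
  have [|z zX zmin] := IH (X `\ x)%fset _ y yX'; first exact: fproperD1.
  have zX' : z \in X by move: zX; rewrite !inE => /andP[].
  have [xz|zx] := leP x z.
    exists x => // u uX; have [->//|ux] := eqVneq u x.
    by apply: (le_trans xz); apply: zmin; rewrite !inE ux.
  exists z => // u uX; have [->|ux] := eqVneq u x; first exact: ltW.
  by apply: zmin; rewrite !inE ux.
exists z; first by move: zl; rewrite in_fset_set// => /set_mem.
by move=> u Su; apply: zmin; rewrite in_fset_set//; exact: mem_set.
Qed.

Lemma finite_max S x : finite_set S -> S x ->
  exists2 z, S z & forall u, S u -> u <= z.
Proof.
move=> fS Sx.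
have [||z [u Su <-] zmin] := @finite_min (-%R @` S) (- x); [exact: finite_image|by exists x|].
exists u => // v Sv; rewrite -lerN2; apply: zmin; by exists v.
Qed.

(** A nearest point to the right exists by finiteness, and half the distance to it is free; with no
    point within distance 1, the value 1 serves. All grid limits rest on such free stretches. *)
Lemma locfin_gap D c a : locfin D -> exists2 e : R, 0 < e &
  forall z, D c z -> a < z -> z <= a + e -> False.
Proof.
move=> lfD; have [[z [Dz za zb]]|Hn] := pselect (exists z, [/\ D c z, a < z & z <= a + 1]).
  have Sz : (D c `&` `]a, a + 1]) z by split => //=; rewrite in_itv/= za zb.
  have [u [Du]] := finite_min (lfD c a (a + 1)) Sz.
  rewrite /= in_itv/= => /andP[au ub] umin.
  exists ((u - a) / 2); first by rewrite divr_gt0// subr_gt0.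
  move=> v Dv av va.
  have : u <= v by apply: umin; split => //=; rewrite in_itv/= av/=; lra.
  lra.
exists 1 => // z Dz az za; apply: Hn; by exists z.
Qed.

End Counting.

Arguments num {R} D c (a b)%_ring_scope.

(** * Cylinder events and gaps *)

Section Points.
Context {R : realType}.
Implicit Types (D : bool -> set R) (x y z t : R) (c : bool) (s : seq (R * nat * nat)).

(* Each entry [(d, k, l)] of [s] prescribes [k] blue and [l] red points in a window
   of length [d]; the windows are consecutive and start at [x]. *)
Fixpoint cyl s D x : Prop :=
  if s is (d, k, l) :: s' then
    [/\ num D true x (x + d) = k, num D false x (x + d) = l & cyl s' D (x + d)]
  else True.

Lemma locfin_gap2 D x : locfin D -> exists2 e : R, 0 < e &
  forall c z, D c z -> x < z -> z <= x + e -> False.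
Proof.
move=> lfD; have [e1 e1p H1] := locfin_gap true x lfD.
have [e2 e2p H2] := locfin_gap false x lfD.
exists (Num.min e1 e2); first by rewrite lt_min e1p e2p.
move=> [] z Dz xz zx; [apply: (H1 z)|apply: (H2 z)] => //.
  by apply: (le_trans zx); rewrite lerD2l ge_min lexx.
by apply: (le_trans zx); rewrite lerD2l ge_min lexx orbT.
Qed.

(** Moving the base to the right changes a window count only if a point crosses an end of the
    window, and to the right of each end there is a free stretch. Grid cells replace a point by a
    base slightly to its right, hence this one-sided continuity. *)
Lemma cyl_right_cont s D x : locfin D -> exists2 e : R, 0 < e &
  forall y, x <= y -> y < x + e -> cyl s D y = cyl s D x.
Proof.
move=> lfD; elim: s x => [|[[d k] l] s IH] x; first by exists 1.
have [e1 e1p H1] := locfin_gap2 x lfD.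
have [e2 e2p H2] := locfin_gap2 (x + d) lfD.
have [e3 e3p H3] := IH (x + d).
exists (Num.min e1 (Num.min e2 e3)); first by rewrite !lt_min e1p e2p e3p.
move=> y xy yx.
have y1 : y < x + e1 by apply: (lt_le_trans yx); rewrite lerD2l ge_min lexx.
have y2 : y < x + e2 by apply: (lt_le_trans yx); rewrite lerD2l !ge_min lexx !orbT.
have y3 : y < x + e3 by apply: (lt_le_trans yx); rewrite lerD2l !ge_min lexx !orbT.
have E c : num D c y (y + d) = num D c x (x + d).
  rewrite /num; congr ncard; apply/seteqP; split => z [Dz]; rewrite /= in_itv/= => /andP[za zb];
    split => //; rewrite /= in_itv/=; apply/andP; split.
  - exact: le_lt_trans za.
  - rewrite leNgt; apply/negP => xz; apply: (H2 c z Dz xz); lra.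
  - rewrite ltNge; apply/negP => zy; apply: (H1 c z Dz za); lra.
  - lra.
by rewrite /= !E H3//; lra.
Qed.

(** A point of both colours is refused, so that the sign of [gap] is unambiguous. *)
Definition isfirst D x z :=
  [/\ x < z, exists2 c, D c z & ~ D (~~ c) z & forall c u, D c u -> x < u -> z <= u].

Definition nxt D x := xget x [set z | isfirst D x z].

(* Signed by colour, positive for red.  The value is [0] when there is no first
   point after [x] or when it has both colours, since then [nxt D x = x]. *)
Definition gap D x := if `[< D true (nxt D x) >] then x - nxt D x else nxt D x - x.

Lemma isfirst_nxt D x z : isfirst D x z -> nxt D x = z.
Proof.
move=> Fz; rewrite /nxt; case: xgetP => [y _ Fy|/(_ z)//].
move: Fz Fy => [xz [c cz _] zmin] [xy [c' cy _] ymin].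
by apply/eqP; rewrite eq_le (ymin _ _ cz xz) (zmin _ _ cy xy).
Qed.

Lemma nxt_cases D x : isfirst D x (nxt D x) \/
  (nxt D x = x /\ forall z, ~ isfirst D x z).
Proof.
have [[z Fz]|H] := pselect (exists z, isfirst D x z).
  by left; rewrite (isfirst_nxt Fz).
right; split; last by move=> z Fz; apply: H; exists z.
by rewrite /nxt; case: xgetP => // y _ Fy; case: H; exists y.
Qed.

Lemma nxt_ge D x : x <= nxt D x.
Proof. by case: (nxt_cases D x) => [[/ltW]|[->]]. Qed.

Lemma normr_gap D x : `|gap D x| = nxt D x - x.
Proof.
rewrite /gap; case: asboolP => _; first by rewrite distrC ger0_norm// subr_ge0 nxt_ge.
by rewrite ger0_norm// subr_ge0 nxt_ge.
Qed.

Lemma nxtE D x : nxt D x = x + `|gap D x|.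
Proof. by rewrite normr_gap addrC subrK. Qed.

Lemma gap_neq0 D x : gap D x != 0 -> isfirst D x (nxt D x).
Proof.
case: (nxt_cases D x) => [//|[nx _]]; rewrite -normr_eq0 normr_gap nx subrr.
by rewrite eqxx.
Qed.

(** For [t >= 0]: the signed gaps that lead to a point of colour [c] at distance more than [t]. *)
Definition ray (c : bool) t : set R := if c then [set y | y < - t] else [set y | t < y].

Lemma gap_ray D x c t : 0 <= t ->
  ray c t (gap D x) <-> exists z, [/\ isfirst D x z, D c z & t < z - x].
Proof.
move=> t0; split; last first.
  move=> [z [Fz Dz tz]]; rewrite /gap (isfirst_nxt Fz).
  move: (Fz) => [_ [c' Dc' nDc'] _].
  case: c Dz => Dz; first by rewrite asboolT//= ltrNr opprB.
  by rewrite asboolF//=; case: c' Dc' nDc'.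
have [F|[nx _]] := nxt_cases D x; last first.
  rewrite /gap nx subrr if_same; case: c => /=; last by rewrite ltNge t0.
  by rewrite oppr_gt0 ltNge t0.
move: (F) => [xn [c' Dc' nDc'] _]; exists (nxt D x).
rewrite /gap in H *; case: asboolP H => Dt; case: c => /= H.
- split => //; by rewrite -ltrN2 opprB.
- exfalso; lra.
- exfalso; lra.
- split => //; by case: c' Dc' nDc'.
Qed.

Definition grid (n : nat) : R := n.+1%:R^-1.

Lemma grid_gt0 n : 0 < grid n. Proof. by rewrite invr_gt0 ltr0n. Qed.

Lemma grid_lt (e : R) : 0 < e -> exists n0, forall n, (n0 <= n)%N -> grid n < e.
Proof.
move=> e0; exists (Num.bound e^-1) => n Hn.
rewrite /grid -[ltRHS]invrK ltf_pV2 ?posrE ?invr_gt0 ?ltr0n//.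
apply: (lt_le_trans (archi_boundP _)); first by rewrite invr_ge0 ltW.
by rewrite ler_nat ltnW.
Qed.

Lemma ceil_cell (a d : R) : 0 < a -> 0 < d ->
  exists j : nat, j%:R * d < a <= j%:R * d + d.
Proof.
move=> a0 d0.
have ex : exists m : nat, a <= m%:R * d.
  exists (Num.bound (a / d)); rewrite -ler_pdivrMr//; apply/ltW/archi_boundP.
  by rewrite divr_ge0// ltW.
have [[|m] Hm Hmin] := ex_minnP ex; first by move: Hm; rewrite mul0r leNgt a0.
exists m; move: Hm; rewrite -natr1 mulrDl mul1r => ->; rewrite andbT.
by rewrite ltNge; apply/negP => /Hmin; rewrite ltnn.
Qed.

Lemma cell_sound D x c t (d : R) (j : nat) s : locfin D -> 0 <= t -> 0 < d ->
  cyl ((t + j%:R * d, 0%N, 0%N) :: (d, (c : nat), (~~ c : nat)) :: s) D x ->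
  exists z, [/\ isfirst D x z, D c z, t + j%:R * d < z - x, z - x <= t + j%:R * d + d
    & cyl s D (x + (t + j%:R * d) + d)].
Proof.
move=> lfD t0 d0 [Nt0 Nf0 [Nt Nf cs]].
set y := x + (t + j%:R * d) in Nt0 Nf0 Nt Nf cs *.
have xy : x <= y by rewrite lerDl addr_ge0// mulr_ge0// ltW.
have N0 c' : num D c' x y = 0%N by case: c'.
have Nc : num D c y (y + d) = 1%N by case: (c) Nt Nf.
have Nn : num D (~~ c) y (y + d) = 0%N by case: (c) Nt Nf.
have [z [Dz yz zy zuniq]] := num_eq1 lfD Nc.
exists z; split => //; [|by rewrite /y in yz; lra|by rewrite /y in zy; lra].
split; [exact: le_lt_trans yz| |].
  by exists c => // Dn; exact: (num_eq0 lfD Nn Dn).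
move=> c' u Du xu; have [uy|yu] := leP u y.
  by exfalso; apply: (num_eq0 lfD (N0 c') Du).
have [ud|/ltW du] := leP u (y + d); last exact: le_trans du.
have [E|E] := eqVneq c' c; first by rewrite (zuniq u)// -E.
have Ec : c' = ~~ c by move: E; case: (c'); case: (c).
by exfalso; apply: (num_eq0 lfD Nn _ yu ud); rewrite -Ec.
Qed.

(** Converse of [cell_sound] on a fine mesh: the free stretch after [z] ensures that the cell of [z]
    holds no second point. *)
Lemma cell_complete D x c t (d : R) (j : nat) s z : locfin D -> 0 <= t -> 0 < d ->
  isfirst D x z -> D c z -> t + j%:R * d < z - x <= t + j%:R * d + d ->
  (forall c' u, D c' u -> z < u -> u <= z + d -> False) ->
  cyl s D (x + (t + j%:R * d) + d) ->
  cyl ((t + j%:R * d, 0%N, 0%N) :: (d, (c : nat), (~~ c : nat)) :: s) D x.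
Proof.
move=> lfD t0 d0 [xz [c' Dc' nDc'] zmin] Dz /andP[j1 j2] iso cs.
have Ec : c' = c by case: c c' Dz Dc' nDc' => [] [].
subst c'; have j0 : 0 <= j%:R * d by rewrite mulr_ge0// ltW.
have N0 c' : num D c' x (x + (t + j%:R * d)) = 0%N.
  by apply: num0 => u Du xu ux; have := zmin _ _ Du xu; lra.
have Nc : num D c (x + (t + j%:R * d)) (x + (t + j%:R * d) + d) = 1%N.
  apply: (@num1 _ _ _ _ _ z) => //; [lra|lra|].
  move=> u Du xu ux.
  have xu' : x < u by lra.
  have := zmin _ _ Du xu'; rewrite le_eqVlt => /orP[/eqP->//|zu].
  by exfalso; apply: (iso _ _ Du zu); lra.
have Nn : num D (~~ c) (x + (t + j%:R * d)) (x + (t + j%:R * d) + d) = 0%N.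
  apply: num0 => u Du xu ux.
  have xu' : x < u by lra.
  have := zmin _ _ Du xu'; rewrite le_eqVlt => /orP[/eqP zu|zu].
    by apply: nDc'; rewrite zu.
  by apply: (iso _ _ Du zu); lra.
by split => //; split => //; case: (c) Nc Nn.
Qed.

(* On a fine enough grid, the first point beyond [x] is detected by a run of empty
   cells followed by a cell holding exactly one point. *)
Lemma step_cvg D x c t s : locfin D -> 0 <= t ->
  exists n0, forall n, (n0 <= n)%N ->
  (exists j : nat,
    cyl ((t + j%:R * grid n, 0%N, 0%N) :: (grid n, (c : nat), (~~ c : nat)) :: s) D x)
  <-> ray c t (gap D x) /\ cyl s D (nxt D x).
Proof.
move=> lfD t0.
(* Below [e1], the later windows may start at the end of the cell instead of at the point; below
   [e2], the point is alone in its cell. *)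
have [e1 e1p H1] := cyl_right_cont s (nxt D x) lfD.
have [e2 e2p H2] := locfin_gap2 (nxt D x) lfD.
have [n0 Hn0] : exists n0, forall n, (n0 <= n)%N -> grid n < Num.min e1 e2.
  by apply: grid_lt; rewrite lt_min e1p e2p.
exists n0 => n /Hn0; rewrite lt_min => /andP[n1 n2]; have d0 := grid_gt0 n.
split.
  move=> [j /(cell_sound lfD t0 d0)[z [Fz Dz z1 z2 cs]]].
  have j0 : 0 <= j%:R * grid n by rewrite mulr_ge0// ltW.
  have nz := isfirst_nxt Fz; split.
    apply/(gap_ray D x c t0); exists z; split => //.
    lra.
  by rewrite -(H1 (x + (t + j%:R * grid n) + grid n)) ?nz//; lra.
move=> [/(gap_ray D x c t0)[z [Fz Dz tz]] cs]; have nz := isfirst_nxt Fz.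
have tz' : 0 < z - x - t by lra.
have [j /andP[j1 j2]] := ceil_cell tz' d0; exists j.
apply: (cell_complete lfD t0 d0 Fz Dz) => //.
- by apply/andP; split; lra.
- by move=> c' u Du zu uz; apply: (H2 c' u Du); rewrite nz//; lra.
- by rewrite H1//; rewrite nz; lra.
Qed.

End Points.

(** * Limits of events that stabilise at each sample point *)

Section EventualSets.
Context {R : realType} d (T : measurableType d).

(** The threshold may depend on [w]: this is pointwise convergence of indicators, enough for
    measurability and for convergence under a finite measure. *)
Definition eventually_equal (Z_ : nat -> set T) (Z : set T) :=
  forall w, exists n0, forall n, (n0 <= n)%N -> Z_ n w <-> Z w.

Lemma eventually_equal_measurable Z_ Z : (forall n, measurable (Z_ n)) -> eventually_equal Z_ Z ->
  measurable Z.
Proof.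
move=> mZ ev.
have -> : Z = \bigcup_m \bigcap_n Z_ (m + n)%N.
  apply/seteqP; split => [w Zw|w [m _ Hm]].
    have [n0 H] := ev w; exists n0 => // n _ /=.
    by apply/H => //; exact: leq_addr.
  have [n0 H] := ev w; by apply/(H (m + n0)%N (leq_addl _ _)); exact: (Hm n0 I).
by apply: bigcupT_measurable => m; apply: bigcapT_measurable.
Qed.

(** The union [F m] of the symmetric differences from index [m] on decreases to the empty set,
    because each [w] leaves them eventually. Finiteness of [mu] gives [mu (F m) --> 0], and
    [mu (Z_ n)] differs from [mu Z] by at most [mu (F n)]. *)
Lemma eventually_equal_measure (mu : {measure set T -> \bar R}) Z_ Z : (mu setT < +oo)%E ->
  (forall n, measurable (Z_ n)) -> eventually_equal Z_ Z -> mu (Z_ n) @[n --> \oo] --> mu Z.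
Proof.
move=> mufin mZ ev; have mZ' := eventually_equal_measurable mZ ev.
pose E n := (Z_ n `\` Z) `|` (Z `\` Z_ n).
pose F m := \bigcup_n E (m + n)%N.
have mE n : measurable (E n) by apply: measurableU; exact: measurableD.
have mF m : measurable (F m) by exact: bigcupT_measurable.
have fin S : measurable S -> mu S \is a fin_num.
  move=> mS; rewrite ge0_fin_numE//; apply: le_lt_trans mufin.
  by apply: le_measure => //; apply: mem_set.
have F0 : mu \o F @ \oo --> 0%E.
  rewrite [X in _ --> X](_ : _ = mu (\bigcap_n F n)); last first.
    rewrite (_ : \bigcap_n F n = set0) ?measure0//.
    apply/seteqP; split => // w Fw; have [n0 H] := ev w.
    have [n _ /= En] := Fw n0 I; have := H (n0 + n)%N (leq_addr _ _).
    by case: En => -[? ?]; tauto.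
  apply: nonincreasing_cvg_mu => //.
  - by have := fin _ (mF 0%N); rewrite ge0_fin_numE.
  - exact: bigcapT_measurable.
  - move=> m n mn; apply/subsetPset => w [k _ Ek]; exists (n - m + k)%N => //.
    by rewrite addnA subnKC.
apply: (@squeeze_cvge _ _ _ _ (fun n => mu Z - mu (F n))%E _ (fun n => mu Z + mu (F n))%E).
- apply: nearW => n; apply/andP; split.
    rewrite leeBlDr ?fin// (@le_trans _ _ (mu (Z_ n `|` F n)))//; last exact: measureU2.
    apply: le_measure; [exact: mem_set|by apply: mem_set; exact: measurableU|].
    move=> w Zw; have [?|nZ] := pselect (Z_ n w); [by left|right].
    by exists 0%N => //; rewrite addn0; right.
  rewrite (@le_trans _ _ (mu (Z `|` F n)))//; last exact: measureU2.
  apply: le_measure; [exact: mem_set|by apply: mem_set; exact: measurableU|].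
  move=> w Zw; have [?|nZ] := pselect (Z w); [by left|right].
  by exists 0%N => //; rewrite addn0; left.
- rewrite -[X in _ --> X]sube0; apply: cvgeB => //; [by rewrite fin_num_adde_defr ?fin|exact: cvg_cst].
- rewrite -[X in _ --> X]adde0; apply: cvgeD => //; [by rewrite fin_num_adde_defr ?fin|exact: cvg_cst].
Qed.

End EventualSets.

Section Poisson.
Context {R : realType}.
Implicit Types (a : bool -> R) (s : seq (R * nat * nat)).

Lemma geometric_eseries (c z : R) : 0 <= z < 1 ->
  (\sum_(0 <= j <oo) (c * z ^+ j)%:E)%E = (c / (1 - z))%:E.
Proof.
move=> /andP[z0 z1]; apply/cvg_lim => //.
rewrite (_ : (fun n => _) = EFin \o series (geometric c z)); last first.
  by apply/funext => n /=; rewrite sumEFin.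
by apply: cvg_EFin; [exact: nearW|apply: cvg_geometric_series; rewrite ger0_norm].
Qed.

Lemma grid_cvg : @grid R n @[n --> \oo] --> (0 : R).
Proof. exact: cvg_harmonic. Qed.

(* the chance that exactly one point falls into the first nonempty cell tends to 1 *)
Lemma cell_ratio_cvg (L : R) : 0 < L ->
  grid n * expR (- (L * grid n)) / (1 - expR (- (L * grid n))) @[n --> \oo] --> L^-1.
Proof.
move=> L0.
apply: (@squeeze_cvgr _ _ _ _ (fun n => L^-1 - grid n) (fun=> L^-1)); last 2 first.
- rewrite -[X in _ --> X]subr0; apply: cvgB; [exact: cvg_cst|exact: grid_cvg].
- exact: cvg_cst.
apply: nearW => n; have d0 := @grid_gt0 R n; set u := L * grid n.
have u0 : 0 < u by rewrite mulr_gt0.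
have e1 : expR (- u) < 1 by rewrite -expR0 ltr_expR oppr_lt0.
have e0 := expR_gt0 (- u).
(* The inequality [1 + x <= expR x] at [- u] and at [u] places [u * expR (- u) / (1 - expR (- u))]
   between [1 - u] and [1]. *)
have h1 : 1 - u <= expR (- u) by have := expR_ge1Dx (- u).
have h2 : u * expR (- u) <= 1 - expR (- u).
  have := expR_ge1Dx u; rewrite -(ler_pM2r e0) -expRD subrr expR0.
  by rewrite mulrDl mul1r; lra.
have gE : grid n = u / L by rewrite /u mulrC mulKf// gt_eqF.
have p0 : 0 < 1 - expR (- u) by lra.
apply/andP; split.
  rewrite ler_pdivlMr// gE (_ : L^-1 - u / L = (1 - u) / L); last by rewrite mulrBl mul1r.
  rewrite mulrAC [leRHS]mulrAC ler_pM2r ?invr_gt0//.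
  have : (1 - u) * (1 - expR (- u)) <= expR (- u) * (1 - expR (- u)) by rewrite ler_pM2r.
  move=> /le_trans; apply; rewrite [leRHS]mulrC ler_pM2l//; lra.
rewrite ler_pdivrMr// gE mulrAC [leRHS]mulrC ler_pM2r ?invr_gt0//.
Qed.

Definition cylpr a s : R :=
  \prod_(q <- s) (poisson_pmf_R (a true * q.1.1) q.1.2 * poisson_pmf_R (a false * q.1.1) q.2).

Definition nneg s := all (fun q => 0 <= q.1.1) s.

Lemma cylpr_cell a (c : bool) (t dl : R) s :
  cylpr a ((t, 0%N, 0%N) :: (dl, (c : nat), (~~ c : nat)) :: s) =
  expR (- ((a true + a false) * t)) *
  (a c * dl * expR (- ((a true + a false) * dl))) * cylpr a s.
Proof.
rewrite /cylpr !big_cons mulrA; congr (_ * _); rewrite /poisson_pmf_R /=.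
rewrite !expr0 !mulrDl !opprD !expRD !fact0.
by case: c => /=; rewrite ?fact0 ?factS ?fact0 ?expr0 ?expr1 ?divr1 ?mulr1 ?muln1 ?divr1; ring.
Qed.

End Poisson.

(** * The gap to the next point of a Poisson process *)

Section Step.
Context {R : realType} d (T : measurableType d) (P : probability T R).
Context (D : T -> bool -> set R) (lfD : forall w, locfin (D w)).
Implicit Types (c : bool) (t : R) (tau : T -> R) (a : bool -> R) (A : set T) (s : seq (R * nat * nat)).

Definition cylset tau s : set T := [set w | cyl s (D w) (tau w)].

Definition cyl_measurable tau := forall s, nneg s -> measurable (cylset tau s).

(* After [tau], and independently of [A], the process is Poisson with rates [a],
   as far as finite-window counts are concerned. *)
Definition pois_at A tau a :=
  forall s, nneg s -> P (A `&` cylset tau s) = (P A * (cylpr a s)%:E)%E.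

Definition nxtv tau w := nxt (D w) (tau w).
Definition gapv tau w := gap (D w) (tau w).

Definition cell_event tau c t s n j :=
  cylset tau ((t + j%:R * grid n, 0%N, 0%N) :: (grid n, (c : nat), (~~ c : nat)) :: s).

Lemma cell_nneg (t : R) s n j (k l : nat) : 0 <= t -> nneg s ->
  nneg ((t + j%:R * grid n, 0%N, 0%N) :: (grid n, k, l) :: s).
Proof.
move=> t0 ns; have d0 := @grid_gt0 R n; apply/and3P; split => //=; last exact: ltW.
by rewrite addr_ge0// mulr_ge0// ltW.
Qed.

Definition step_event tau c t s := [set w | ray c t (gapv tau w)] `&` cylset (nxtv tau) s.

Lemma cell_eventually_equal tau c t s : 0 <= t ->
  eventually_equal (fun n => \bigcup_j cell_event tau c t s n j) (step_event tau c t s).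
Proof.
move=> t0 w; have [n0 H] := step_cvg (tau w) c s (lfD w) t0.
exists n0 => n /H[H1 H2]; split => [[j _ Hj]|Sw]; first by apply: H1; exists j.
by have [j Hj] := H2 Sw; exists j.
Qed.

Lemma step_measurable tau c t s : cyl_measurable tau -> 0 <= t -> nneg s ->
  measurable (step_event tau c t s).
Proof.
move=> mtau t0 ns; apply: eventually_equal_measurable (cell_eventually_equal _ _ _ t0) => n.
by apply: bigcupT_measurable => j; apply: mtau; exact: cell_nneg.
Qed.

(** At mesh [grid n], each empty cell before the point costs a factor [expR (- (L * grid n))], so
    the disjoint cell events form a geometric series; refining the mesh turns it into an exponential
    distance with an independent colour. The pattern [s] factors out because its windows begin after
    the cell. *)
Lemma step_prob A tau a c t s : measurable A -> cyl_measurable tau -> pois_at A tau a ->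
  0 < a true + a false -> 0 <= t -> nneg s ->
  P (A `&` step_event tau c t s) =
  (P A * (expR (- ((a true + a false) * t)) * (a c / (a true + a false)) * cylpr a s)%:E)%E.
Proof.
move=> mA mtau pA; set L := a true + a false => L0 t0 ns.
have PAfin : P A \is a fin_num by exact: fin_num_measure.
set pa := fine (P A); have PAE : P A = pa%:E by rewrite fineK.
have mcell n j : measurable (cell_event tau c t s n j) by apply: mtau; exact: cell_nneg.
have Pn n : P (A `&` \bigcup_j cell_event tau c t s n j) =
   (pa * expR (- (L * t)) * a c * cylpr a s *
    (grid n * expR (- (L * grid n)) / (1 - expR (- (L * grid n)))))%:E.
  rewrite setI_bigcupr measure_semi_bigcup; first last.
  - by apply: bigcupT_measurable => j; exact: measurableI.
  - move=> i j _ _ [w [[_ ci] [_ cj]]].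
    have [z [Fz _ i1 i2 _]] := cell_sound (lfD w) t0 (@grid_gt0 R n) ci.
    have [z' [Fz' _ j1 j2 _]] := cell_sound (lfD w) t0 (@grid_gt0 R n) cj.
    have zz : z' = z by rewrite -(isfirst_nxt Fz') (isfirst_nxt Fz).
    subst z'; have d0 := @grid_gt0 R n; apply/eqP; rewrite eqn_leq; apply/andP; split.
      have : i%:R * @grid R n < j.+1%:R * grid n by rewrite -natr1 mulrDl mul1r; lra.
      by rewrite ltr_pM2r// ltr_nat ltnS.
    have : j%:R * @grid R n < i.+1%:R * grid n by rewrite -natr1 mulrDl mul1r; lra.
    by rewrite ltr_pM2r// ltr_nat ltnS.
  - by move=> j; exact: measurableI.
  have d0 := @grid_gt0 R n.
  have z01 : 0 <= expR (- (L * grid n)) < 1.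
    by rewrite expR_ge0/= -expR0 ltr_expR oppr_lt0 mulr_gt0.
  rewrite (eq_eseriesr (g := fun j => ((pa * expR (- (L * t)) *
     (a c * grid n * expR (- (L * grid n))) * cylpr a s) * expR (- (L * grid n)) ^+ j)%:E)).
    by rewrite geometric_eseries//; congr EFin; ring.
  move=> j _; rewrite [LHS](pA _ (cell_nneg n j c (~~ c) t0 ns)).
  rewrite PAE -EFinM cylpr_cell; congr EFin.
  rewrite -/L mulrDr opprD expRD -expRM_natl.
  rewrite (_ : - (L * (j%:R * grid n)) = j%:R * - (L * grid n)); last by ring.
  by ring.
have cv1 : P (A `&` \bigcup_j cell_event tau c t s n j) @[n --> \oo] -->
    P (A `&` step_event tau c t s).
  apply: eventually_equal_measure.
  - by apply: le_lt_trans (probability_le1 P measurableT) _; exact: ltry.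
  - by move=> n; apply: measurableI => //; exact: bigcupT_measurable.
  - move=> w; have [n0 H] := cell_eventually_equal tau c s t0 w; exists n0 => n /H[h1 h2].
    by split => -[Aw] => [/h1|/h2].
have cv2 : P (A `&` \bigcup_j cell_event tau c t s n j) @[n --> \oo] -->
    (pa * expR (- (L * t)) * a c * cylpr a s * L^-1)%:E.
  under eq_fun do rewrite Pn.
  apply: cvg_EFin; first exact: nearW.
  by apply: cvgMr; exact: cell_ratio_cvg.
rewrite (cvg_unique _ cv1 cv2)//; rewrite PAE -EFinM; congr EFin; ring.
Qed.

End Step.

(** * Extending product formulas from a pi-system *)

Section RestrictedLaw.
Local Open Scope ereal_scope.
Context d d' (T : measurableType d) (U : measurableType d') (R : realType).
Context (P : {measure set T -> \bar R}) (A : set T) (X : T -> U).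

Definition restricted_law of measurable A & measurable_fun setT X :=
  fun S : set U => P (A `&` X @^-1` S).

Context (mA : measurable A) (mX : measurable_fun setT X).

Let mpre S : measurable S -> measurable (X @^-1` S).
Proof. by move=> mS; rewrite -[X @^-1` S]setTI; exact: mX. Qed.

Let restricted_law0 : restricted_law mA mX set0 = 0.
Proof. by rewrite /restricted_law preimage_set0 setI0 measure0. Qed.

Let restricted_law_ge0 S : 0 <= restricted_law mA mX S.
Proof. exact: measure_ge0. Qed.

Let restricted_law_sigma : semi_sigma_additive (restricted_law mA mX).
Proof.
move=> F mF tF mUF; rewrite /restricted_law preimage_bigcup setI_bigcupr.
apply: measure_semi_sigma_additive.
- by move=> n; apply: measurableI => //; exact: mpre.
- apply/trivIsetP => /= i j _ _ ij; rewrite setIACA -preimage_setI.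
  by move/trivIsetP : tF => /(_ _ _ _ _ ij) ->//; rewrite preimage_set0 setI0.
- by rewrite -setI_bigcupr -preimage_bigcup; apply: measurableI => //; exact: mpre.
Qed.

HB.instance Definition _ := isMeasure.Build _ _ _ (restricted_law mA mX) restricted_law0 restricted_law_ge0 restricted_law_sigma.

End RestrictedLaw.

(** As functions of [S] both sides are finite measures, the law of [X] restricted to [A] and a
    multiple of [Q]. They agree on a pi-system that contains the whole space, hence everywhere. *)
Lemma indep_pi_lambda d d' (T : measurableType d) (U : measurableType d') (R : realType)
    (P : probability T R) (A : set T) (X : T -> U) (Q : {measure set U -> \bar R})
    (G : set (set U)) :
  measurable A -> measurable_fun setT X ->
  @measurable _ U = <<s G >> -> setI_closed G -> G setT ->
  (forall S, G S -> P (A `&` X @^-1` S) = P A * Q S)%E ->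
  forall S, measurable S -> P (A `&` X @^-1` S) = (P A * Q S)%E.
Proof.
move=> mA mX mG GI GT H S mS.
have PAfin : P A \is a fin_num by exact: fin_num_measure.
have pa0 : 0 <= fine (P A) by exact: fine_ge0.
have E B : (P A * Q B = mscale (NngNum pa0) Q B)%E by rewrite /mscale/= fineK.
rewrite -[LHS]/(restricted_law P mA mX S) E.
apply: (measure_unique G (fun=> setT)) => //.
- by rewrite bigcup_const//; exists 0%N.
- by move=> B GB; rewrite -[RHS]E -H.
- move=> _; apply: (@le_lt_trans _ _ (P setT)); last by rewrite probability_setT ltry.
  apply: le_measure => //; apply: mem_set => //; apply: measurableI => //.
  by rewrite -[X in measurable X]setTI; exact: mX.
Qed.

(** * Laws of sequences of gaps *)

Section Rays.
Context {R : realType}.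
Implicit Types (r : option (bool * R)) (l : seq (option (bool * R))) (y : nat -> R).

(** [None] imposes nothing, so a pattern can constrain a late coordinate alone. *)
Definition rset r : set R := if r is Some (c, t) then ray c t else setT.

Definition rvalid r := if r is Some (c, t) then 0 <= t else true.

Definition rprob (a : bool -> R) r : R :=
  if r is Some (c, t) then expR (- ((a true + a false) * t)) * (a c / (a true + a false)) else 1.

(** The empty set is included because rays of opposite colours are disjoint and the family has to be
    closed under intersection. *)
Definition raysys : set (set R) :=
  [set S | S = set0 \/ exists2 r, rvalid r & S = rset r].

Lemma rset_setI r r' : rvalid r -> rvalid r' -> rset r `&` rset r' = set0 \/
  exists2 r'', rvalid r'' & rset r `&` rset r' = rset r''.
Proof.
case: r => [[c t]|]; last by move=> _ v; right; exists r' => //=; rewrite setTI.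
case: r' => [[c' t']|]; last by move=> v _; right; exists (Some (c, t)) => //=; rewrite setIT.
move=> /= t0 t0'; have [<-|cc'] := eqVneq c c'.
  right; exists (Some (c, Num.max t t')); first by rewrite /= le_max t0.
  apply/seteqP; case: c => /=; split => y /=; last 2 first.
  - by rewrite gt_max => -[-> ->].
  - by rewrite gt_max => /andP[-> ->].
  - by rewrite -[_ < - Num.max _ _]ltrN2 opprK gt_max -ltrNr [t < _]ltrNr => -[h1 h2]; rewrite [t' < _]ltrNr h1 h2.
  - rewrite -[_ < - Num.max _ _]ltrN2 opprK gt_max => /andP[]; by rewrite ltrNr => ->; rewrite ltrNr.
left; apply/seteqP; split => // y []; case: c c' cc' => -[]//= _ h1 h2; lra.
Qed.

Lemma raysys_setI : setI_closed raysys.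
Proof.
move=> A B [->|[r vr ->]]; first by rewrite set0I; left.
move=> [->|[r' vr' ->]]; first by rewrite setI0; left.
by case: (rset_setI vr vr') => [->|[r'' vr'' ->]]; [left|right; exists r''].
Qed.

Lemma raysysT : raysys setT. Proof. by right; exists None. Qed.

Lemma raysys_ray c t : 0 <= t -> raysys (ray c t).
Proof. by move=> t0; right; exists (Some (c, t)). Qed.

Lemma measurable_ray (c : bool) (t : R) : measurable (ray c t).
Proof.
by case: c => /=; [rewrite -set_itvNyo|rewrite -set_itvoy].
Qed.

Lemma measurable_raysys : @measurable _ R = <<s raysys >>.
Proof.
apply/seteqP; split => A.
  suff H : (RGenCInfty.G (R:=R)).-sigma.-measurable `<=` <<s raysys >>.
    by move=> mA; apply: H; rewrite -RGenCInfty.measurableE.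
  apply: smallest_sub; first exact: smallest_sigma_algebra.
  move=> _ [x ->]; have [x0|x0] := leP x 0.
    rewrite (_ : [set` _] = ~` ray true (- x)); last first.
      by apply/seteqP; split => y /=; rewrite in_itv/= andbT opprK leNgt => /negP.
    apply: (@sigma_algebraC _ raysys); apply: sub_sigma_algebra.
    by apply: raysys_ray; rewrite oppr_ge0.
  (* The thresholds [x * (1 - grid n)] increase to [x] and stay nonnegative, as rays require. *)
  rewrite (_ : [set` _] = \bigcap_n ray false (x * (1 - grid n))); last first.
    apply/seteqP; split => y; rewrite /= in_itv/= andbT.
      move=> xy n _ /=; apply: lt_le_trans xy; rewrite gtr_pMr// gtrBl.
      exact: grid_gt0.
    move=> H; rewrite leNgt; apply/negP => yx.
    have [n0 Hn] : exists n0, forall n, (n0 <= n)%N -> grid n < (x - y) / x.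
      by apply: grid_lt; rewrite divr_gt0// subr_gt0.
    have := H n0 I; have := Hn n0 (leqnn _); rewrite /= ltr_pdivlMr// mulrBr mulr1 mulrC; lra.
  apply: (@bigcapT_measurable _ (g_sigma_algebraType raysys)) => n; apply: sub_sigma_algebra.
  apply: raysys_ray; rewrite mulr_ge0// ?(ltW x0)// subr_ge0 /grid invf_le1// ?ltr0n//.
  by rewrite ler1n.
apply: smallest_sub; first exact: sigma_algebra_measurable.
move=> _ [->|[[[c t]|] _ ->]] //=; exact: measurable_ray.
Qed.

Lemma measurable_fun_rays d (T : measurableType d) (f : T -> R) :
  (forall c t, 0 <= t -> measurable [set w | ray c t (f w)]) -> measurable_fun setT f.
Proof.
move=> H; apply: (measurability raysys measurable_raysys).
move=> _ [_ [->|[[[c t]|] v ->]] <-]; first by rewrite preimage_set0 setI0.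
  by rewrite setTI; exact: H.
by rewrite preimage_setT setTI.
Qed.

Fixpoint rcyl l y : Prop :=
  if l is r :: l' then rset r (y 0%N) /\ rcyl l' (fun i => y i.+1) else True.

Lemma rcyl_setI l l' : all rvalid l -> all rvalid l' ->
  (forall y, ~ (rcyl l y /\ rcyl l' y)) \/
  exists2 l'', all rvalid l'' & forall y, rcyl l y /\ rcyl l' y <-> rcyl l'' y.
Proof.
elim: l l' => [|r l IH] [|r' l'] /=.
- by move=> _ _; right; exists [::] => // y /=; tauto.
- by move=> _ v; right; exists (r' :: l') => // y /=; tauto.
- by move=> v _; right; exists (r :: l) => // y /=; tauto.
move=> /andP[vr vl] /andP[vr' vl'].
have [E|[r'' vr'' E]] := rset_setI vr vr'.
  left => y [[ry _] [ry' _]].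
  by have : set0 (y 0%N) by rewrite -E.
have [H|[l'' vl'' H]] := IH l' vl vl'.
  by left => y [[_ ly] [_ ly']]; apply: (H (fun i => y i.+1)).
right; exists (r'' :: l'') => [/=|y /=]; first by rewrite vr''.
by rewrite -E -H /setI /=; tauto.
Qed.

Definition rcylsys : set (set (nat -> R)) :=
  [set S | S = set0 \/ exists2 l, all rvalid l & S = [set y | rcyl l y]].

Lemma rcylsys_setI : setI_closed rcylsys.
Proof.
move=> A B [->|[r vr ->]]; first by rewrite set0I; left.
move=> [->|[r' vr' ->]]; first by rewrite setI0; left.
case: (rcyl_setI vr vr') => [H|[l v H]]; [left|right; exists l => //].
  by apply/seteqP; split => // y /= /H.
by apply/seteqP; split => y /= /H.
Qed.

Lemma rcylsysT : rcylsys setT.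
Proof. by right; exists [::] => //; apply/seteqP; split. Qed.

(** The product sigma-algebra, presented by its ray cylinders, so that laws of gap sequences are
    compared on finite patterns only. *)
Definition seqT := g_sigma_algebraType rcylsys.

Definition shift (n : nat) (y : seqT) : seqT := fun i => y (n + i)%N.

Lemma measurable_coord i : measurable_fun setT (fun y : seqT => y i).
Proof.
apply: measurable_fun_rays => c t t0; apply: sub_sigma_algebra.
right; exists (nseq i None ++ [:: Some (c, t)]).
  by rewrite all_cat/= t0 andbT; elim: i.
apply/seteqP; split => y.
  by elim: i y => [|i IH] y //= yi; split => //; exact: (IH (fun i => y i.+1)).
by elim: i y => [|i IH] y //= [] // _; exact: (IH (fun i => y i.+1)).
Qed.

Lemma measurable_rcyl l : all rvalid l -> measurable ([set y | rcyl l y] : set seqT).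
Proof. by move=> v; apply: sub_sigma_algebra; right; exists l. Qed.

Lemma measurable_seqT d (T : measurableType d) (Y : T -> seqT) :
  (forall i, measurable_fun setT (fun w => Y w i)) -> measurable_fun setT Y.
Proof.
move=> mY; apply: (@measurability _ _ T (g_sigma_algebraType rcylsys) setT Y rcylsys erefl).
move=> _ [_ [->|[l v ->]] <-]; first by rewrite preimage_set0 setI0.
rewrite setTI.
elim: l Y mY v => [|r l IH] Y mY /=.
  by move=> _; rewrite (_ : _ @^-1` _ = setT)//; apply/seteqP; split.
move=> /andP[vr vl].
rewrite (_ : _ @^-1` _ = (fun w => Y w 0%N) @^-1` rset r `&`
   (fun w => (fun i => Y w i.+1) : seqT) @^-1` [set y | rcyl l y])//.
apply: measurableI; last by apply: IH => // i; exact: mY.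
rewrite -[X in measurable X]setTI; apply: mY => //.
by case: r vr => [[c t]|] //= _; exact: measurable_ray.
Qed.

Lemma measurable_shift n : measurable_fun setT (shift n).
Proof. by apply: measurable_seqT => i; exact: measurable_coord. Qed.

End Rays.

Arguments seqT R : clear implicits.

Section Gaps.
Context {R : realType}.
Implicit Types (D : bool -> set R) (x : R).

Definition pos D x n := iter n (nxt D) x.

Definition gaps D x : seqT R := fun i => gap D (pos D x i).

Lemma posS D x i : pos D x i.+1 = pos D x i + `|gaps D x i|.
Proof. by rewrite /pos iterS nxtE. Qed.

Lemma gapsS D x i : gaps D x i.+1 = gaps D (nxt D x) i.
Proof. by rewrite /gaps /pos iterSr. Qed.

Lemma pos_sum D x n : pos D x n = x + \sum_(i < n) `|gaps D x i|.
Proof.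
elim: n => [|n IH]; first by rewrite big_ord0 addr0.
by rewrite posS IH big_ord_recr/= addrA.
Qed.

End Gaps.

Section ProbabilitySets.
Context {R : realType} d (T : measurableType d) (P : probability T R).

Lemma probU (A B : set T) : measurable A -> measurable B -> A `&` B = set0 ->
  P (A `|` B) = (P A + P B)%E.
Proof. exact: measureU. Qed.

Lemma prob_sub0 (A B : set T) : measurable A -> measurable B -> A `<=` B ->
  P B = 0%E -> P A = 0%E.
Proof. by move=> mA mB AB B0; exact: (subset_measure0 mA mB AB B0). Qed.

Lemma prob_setC1 (A : set T) : measurable A -> P A = 1%E -> P (~` A) = 0%E.
Proof. by move=> mA A1; rewrite probability_setC// A1 subee. Qed.

Lemma prob_setC0 (A : set T) : measurable A -> P (~` A) = 0%E -> P A = 1%E.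
Proof.
move=> mA; rewrite probability_setC// => /eqP.
by rewrite sube_eq ?fin_num_measure// add0e => /eqP <-.
Qed.

Lemma prob_setI1 (G X : set T) : measurable G -> measurable X -> P G = 1%E ->
  P (X `&` G) = P X.
Proof.
move=> mG mX G1; have mC := measurableC mG.
have C0 := prob_setC1 mG G1.
rewrite -[in RHS](setUIDK X G) probU//; last 3 first.
- exact: measurableI.
- exact: measurableD.
- by apply/seteqP; split => // y [[_ ?] [_ ?]].
rewrite [X in (_ + X)%E](_ : _ = 0%E) ?adde0//.
by apply: (prob_sub0 (measurableD mX mG) mC _ C0) => y [].
Qed.

Lemma prob_bigcap1 (F : nat -> set T) : (forall i, measurable (F i)) ->
  (forall i, P (F i) = 1%E) -> P (\bigcap_i F i) = 1%E.
Proof.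
move=> mF F1; have mI : measurable (\bigcap_i F i) by exact: bigcapT_measurable.
apply: prob_setC0 => //; apply/negligibleP; first exact: measurableC.
rewrite setC_bigcap; apply: negligible_bigcup => i; apply/negligibleP.
  exact: measurableC.
exact: prob_setC1.
Qed.

End ProbabilitySets.

Section Chain.
Context {R : realType} d (T : measurableType d) (P : probability T R).
Context (D : T -> bool -> set R) (lfD : forall w, locfin (D w)).
Implicit Types (c : bool) (t : R) (tau : T -> R) (a : bool -> R) (A : set T).

Local Notation cyl_measurable := (@cyl_measurable R d T D).
Local Notation pois_at := (@pois_at R d T P D).
Local Notation nxtv := (@nxtv R d T D).
Local Notation gapv := (@gapv R d T D).

Lemma gapv_ray_measurable tau c t : cyl_measurable tau -> 0 <= t ->
  measurable [set w | ray c t (gapv tau w)].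
Proof.
move=> mtau t0; have := @step_measurable R d T D lfD tau c t [::] mtau t0 isT.
by rewrite /step_event (_ : cylset _ _ _ = setT) ?setIT//; apply/seteqP.
Qed.

Lemma measurable_gapv tau : cyl_measurable tau -> measurable_fun setT (gapv tau).
Proof. by move=> mtau; apply: measurable_fun_rays => c t t0; exact: gapv_ray_measurable. Qed.

Lemma measurable_nxtv tau : cyl_measurable tau -> measurable_fun setT tau ->
  measurable_fun setT (nxtv tau).
Proof.
move=> mtau mt; rewrite (_ : nxtv tau = fun w => tau w + `|gapv tau w|); last first.
  by apply/funext => w; exact: nxtE.
by apply: measurable_funD => //; apply: measurableT_comp => //; exact: measurable_gapv.
Qed.

Lemma gap_trichotomy y : [\/ ray true 0 y, ray false 0 y | y = 0 :> R].
Proof.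
rewrite /ray /= oppr0; case: (ltgtP y 0) => [|_|->]; [by constructor 1|by constructor 2|].
by constructor 3.
Qed.

Lemma gapv_eq0 tau w : gapv tau w = 0 -> nxtv tau w = tau w.
Proof. by move=> g0; rewrite /nxtv nxtE -/(gapv tau w) g0 normr0 addr0. Qed.

(** [step_event] sees nonzero gaps only; where the gap is zero, the base does not move and the event
    is that of [tau]. *)
Lemma nxtv_cylset tau s : cylset D (nxtv tau) s =
  step_event D tau true 0 s `|` step_event D tau false 0 s `|`
  ([set w | gapv tau w = 0] `&` cylset D tau s).
Proof.
apply/seteqP; split => w.
  move=> cw; have [h|h|h] := gap_trichotomy (gapv tau w); [by left; left|by left; right|right].
  by split => //; rewrite /cylset /= -(gapv_eq0 h).
by move=> [[[_ //]|[_ //]]|[/= h]]; rewrite /cylset /= (gapv_eq0 h).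
Qed.

Lemma cyl_measurable_nxt tau : cyl_measurable tau -> cyl_measurable (nxtv tau).
Proof.
move=> mtau s ns; rewrite nxtv_cylset.
apply: measurableU; first by apply: measurableU; exact: step_measurable.
apply: measurableI; last exact: mtau.
rewrite (_ : [set w | _] = gapv tau @^-1` [set 0])//.
by rewrite -[X in measurable X]setTI; apply: measurable_gapv.
Qed.

(* The Markov step: conditioning on one more gap keeps the process Poisson after it. *)
Lemma pois_nxt A tau a r : measurable A -> cyl_measurable tau -> pois_at A tau a ->
  0 < a true + a false -> rvalid r ->
  pois_at (A `&` [set w | rset r (gapv tau w)]) (nxtv tau) a /\
  P (A `&` [set w | rset r (gapv tau w)]) = (P A * (rprob a r)%:E)%E.
Proof.
move=> mA mtau pA L0 vr.
suff H s : nneg s -> P (A `&` [set w | rset r (gapv tau w)] `&` cylset D (nxtv tau) s) =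
    (P A * (rprob a r * cylpr a s)%:E)%E.
  have H0 : P (A `&` [set w | rset r (gapv tau w)]) = (P A * (rprob a r)%:E)%E.
    have := H [::] isT; rewrite (_ : cylset _ _ _ = setT); last by apply/seteqP.
    by rewrite setIT /cylpr big_nil mulr1.
  by split => // s ns; rewrite H// H0 EFinM muleA.
move=> ns; have mg c := gapv_ray_measurable c mtau (lexx 0).
case: r vr => [[c t] /= t0|_].
  by rewrite -setIA -(step_prob lfD c mA mtau pA L0 t0 ns).
rewrite /= mul1r (_ : [set w | [set: R] (gapv tau w)] = setT); last by apply/seteqP; split.
rewrite setIT.
have PAfin : P A \is a fin_num by exact: fin_num_measure.
have S c : P (A `&` step_event D tau c 0 s) = (P A * (a c / (a true + a false) * cylpr a s)%:E)%E.
  by rewrite (step_prob lfD c mA mtau pA L0 (lexx _) ns) mulr0 oppr0 expR0 mul1r.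
have S0 c : P (A `&` [set w | ray c 0 (gapv tau w)]) = (P A * (a c / (a true + a false))%:E)%E.
  have := step_prob lfD c mA mtau pA L0 (lexx 0) (isT : nneg [::]).
  rewrite mulr0 oppr0 expR0 mul1r /cylpr big_nil mulr1 => <-; congr (P (_ `&` _)).
  by rewrite /step_event (_ : cylset _ _ _ = setT) ?setIT//; apply/seteqP.
have tot : a true / (a true + a false) + a false / (a true + a false) = 1.
  by rewrite -mulrDl divff// gt_eqF.
have mz : measurable [set w | gapv tau w = 0].
  rewrite (_ : [set w | _] = gapv tau @^-1` [set 0])//.
  by rewrite -[X in measurable X]setTI; apply: measurable_gapv.
have ms c : measurable (step_event D tau c 0 s) by exact: step_measurable.
have disj B C : B `<=` [set w | ray true 0 (gapv tau w)] ->
    C `<=` [set w | ray false 0 (gapv tau w)] -> A `&` B `&` (A `&` C) = set0.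
  move=> HB HC; apply/seteqP; split => // w [[_ /HB/= h1] [_ /HC/= h2]]; lra.
(* The two colours already exhaust the mass of [A], since their probabilities add up to 1; a missing
   or two-coloured next point is thus negligible. *)
have Z0 : P (A `&` [set w | gapv tau w = 0]) = 0%E.
  have E : P A = (P A + P (A `&` [set w | gapv tau w = 0%R]))%E.
    rewrite {1}(_ : A = (A `&` [set w | ray true 0 (gapv tau w)] `|`
        (A `&` [set w | ray false 0 (gapv tau w)])) `|` (A `&` [set w | gapv tau w = 0])); last first.
      apply/seteqP; split => [w Aw|w [[[]|[]]|[]]//].
      by have [h|h|h] := gap_trichotomy (gapv tau w); [left; left|left; right|right].
    rewrite probU//; [|by apply: measurableU; exact: measurableI|exact: measurableI|].
      rewrite probU//; [|exact: measurableI|exact: measurableI|exact: disj].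
      by rewrite !S0 -muleDr// -EFinD tot mule1.
    apply/seteqP; split => // w [[[_ /= h]|[_ /= h]] [_ /= h']];
      by rewrite h' ?oppr0 ltxx in h.
  have Zfin : P (A `&` [set w | gapv tau w = 0]) \is a fin_num.
    by apply: fin_num_measure; exact: measurableI.
  move: E; rewrite -(fineK PAfin) -(fineK Zfin) -EFinD => -[] E.
  by congr EFin; lra.
rewrite nxtv_cylset setIUr measureU0; first last.
- apply: prob_sub0 Z0 => //; [|exact: measurableI|by move=> w [? [? _]]].
  by apply: measurableI => //; apply: measurableI => //; exact: mtau.
- by apply: measurableI => //; apply: measurableI => //; exact: mtau.
- by apply: measurableI => //; exact: measurableU.
rewrite (setIUr A).
apply: (etrans (probU P (measurableI _ _ mA (ms true)) (measurableI _ _ mA (ms false)) _)).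
  by apply: disj => w [].
by rewrite !S -muleDr// -EFinD -mulrDl tot mul1r.
Qed.

(** Each gap is absorbed into the event [A] and the base moves to the next point ([pois_nxt]). The
    induction needs [A] arbitrary; the same freedom later lets [A] be an event of a second
    stream. *)
Lemma chain_prob A tau a l : measurable A -> cyl_measurable tau -> pois_at A tau a ->
  0 < a true + a false -> all rvalid l ->
  P (A `&` [set w | rcyl l (gaps (D w) (tau w))]) = (P A * (\prod_(r <- l) rprob a r)%:E)%E.
Proof.
elim: l A tau => [|r l IH] A tau mA mtau pA L0 /=.
  by move=> _; rewrite big_nil mule1 (_ : [set _ | _] = setT) ?setIT//; apply/seteqP.
move=> /andP[vr vl]; have [p1 p2] := pois_nxt mA mtau pA L0 vr.
have mr : measurable [set w | rset r (gapv tau w)].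
  case: r vr {p1 p2} => [[c t] t0|_]; first exact: gapv_ray_measurable.
  by rewrite (_ : [set _ | _] = setT)//; apply/seteqP.
rewrite big_cons EFinM muleA -p2 -(IH _ (nxtv tau))//; last 2 first.
- exact: measurableI.
- exact: cyl_measurable_nxt.
rewrite -setIA; congr (P (A `&` _)).
by apply/seteqP; split => w [/= h1 h2]; split => //; move: h2;
  rewrite (_ : (fun i => gaps _ _ i.+1) = gaps (D w) (nxtv tau w))//;
  apply/funext => i; rewrite gapsS.
Qed.

Lemma cyl_measurable_pos tau n : cyl_measurable tau -> measurable_fun setT tau ->
  cyl_measurable (fun w => pos (D w) (tau w) n) /\
  measurable_fun setT (fun w => pos (D w) (tau w) n).
Proof.
move=> mtau mt; elim: n => [//|n [m1 m2]]; split.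
  exact: (cyl_measurable_nxt m1).
exact: (measurable_nxtv m1 m2).
Qed.

Lemma measurable_gaps tau : cyl_measurable tau -> measurable_fun setT tau ->
  measurable_fun setT (fun w => gaps (D w) (tau w)).
Proof.
move=> mtau mt; apply: measurable_seqT => i.
by have [m1 m2] := cyl_measurable_pos i mtau mt; exact: (measurable_gapv m1).
Qed.

End Chain.

Section Law.
Context d d' (T : measurableType d) (U : measurableType d') (R : realType).
Context (P : probability T R) (X : T -> U).

Definition law of measurable_fun setT X := fun S : set U => P (X @^-1` S).

Context (mX : measurable_fun setT X).

Let law0 : law mX set0 = 0%E. Proof. by rewrite /law preimage_set0 measure0. Qed.

Let law_ge0 S : (0 <= law mX S)%E. Proof. exact: measure_ge0. Qed.

Let law_sigma : semi_sigma_additive (law mX).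
Proof.
have := @measure_semi_sigma_additive _ _ _ (restricted_law P measurableT mX).
rewrite (_ : law mX = restricted_law P measurableT mX :> (set U -> \bar R))//.
by apply/funext => S; rewrite /law /restricted_law setTI.
Qed.

HB.instance Definition _ := isMeasure.Build _ _ _ (law mX) law0 law_ge0 law_sigma.

Let law_setT : law mX setT = 1%E.
Proof. by rewrite /law preimage_setT probability_setT. Qed.

HB.instance Definition _ := Measure_isProbability.Build _ _ _ (law mX) law_setT.

End Law.

Lemma measurable_fun_natindex d d' (T : measurableType d) (U : measurableType d')
    (N : T -> nat) (F : nat -> T -> U) :
  (forall n, measurable [set w | N w = n]) -> (forall n, measurable_fun setT (F n)) ->
  measurable_fun setT (fun w => F (N w) w).
Proof.
move=> mN mF _ S mS; rewrite setTI.
rewrite (_ : _ @^-1` S = \bigcup_n ([set w | N w = n] `&` F n @^-1` S)); last first.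
  apply/seteqP; split => [w Sw|w [n _ [/= <-]]//].
  by exists (N w).
apply: bigcupT_measurable => n; apply: measurableI => //.
by rewrite -[X in measurable X]setTI; exact: mF.
Qed.

Lemma measurable_preimage d d' (T : measurableType d) (U : measurableType d')
    (f : T -> U) (S : set U) :
  measurable_fun setT f -> measurable S -> measurable [set w | S (f w)].
Proof. by move=> mf mS; rewrite -[X in measurable X]setTI; exact: mf. Qed.

Section Iid.
Context {R : realType} (nu : probability (seqT R) R).
Implicit Types (S : set (seqT R)) (D : set R) (y : seqT R).

(** With [D] the whole line this says that [nu] is invariant under the shift, so this single
    identity encodes an i.i.d. sequence. *)
Definition iid_law := forall D S, measurable D -> measurable S ->
  nu [set y | D (y 0%N) /\ S (shift 1 y)] = (nu [set y | D (y 0%N)] * nu S)%E.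

(** Two extensions from a pi-system: [stepA] goes from cylinders to all [S] while [D] is a ray, and
    the second passes from rays to all [D]. *)
Lemma rcyl_iid (a : bool -> R) :
  (forall l, all rvalid l -> nu [set y | rcyl l y] = (\prod_(r <- l) rprob a r)%:E) ->
  iid_law.
Proof.
move=> H D S mD mS.
have mc D' : measurable D' -> measurable [set y : seqT R | D' (y 0%N)].
  by move=> mD'; exact: (measurable_preimage (measurable_coord 0)).
have mr (r : option (bool * R)) : rvalid r -> measurable (rset r).
  by case: r => [[c t]|] //= _; exact: measurable_ray.
have stepA (r : option (bool * R)) S' : rvalid r -> measurable S' ->
    nu ([set y | rset r (y 0%N)] `&` shift 1 @^-1` S') =
    (nu [set y | rset r (y 0%N)] * nu S')%E.
  move=> vr mS'.
  apply: (indep_pi_lambda (mc _ (mr _ vr)) (measurable_shift 1) (P := nu) (Q := nu) (G := rcylsys)) => //.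
  - exact: rcylsys_setI.
  - exact: rcylsysT.
  move=> _ [->|[l vl ->]]; first by rewrite preimage_set0 setI0 !measure0 mule0.
  have := H (r :: l); rewrite /= vr => /(_ vl); rewrite big_cons EFinM -(H l)//.
  have := H [:: r]; rewrite /= vr big_cons big_nil mulr1 => /(_ isT) <-.
  rewrite (_ : [set y | rset r (y 0%N) /\ True] = [set y | rset r (y 0%N)])//.
  by apply/seteqP; split => y //= [].
rewrite (_ : [set y | _ /\ _] = shift 1 @^-1` S `&` (fun y => y 0%N) @^-1` D); last first.
  by apply/seteqP; split => y [].
rewrite -[nu [set y | D _]]/(law nu (measurable_coord 0) D) muleC.
have m1 : measurable (shift 1 @^-1` S).
  by rewrite -[X in measurable X]setTI; exact: measurable_shift.
have E1 : nu (shift 1 @^-1` S) = nu S.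
  have := stepA None S isT mS.
  by rewrite (_ : [set y | _] = setT) ?setTI ?probability_setT ?mul1e//; apply/seteqP.
rewrite -E1.
apply: (indep_pi_lambda m1 (measurable_coord 0) (P := nu) (Q := law nu (measurable_coord 0)) (G := raysys)) => //.
- exact: measurable_raysys.
- exact: raysys_setI.
- exact: raysysT.
move=> _ [->|[r vr ->]]; first by rewrite preimage_set0 setI0 !measure0 mule0.
by rewrite setIC stepA// E1 muleC.
Qed.

Hypothesis nu_iid : iid_law.

Lemma shift0 y : shift 0 y = y. Proof. by apply/funext => i; rewrite /shift. Qed.

Lemma shiftS n y : shift n.+1 y = shift n (shift 1 y).
Proof. by apply/funext => i; rewrite /shift addnA add1n. Qed.

Lemma shiftD m n y : shift n (shift m y) = shift (m + n) y.
Proof. by apply/funext => i; rewrite /shift addnA. Qed.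

Definition prefix_set (n : nat) (D : nat -> set R) : set (seqT R) :=
  [set y | forall i, (i < n)%N -> D i (y i)].

Lemma measurable_prefix_set n (D : nat -> set R) : (forall i, measurable (D i)) ->
  measurable (prefix_set n D).
Proof.
move=> mD; case: n => [|n].
  by rewrite (_ : prefix_set _ _ = setT)//; apply/seteqP; split.
rewrite (_ : prefix_set _ _ = \bigcap_(i in [set i | (i < n.+1)%N]) [set y | D i (y i)]); last first.
  by apply/seteqP; split => y H i; exact: H.
apply: bigcap_measurable; first by exists 0%N.
by move=> i _; apply: (measurable_preimage (measurable_coord i)).
Qed.

Lemma prefix_prob n (D : nat -> set R) S : (forall i, measurable (D i)) -> measurable S ->
  nu (prefix_set n D `&` shift n @^-1` S) =
  ((\prod_(i < n) nu [set y | D i (y 0%N)]) * nu S)%E.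
Proof.
elim: n D => [|n IH] D mD mS.
  rewrite big_ord0 mul1e; congr (nu _); apply/seteqP; split => y /=; rewrite shift0.
    by case.
  by move=> Sy; split.
rewrite big_ord_recl -muleA -(IH (fun i => D i.+1))// -nu_iid//; last first.
  apply: measurableI; last by apply: (measurable_preimage (measurable_shift n)).
  exact: measurable_prefix_set.
congr (nu _); apply/seteqP; split => y [h1 h2] /=.
  split; first exact: h1; split => [i ni|].
    exact: (h1 i.+1).
  by rewrite -shiftS.
case: h2 => h2 h3; split; last by rewrite /= shiftS.
by case => // i ni; exact: (h2 i).
Qed.

Definition prefixsys n : set (set (seqT R)) :=
  [set S | exists2 D : nat -> set R, (forall i, measurable (D i)) & S = prefix_set n D].

(** Sequences with the sigma-algebra of the first [n] coordinates. As a type of its own, it lets the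
    measurability lemmas for [firstup] and for partial sums show that an event depends on the past
    only. *)
Definition prefT n := g_sigma_algebraType (prefixsys n).

Lemma measurable_prefix_coord n i : (i < n)%N -> measurable_fun setT (fun y : prefT n => y i).
Proof.
move=> ni _ D mD; rewrite setTI; apply: sub_sigma_algebra.
exists (fun j => if j == i then D else setT); first by move=> j; case: ifP.
apply/seteqP; split => y /=; last by move=> /(_ i ni); rewrite eqxx.
by move=> Dy j nj; case: eqVneq => [->|].
Qed.

Lemma prefT_measurable n (Z : set (seqT R)) : <<s prefixsys n >> Z -> measurable Z.
Proof.
apply: smallest_sub; first exact: sigma_algebra_measurable.
by move=> _ [D mD ->]; exact: measurable_prefix_set.
Qed.

(** The Markov property at a fixed time: prefix rectangles form a pi-system that generates the past,
    and on them [prefix_prob] gives the product. *)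
Lemma block_prob n (Z : set (seqT R)) S : <<s prefixsys n >> Z -> measurable S ->
  nu (Z `&` shift n @^-1` S) = (nu Z * nu S)%E.
Proof.
move=> sZ mS; have mZ := prefT_measurable sZ.
have mS' : measurable (shift n @^-1` S) by exact: (measurable_preimage (measurable_shift n)).
have midT : measurable_fun setT (id : seqT R -> prefT n).
  by move=> _ B mB; rewrite setTI; exact: (@prefT_measurable n).
have pre_setT : prefix_set n (fun=> setT) = setT by apply/seteqP; split.
have E1 : nu (shift n @^-1` S) = nu S.
  have := @prefix_prob n (fun=> setT) S (fun=> measurableT) mS.
  rewrite pre_setT setTI => ->; rewrite big1 ?mul1e// => i _.
  by rewrite (_ : [set y | _] = setT) ?probability_setT//; apply/seteqP.
rewrite setIC muleC -E1 -[nu Z]/(law nu midT Z) -[Z in nu (_ `&` Z)]/((id : seqT R -> prefT n) @^-1` Z).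
apply: (indep_pi_lambda mS' midT (P := nu) (Q := law nu midT) (G := prefixsys n)) => //.
- move=> _ _ [D mD ->] [D' mD' ->].
  exists (fun i => D i `&` D' i); first by move=> i; exact: measurableI.
  by apply/seteqP; split => y; [move=> [h1 h2] i ni; split; [exact: h1|exact: h2]|
    move=> h; split => i ni; have [] := h i ni].
- by exists (fun=> setT).
move=> _ [D mD ->]; rewrite E1 setIC prefix_prob// muleC; congr (_ * _)%E.
have := prefix_prob n mD measurableT; rewrite preimage_setT setIT probability_setT mule1.
by move=> <-.
Qed.

End Iid.

(** * The random walk of gap signs *)

Section Walk.
Context {R : realType}.
Implicit Types (y : seqT R) (e : bool).

(** A zero gap counts as a step down; such gaps turn out to be negligible ([all_neq0_prob]). *)
Definition zstep (x : R) : int := if 0 < x then 1 else -1.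

Definition zwalk y n : int := \sum_(i < n) zstep (y i).

Lemma zwalk0 y : zwalk y 0 = 0. Proof. by rewrite /zwalk big_ord0. Qed.

Lemma zwalkS y n : zwalk y n.+1 = zwalk y n + zstep (y n).
Proof. by rewrite /zwalk big_ord_recr. Qed.

Lemma zwalk_shift y m n : zwalk y (m + n) = zwalk y m + zwalk (shift m y) n.
Proof.
elim: n => [|n IH]; first by rewrite addn0 zwalk0 addr0.
by rewrite addnS !zwalkS IH addrA.
Qed.

Lemma zwalk_up y n (k : int) : 0 <= k -> k <= zwalk y n ->
  exists2 m, (m <= n)%N & zwalk y m = k.
Proof.
move=> k0; elim: n => [|n IH].
  by rewrite zwalk0 => k1; exists 0%N => //; rewrite zwalk0; lia.
rewrite zwalkS => kn; have [kn'|nk] := leP k (zwalk y n).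
  by have [m mn mk] := IH kn'; exists m => //; exact: leqW.
exists n.+1 => //; rewrite zwalkS; move: kn; rewrite /zstep; case: ifP => _; lia.
Qed.

Lemma zwalk_down y n (k : int) : k <= 0 -> zwalk y n <= k ->
  exists2 m, (m <= n)%N & zwalk y m = k.
Proof.
move=> k0; elim: n => [|n IH].
  by rewrite zwalk0 => k1; exists 0%N => //; rewrite zwalk0; lia.
rewrite zwalkS => kn; have [kn'|nk] := leP (zwalk y n) k.
  by have [m mn mk] := IH kn'; exists m => //; exact: leqW.
exists n.+1 => //; rewrite zwalkS; move: kn; rewrite /zstep; case: ifP => _; lia.
Qed.

Definition half e : set R := if e then [set x | 0 < x] else [set x | x <= 0].

Definition zsgn e : int := if e then 1 else -1.

Lemma half_zstep e x : half e x <-> zstep x = zsgn e.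
Proof. by split; rewrite /half /zstep /zsgn; case: e => /=; case: ltP. Qed.

Lemma half_dec e x : half e x \/ half (~~ e) x.
Proof. by rewrite /half; case: e => /=; case: ltP => _; [left|right|right|left]. Qed.

Lemma measurable_half e : measurable (half e).
Proof. by case: e => /=; [rewrite -set_itvoy|rewrite -set_itvNyc]. Qed.

Definition hit e (n k : nat) : set (seqT R) :=
  [set y | exists2 j, (j <= n)%N & zwalk y j = zsgn e * k%:Z].

Lemma hit0 e n : hit e n 0 = setT.
Proof. by apply/seteqP; split => // y _; exists 0%N => //; rewrite zwalk0 mulr0. Qed.

Lemma hit0n e k : hit e 0 k.+1 = set0.
Proof.
apply/seteqP; split => // y [[|//] _]; rewrite zwalk0 /zsgn.
by case: e; lia.
Qed.

(** First-step analysis: a step towards the target leaves distance [k], a step away from it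
    [k.+2]. *)
Lemma hit_rec e n k : hit e n.+1 k.+1 =
  [set y | half e (y 0%N) /\ hit e n k (shift 1 y)] `|`
  [set y | half (~~ e) (y 0%N) /\ hit e n k.+2 (shift 1 y)].
Proof.
have E y j : zwalk y j.+1 = zstep (y 0%N) + zwalk (shift 1 y) j.
  by rewrite -add1n zwalk_shift zwalkS zwalk0 add0r.
apply/seteqP; split => y.
  move=> [[|j] jn]; first by rewrite zwalk0 /zsgn; case: e; lia.
  rewrite E => H; have [h|h] := half_dec e (y 0%N); [left|right]; split => //; exists j => //;
    move/half_zstep: h H => ->; rewrite /zsgn; case: e => /=; lia.
move=> [[/half_zstep h [j jn H]]|[/half_zstep h [j jn H]]]; exists j.+1 => //;
  rewrite E h H; rewrite /zsgn; case: e {h H} => /=; lia.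
Qed.

Lemma measurable_zwalk d (T : measurableType d) (Y : T -> seqT R) n k :
  (forall i, (i < n)%N -> measurable_fun setT (fun w => Y w i)) ->
  measurable [set w | zwalk (Y w) n = k].
Proof.
elim: n k => [|n IH] k mY.
  have [k0|k0] := eqVneq k 0.
    rewrite (_ : [set w | _] = setT)//; apply/seteqP; split => // w _ /=.
    by rewrite zwalk0 k0.
  rewrite (_ : [set w | _] = set0)//; apply/seteqP; split => // w /=.
  by rewrite zwalk0 => k0'; rewrite -k0' eqxx in k0.
have mYn := mY n (ltnSn n).
have mY' i : (i < n)%N -> measurable_fun setT (fun w => Y w i) by move=> ni; apply: mY; lia.
rewrite (_ : [set w | _] = ([set w | half true (Y w n)] `&` [set w | zwalk (Y w) n = k - 1]) `|`
   ([set w | half false (Y w n)] `&` [set w | zwalk (Y w) n = k + 1])); last first.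
  apply/seteqP; split => w /=; rewrite zwalkS.
    by rewrite /zstep; case: ltP => h H; [left|right]; split => //; lia.
  by rewrite /zstep => -[[h H]|[h H]]; move: h; case: ltP => // h _; rewrite H; lia.
by apply: measurableU; apply: measurableI; [|exact: IH| |exact: IH];
  apply: (measurable_preimage mYn); exact: measurable_half.
Qed.

Lemma measurable_hit e n k : measurable (hit e n k).
Proof.
rewrite (_ : hit e n k = \bigcup_(j in [set j | (j <= n)%N]) [set y | zwalk y j = zsgn e * k%:Z]).
  apply: bigcup_measurable => j _; apply: (measurable_zwalk (Y := id)) => i _.
  exact: measurable_coord.
by apply/seteqP; split => y [j h1 h2]; exists j.
Qed.

(** The difference [x ^+ k - h n k] obeys the recursion of [h], since [x] is a root of
    [x = al + be * x ^+ 2]. It vanishes at [k = 0] and is at most [b ^+ k] at [n = 0]; one step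
    multiplies the weight [b ^+ k] by exactly [al / b + be * b]. *)
Lemma harmonic_bound (h : nat -> nat -> R) (al be x b : R) :
  0 < al -> 0 < be -> 0 <= x <= b -> 0 < b -> x = al + be * x ^+ 2 ->
  (forall n, h n 0%N = 1) -> (forall k, h 0%N k.+1 = 0) ->
  (forall n k, h n.+1 k.+1 = al * h n k + be * h n k.+2) ->
  forall n k, `|x ^+ k - h n k| <= (al / b + be * b) ^+ n * b ^+ k.
Proof.
move=> al0 be0 /andP[x0 xb] b0 xE h1 h0 hS; elim => [|n IH] [|k].
- by rewrite h1 expr0 subrr normr0 !expr0 mulr1.
- by rewrite h0 subr0 normrX ger0_norm// expr0 mul1r lerXn2r// ?nnegrE// ltW.
- rewrite h1 expr0 subrr normr0 mulr1 exprn_ge0//.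
  by rewrite addr_ge0// ltW// ?divr_gt0// mulr_gt0.
rewrite hS (_ : x ^+ k.+1 - _ = al * (x ^+ k - h n k) + be * (x ^+ k.+2 - h n k.+2)); last first.
  have -> : x ^+ k.+1 = al * x ^+ k + be * x ^+ k.+2.
    by rewrite -[k.+2]/(2 + k)%N exprD mulrA -mulrDl -xE exprS.
  by ring.
apply: (le_trans (ler_normD _ _)); rewrite !normrM (gtr0_norm al0) (gtr0_norm be0).
have := IH k; rewrite -(ler_pM2l al0) => i1.
have := IH k.+2; rewrite -(ler_pM2l be0) => i2.
apply: (le_trans (lerD i1 i2)).
rewrite le_eqVlt; apply/orP; left; apply/eqP.
have b1 : b != 0 by rewrite gt_eqF.
rewrite [in RHS]exprS ![b ^+ k.+1]exprS [b ^+ k.+2]exprS [b ^+ k.+1]exprS.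
by field.
Qed.

End Walk.

Section HitProb.
Context {R : realType} (nu : probability (seqT R) R) (nu_iid : iid_law nu).
Context (p q : R) (q0 : 0 < q) (qp : q < p) (pq : p + q = 1).
Hypothesis nup : nu [set y | half true (y 0%N)] = p%:E.

Let p0 : 0 < p. Proof. exact: lt_trans qp. Qed.

Definition pstep (e : bool) := if e then p else q.

Lemma nu_half e : nu [set y | half e (y 0%N)] = (pstep e)%:E.
Proof.
case: e; first exact: nup.
rewrite (_ : [set y | _] = ~` [set y | half true (y 0%N)]); last first.
  by apply/seteqP; split => y /=; rewrite leNgt => /negP.
rewrite probability_setC; last first.
  by apply: (measurable_preimage (measurable_coord 0)); exact: measurable_half.
by rewrite nup -EFinB /= -pq addrAC subrr add0r.
Qed.

Lemma hit_prob_rec e n k : fine (nu (hit e n.+1 k.+1)) =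
  pstep e * fine (nu (hit e n k)) + pstep (~~ e) * fine (nu (hit e n k.+2)).
Proof.
have m e' n' k' : measurable [set y : seqT R | half e' (y 0%N) /\ hit e n' k' (shift 1 y)].
  apply: measurableI; first by apply: (measurable_preimage (measurable_coord 0)); exact: measurable_half.
  by apply: (measurable_preimage (measurable_shift 1)); exact: measurable_hit.
rewrite hit_rec probU//; last first.
  apply/seteqP; split => // y [[h1 _] [h2 _]]; move: h1 h2.
  by case: e {m} => /= h1 h2; [move: h1|move: h2]; rewrite ltNge ?h1 ?h2.
rewrite !nu_iid//; try exact: measurable_half; try exact: measurable_hit.
rewrite !nu_half.
have f n' k' : nu (hit e n' k') \is a fin_num by apply: fin_num_measure; exact: measurable_hit.
by rewrite fineD ?fin_numM// !fineM.
Qed.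

Definition hits e k : set (seqT R) := [set y | exists j, zwalk y j = zsgn e * k%:Z].

Lemma measurable_hits e k : measurable (hits e k).
Proof.
rewrite (_ : hits e k = \bigcup_n hit e n k); first by apply: bigcupT_measurable => n; exact: measurable_hit.
apply/seteqP; split => y; first by move=> [j h]; exists j => //; exists j.
by move=> [n _ [j _ h]]; exists j.
Qed.

(* ruin probabilities: x^k is harmonic for the walk and b^k contracts by the
   factor [al/b + be*b < 1], b being the geometric mean of the two harmonic bases *)
Lemma hits_prob e k : nu (hits e k) = ((if e then 1 else (q / p) ^+ k) : R)%:E.
Proof.
(* The harmonic bases are [1] and [p / q] for an upward target, [1] and [q / p] for a downward one.
   Their geometric means [r^-1] and [r] give the same factor [2 * (p * r)], which is below 1 because
   [p + q - 2 * (p * r)] equals [p * (1 - r) ^+ 2]. *)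
pose r := Num.sqrt (q / p).
have r0 : 0 < r by rewrite sqrtr_gt0 divr_gt0.
have rr : r ^+ 2 = q / p by rewrite sqr_sqrtr// ltW// divr_gt0.
have qE : q = r ^+ 2 * p by rewrite rr divfK// gt_eqF.
have r1 : r < 1.
  by rewrite -(@ltr_pXn2r _ 2)// ?nnegrE ?(ltW r0)// rr expr1n ltr_pdivrMr// mul1r.
have g1 : 2 * (p * r) < 1.
  have : 0 < p * (1 - r) ^+ 2 by rewrite mulr_gt0// exprn_gt0// subr_gt0.
  rewrite (_ : _ * _ = p + r ^+ 2 * p - 2 * (p * r)); last by ring.
  by rewrite -qE pq subr_gt0.
have g0 : 0 <= 2 * (p * r) by rewrite mulr_ge0// mulr_ge0// ltW.
pose h n k := fine (nu (hit e n k)).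
pose x : R := if e then 1 else q / p.
pose b : R := if e then r^-1 else r.
have b0 : 0 < b by rewrite /b; case: (e) => //; rewrite invr_gt0.
have H n : `|x ^+ k - h n k| <= (2 * (p * r)) ^+ n * b ^+ k.
  rewrite (_ : 2 * (p * r) = pstep e / b + pstep (~~ e) * b); last first.
    by rewrite /b /pstep; case: (e) => /=; rewrite ?invrK qE; field; rewrite gt_eqF.
  apply: harmonic_bound => //.
  - by rewrite /pstep; case: (e).
  - by rewrite /pstep; case: (e).
  - rewrite /x /b; case: (e); first by rewrite ler01/= invf_ge1// ltW.
    rewrite -rr exprn_ge0 ?(ltW r0)//= expr2 ler_piMl// ltW//.
  - rewrite /x /pstep; case: (e) => /=; first by rewrite expr1n mulr1.
    by rewrite -{1}[q]mulr1 -pq; field; rewrite gt_eqF.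
  - by move=> m; rewrite /h hit0 probability_setT.
  - by move=> m; rewrite /h hit0n measure0.
  - by move=> m m'; rewrite /h hit_prob_rec.
have f n k' : nu (hit e n k') \is a fin_num by apply: fin_num_measure; exact: measurable_hit.
have c1 : nu (hit e n k) @[n --> \oo] --> nu (hits e k).
  rewrite (_ : hits e k = \bigcup_n hit e n k); last first.
    apply/seteqP; split => y; first by move=> [j hj]; exists j => //; exists j.
    by move=> [n _ [j _ hj]]; exists j.
  apply: nondecreasing_cvg_mu.
  - by move=> n; exact: measurable_hit.
  - by apply: bigcupT_measurable => n; exact: measurable_hit.
  - by move=> m n mn; apply/subsetPset => y [j jm hj]; exists j => //; exact: leq_trans mn.
have c2 : nu (hit e n k) @[n --> \oo] --> (x ^+ k)%:E.
  rewrite (_ : (fun n => _) = EFin \o (h ^~ k)); last first.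
    by apply/funext => n; rewrite /= fineK.
  apply: cvg_EFin; first exact: nearW.
  have z : (fun n => (2 * (p * r)) ^+ n * b ^+ k) @ \oo --> (0 : R).
    rewrite -[X in _ --> X](mul0r (b ^+ k)); apply: cvgMl.
    by apply: cvg_expr; rewrite ger0_norm.
  apply: (@squeeze_cvgr _ _ _ _ (fun n => x ^+ k - (2 * (p * r)) ^+ n * b ^+ k)
     (fun n => x ^+ k + (2 * (p * r)) ^+ n * b ^+ k)).
  - by apply: nearW => n; have := H n; rewrite distrC ler_distl.
  - by rewrite -[X in _ --> X]subr0; apply: cvgB => //; exact: cvg_cst.
  - by rewrite -[X in _ --> X]addr0; apply: cvgD => //; exact: cvg_cst.
rewrite (cvg_unique _ c1 c2)//; rewrite /x; case: (e) => //; by rewrite expr1n.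
Qed.

End HitProb.

(** * Ladder times *)

Section Ladder.
Context {R : realType}.
Implicit Types (y : seqT R).

Definition firstup n : set (seqT R) :=
  [set y | zwalk y n = 1 /\ forall m, (m < n)%N -> zwalk y m <> 1].

(* [0] if the walk never reaches [1]. *)
Definition lad y : nat := xget 0%N [set n | firstup n y].

(** Distance covered, not number of steps, until the walk first stands at 1; this will be the busy
    period. *)
Definition ladder_len y : R := \sum_(i < lad y) `|y i|.

Definition ladder y : seqT R := shift (lad y) y.

Definition climbs : set (seqT R) := hits true 1.

Lemma firstup_uniq y m n : firstup m y -> firstup n y -> m = n.
Proof.
move=> [m1 mmin] [n1 nmin]; apply/eqP; rewrite eqn_leq; apply/andP; split.
  by rewrite leqNgt; apply/negP => /mmin.
by rewrite leqNgt; apply/negP => /nmin.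
Qed.

Lemma firstup_lad y n : firstup n y -> lad y = n.
Proof.
move=> fn; rewrite /lad; case: xgetP => [m _ fm|/(_ n)//]; exact: firstup_uniq fm fn.
Qed.

Lemma climbs_firstup y : climbs y -> exists n, firstup n y.
Proof.
move=> [j]; rewrite /zsgn mul1r => hj.
have ex : exists n, zwalk y n == 1 by exists j; apply/eqP.
have [n /eqP n1 nmin] := ex_minnP ex; exists n; split => // m mn /eqP/nmin.
by rewrite leqNgt mn.
Qed.

Lemma firstup_climbs y n : firstup n y -> climbs y.
Proof. by move=> [h _]; exists n; rewrite h. Qed.

Lemma climbs_lad y : climbs y -> firstup (lad y) y.
Proof. by move=> /climbs_firstup[n fn]; rewrite (firstup_lad fn). Qed.

Lemma nclimbs_lad y : ~ climbs y -> lad y = 0%N.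
Proof.
move=> nc; rewrite /lad; case: xgetP => // m _ fm.
by exfalso; apply: nc; exact: firstup_climbs fm.
Qed.

Lemma measurable_firstup d (T : measurableType d) (Y : T -> seqT R) n :
  (forall i, (i < n)%N -> measurable_fun setT (fun w => Y w i)) ->
  measurable [set w | firstup n (Y w)].
Proof.
move=> mY.
rewrite (_ : [set w | _] = [set w | zwalk (Y w) n = 1] `&`
    \bigcap_m ~` [set w | (m < n)%N /\ zwalk (Y w) m = 1]); last first.
  apply/seteqP; split => w [h1 h2]; split => //.
    by move=> m _ /= [mn hm]; exact: h2 hm.
  by move=> m mn hm; apply: (h2 m I).
apply: measurableI; first exact: measurable_zwalk.
apply: bigcapT_measurable => m; apply: measurableC.
have [mn|nm] := ltnP m n; last first.
  by rewrite (_ : [set w | _] = set0)//; apply/seteqP; split => // w [].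
rewrite (_ : [set w | _] = [set w | zwalk (Y w) m = 1]).
  by apply: measurable_zwalk => i im; apply: mY; exact: ltn_trans mn.
by apply/seteqP; split => w //= [].
Qed.

Lemma measurable_climbs : measurable climbs. Proof. exact: measurable_hits. Qed.

Lemma measurable_lad n : measurable [set y | lad y = n].
Proof.
have mf m : measurable [set y | firstup m y].
  by apply: (measurable_firstup (Y := id)) => i _; exact: measurable_coord.
case: n => [|n].
  rewrite (_ : [set y | _] = ~` climbs).
    exact: (measurableC measurable_climbs).
  apply/seteqP; split => y /=; last exact: nclimbs_lad.
  by move=> h /climbs_lad; rewrite h => -[]; rewrite zwalk0.
rewrite (_ : [set y | _] = [set y | firstup n.+1 y])//.
apply/seteqP; split => y /=; last exact: firstup_lad.
move=> h; have [c|nc] := pselect (climbs y); first by rewrite -h; exact: climbs_lad.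
by rewrite nclimbs_lad in h.
Qed.

Lemma measurable_abs_sum d (T : measurableType d) (Y : T -> seqT R) n :
  (forall i, (i < n)%N -> measurable_fun setT (fun w => Y w i)) ->
  measurable_fun setT (fun w => \sum_(i < n) `|Y w i|).
Proof.
elim: n => [|n IH] mY.
  by rewrite (_ : (fun w => _) = cst 0)//; apply/funext => w; rewrite big_ord0.
rewrite (_ : (fun w => _) = fun w => \sum_(i < n) `|Y w i| + `|Y w n|); last first.
  by apply/funext => w; rewrite big_ord_recr.
apply: measurable_funD; first by apply: IH => i ni; apply: mY; exact: ltnW.
by apply: measurableT_comp => //; apply: mY.
Qed.

Lemma measurable_ladder_len : measurable_fun setT ladder_len.
Proof.
apply: (measurable_fun_natindex (N := lad) (F := fun n y => \sum_(i < n) `|y i|)).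
  exact: measurable_lad.
by move=> n; apply: (measurable_abs_sum (Y := id)) => i _; exact: measurable_coord.
Qed.

Lemma measurable_ladder : measurable_fun setT ladder.
Proof.
apply: (measurable_fun_natindex (N := lad) (F := fun n y => shift n y)).
  exact: measurable_lad.
exact: measurable_shift.
Qed.

Lemma measurable_iter_ladder n : measurable_fun setT (iter n ladder).
Proof.
elim: n => [|n IH]; first exact: measurable_id.
by rewrite (_ : iter _ _ = ladder \o iter n ladder)//; exact: measurableT_comp measurable_ladder IH.
Qed.

Definition below k : set (seqT R) := hits false k.

(* The walk stands at height [k] at the [k]-th ladder time; [escapes y k] says that
   [k] is the first index after which it never returns to [0]. *)
Definition escapes y k := ~ below k (iter k ladder y) /\
  forall i, (i < k)%N -> below i (iter i ladder y).

(* [0] if there is no such index; a true value is never [0]. *)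
Definition escape_index y : nat := xget 0%N [set k | escapes y k].

Lemma escapes_uniq y m n : escapes y m -> escapes y n -> m = n.
Proof.
move=> [m1 mmin] [n1 nmin]; apply/eqP; rewrite eqn_leq; apply/andP; split.
  by rewrite leqNgt; apply/negP => /mmin.
by rewrite leqNgt; apply/negP => /nmin.
Qed.

Lemma escape_indexE y n : escape_index y = n.+1 <-> escapes y n.+1.
Proof.
rewrite /escape_index; case: xgetP => [m _ em|h]; split.
- by move=> <-.
- by move=> en; exact: escapes_uniq em en.
- by [].
- by move=> en; case: (h _ en).
Qed.

Definition climbs_forever y := forall i, climbs (iter i ladder y).

Lemma climbs_ladder y n : climbs_forever y ->
  zwalk (iter n ladder y) (lad (iter n ladder y)) = 1.
Proof. by move=> /(_ n)/climbs_lad[]. Qed.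

Lemma below_ladder y k : climbs y -> below k.+1 (ladder y) -> below k y.
Proof.
move=> /climbs_lad[h1 _] [j hj]; exists (lad y + j)%N.
by rewrite zwalk_shift h1 -/(ladder y) hj /zsgn; lia.
Qed.

(** After the [j]-th ladder time the walk is at height [j], so losing [j] units means a return to 0,
    which is also a return to 0 after every earlier ladder time. The events thus decrease in [j],
    and the first failure can be read off from two consecutive ones. *)
Lemma below_iter y i j : climbs_forever y -> (i <= j)%N ->
  below j (iter j ladder y) -> below i (iter i ladder y).
Proof.
move=> cy; elim: j => [|j IH]; first by rewrite leqn0 => /eqP->.
rewrite leq_eqVlt ltnS => /orP[/eqP->//|ij] /(below_ladder (cy j)); exact: IH.
Qed.

Definition ladder_index y n : nat := \sum_(i < n) lad (iter i ladder y).

Lemma iter_ladderE y n : iter n ladder y = shift (ladder_index y n) y.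
Proof.
rewrite /ladder_index; elim: n => [|n IH]; first by rewrite big_ord0 shift0.
by rewrite big_ord_recr iterS {1}/ladder {2}IH shiftD.
Qed.

Lemma ladder_index_walk y n : climbs_forever y -> zwalk y (ladder_index y n) = n%:Z.
Proof.
move=> cy; rewrite /ladder_index; elim: n => [|n IH]; first by rewrite big_ord0 zwalk0.
rewrite big_ord_recr/= zwalk_shift IH -[shift _ y]iter_ladderE climbs_ladder//; lia.
Qed.

Lemma ladder_index_len y n : \sum_(i < n) ladder_len (iter i ladder y) =
  \sum_(i < ladder_index y n) `|y i|.
Proof.
rewrite /ladder_index; elim: n => [|n IH]; first by rewrite !big_ord0.
rewrite !big_ord_recr/= IH big_split_ord/=; congr (_ + _).
rewrite /ladder_len; apply: eq_bigr => i _; congr (`| _ |).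
exact: (congr1 (fun z : seqT R => z (nat_of_ord i)) (iter_ladderE y n)).
Qed.

(** From height [k] at the [k]-th ladder time, a later height below 1 would force a visit to 0
    because the steps have size one, hence a loss of [k] units. *)
Lemma escapes_walk y k n : climbs_forever y -> escapes y k ->
  (ladder_index y k <= n)%N -> 1 <= zwalk y n.
Proof.
move=> cy [nb _] kn; rewrite leNgt; apply/negP => lt1; apply: nb.
rewrite iter_ladderE; set m := (n - ladder_index y k)%N.
have E : zwalk y n = k%:Z + zwalk (shift (ladder_index y k) y) m.
  by rewrite -(ladder_index_walk k cy) -zwalk_shift subnKC.
have [||j _ hj] := @zwalk_down _ (shift (ladder_index y k) y) m (- k%:Z); [lia|lia|].
by exists j; rewrite hj /zsgn; lia.
Qed.

End Ladder.

Section LadderProb.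
Context {R : realType} (nu : probability (seqT R) R) (nu_iid : iid_law nu).
Context (p q : R) (q0 : 0 < q) (qp : q < p) (pq : p + q = 1).
Hypothesis nup : nu [set y | half true (y 0%N)] = p%:E.

Lemma climbs_prob : nu climbs = 1%E.
Proof. by rewrite (hits_prob nu_iid q0 qp pq nup). Qed.

(** The strong Markov property at the first ladder time, by splitting over its value [n]: on
    [firstup n] the length depends on the first [n] coordinates and the rest is [shift n], so
    [block_prob] applies to each piece. Sequences that never climb are negligible. *)
Lemma ladder_indep (D : set R) (S : set (seqT R)) : measurable D -> measurable S ->
  nu [set y | D (ladder_len y) /\ S (ladder y)] =
  (nu [set y | D (ladder_len y)] * nu S)%E.
Proof.
move=> mD mS; have mc := @measurable_climbs R.
have mDl : measurable [set y | D (ladder_len y)].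
  exact: (measurable_preimage measurable_ladder_len).
have mSl : measurable [set y | S (ladder y)] by exact: (measurable_preimage measurable_ladder).
pose Z n := [set y : seqT R | firstup n y] `&` [set y | D (\sum_(i < n) `|y i|)].
have pZ n : <<s prefixsys n >> (Z n).
  apply: (@measurableI _ (prefT n)).
    by apply: (measurable_firstup (T := prefT n) (Y := id)) => i; exact: measurable_prefix_coord.
  apply: (measurable_preimage (T := prefT n)) mD.
  by apply: (measurable_abs_sum (T := prefT n) (Y := id)) => i; exact: measurable_prefix_coord.
have mZ n : measurable (Z n) by exact: prefT_measurable (pZ n).
have mSn n : measurable (shift n @^-1` S) by exact: (measurable_preimage (measurable_shift n)).
have E1 : [set y | D (ladder_len y)] `&` climbs = \bigcup_n Z n.
  apply/seteqP; split => y.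
    by move=> [Dy /climbs_lad c]; exists (lad y).
  move=> [n _ [fn Dn]]; split; last exact: firstup_climbs fn.
  by rewrite /= /ladder_len (firstup_lad fn).
have E2 : [set y | D (ladder_len y) /\ S (ladder y)] `&` climbs = \bigcup_n (Z n `&` shift n @^-1` S).
  apply/seteqP; split => y.
    by move=> [[Dy Sy] /climbs_lad c]; exists (lad y).
  move=> [n _ [[fn Dn] Sn]]; split; last exact: firstup_climbs fn.
  by rewrite /= /ladder_len /ladder (firstup_lad fn).
have triv (F : nat -> set (seqT R)) : (forall n, F n `<=` [set y | firstup n y]) -> trivIset setT F.
  by move=> HF i j _ _ [y [/HF fi /HF fj]]; exact: firstup_uniq fi fj.
rewrite -(prob_setI1 mc _ climbs_prob); last exact: measurableI.
rewrite -[in RHS](prob_setI1 mc mDl climbs_prob) E1 E2.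
have mU1 : measurable (\bigcup_n Z n) by exact: bigcupT_measurable.
rewrite measure_semi_bigcup; first last.
- by apply: bigcupT_measurable => n; exact: measurableI.
- by apply: triv => n y [[]].
- by move=> n; exact: measurableI.
rewrite measure_semi_bigcup//; last by apply: triv => n y [].
have fS : nu S \is a fin_num by exact: fin_num_measure.
rewrite muleC -(fineK fS) -nneseriesZl//.
by apply: eq_eseriesr => n _; rewrite fineK// muleC; exact: block_prob.
Qed.

Lemma ladder_law S : measurable S -> nu [set y | S (ladder y)] = nu S.
Proof.
move=> mS; have := ladder_indep measurableT mS.
rewrite (_ : [set y | setT (ladder_len y)] = setT); last by apply/seteqP.
rewrite probability_setT mul1e => <-; congr (nu _).
by apply/seteqP; split => y //= [].
Qed.

Lemma iter_ladder_law n S : measurable S -> nu [set y | S (iter n ladder y)] = nu S.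
Proof.
elim: n => [//|n IH] mS.
rewrite -(IH mS) -[in RHS]ladder_law//; last exact: (measurable_preimage (measurable_iter_ladder n)).
by congr (nu _); apply/seteqP; split => y /=; rewrite -iterSr.
Qed.

Lemma climbs_forever_prob : exists2 G : set (seqT R), measurable G /\ nu G = 1%E &
  G `<=` @climbs_forever R.
Proof.
exists (\bigcap_i [set y | climbs (iter i ladder y)]); last by move=> y h i; exact: h.
have m i : measurable [set y : seqT R | climbs (iter i ladder y)].
  by apply: (measurable_preimage (measurable_iter_ladder i)); exact: measurable_climbs.
split; first exact: bigcapT_measurable.
apply: prob_bigcap1 => // i.
by rewrite (iter_ladder_law i (@measurable_climbs R)) climbs_prob.
Qed.

Lemma ladder_prefix m (D : nat -> set R) : (forall i, measurable (D i)) ->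
  nu [set y | forall i, (i < m)%N -> D i (ladder_len (iter i ladder y))] =
  (\prod_(i < m) nu [set y | D i (ladder_len y)])%E.
Proof.
elim: m D => [|m IH] D mD.
  rewrite big_ord0 -[RHS](probability_setT nu); congr (nu _).
  by apply/seteqP; split.
rewrite big_ord_recl -(IH (fun i => D i.+1))// -ladder_indep//; last first.
  rewrite (_ : [set y | _] = \bigcap_i [set y | (i < m)%N -> D i.+1 (ladder_len (iter i ladder y))]).
    apply: bigcapT_measurable => i; case: ltnP => im.
      rewrite (_ : [set y | _] = [set y | D i.+1 (ladder_len (iter i ladder y))]).
        apply: (measurable_preimage (f := ladder_len \o iter i ladder)) => //.
        exact: measurableT_comp measurable_ladder_len (measurable_iter_ladder i).
      by apply/seteqP; split => y /=; [apply|move=> ? _].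
    by rewrite (_ : [set y | _] = setT)//; apply/seteqP.
  by apply/seteqP; split => y h i; [move=> _|]; exact: h.
congr (nu _); apply/seteqP; split => y /=.
  move=> h; split; first exact: (h 0%N).
  by move=> i im; have := h i.+1 im; rewrite iterSr.
by move=> [h1 h2] [//|i] im; rewrite iterSr; exact: h2.
Qed.

Lemma measurable_below_iter k : measurable [set y : seqT R | below k (iter k ladder y)].
Proof. by apply: (measurable_preimage (measurable_iter_ladder k)); exact: measurable_hits. Qed.

Lemma measurable_escapes k : measurable [set y : seqT R | escapes y k].
Proof.
rewrite (_ : [set y | _] = ~` [set y : seqT R | below k (iter k ladder y)] `&`
    \bigcap_i (if (i < k)%N then [set y : seqT R | below i (iter i ladder y)] else setT)).
  apply: measurableI; first exact: (measurableC (measurable_below_iter k)).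
  by apply: bigcapT_measurable => i; case: ifP => // _; exact: measurable_below_iter.
apply/seteqP; split => y [h1 h2]; split => // i.
  by move=> _; case: ifP => // ik; exact: h2.
by move=> ik; have := h2 i I; rewrite ik.
Qed.

Lemma measurable_escape_index k : measurable [set y : seqT R | escape_index y = k].
Proof.
have m n : measurable [set y : seqT R | escape_index y = n.+1].
  rewrite (_ : [set y | _] = [set y | escapes y n.+1]); first exact: measurable_escapes.
  by apply/seteqP; split => y /= /escape_indexE.
case: k => [|k]; last exact: m.
rewrite (_ : [set y | _] = ~` \bigcup_n [set y : seqT R | escape_index y = n.+1]).
  by apply: measurableC; exact: bigcupT_measurable.
apply/seteqP; split => y /=; first by move=> h [n _ /=]; rewrite h.
by move=> h; case E: (escape_index y) => [//|n]; exfalso; apply: h; exists n.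
Qed.

(** Up to a null set, index [j.+1] means a return to 0 after the [j]-th ladder time but none after
    the next. These nested events have probabilities [(q / p) ^+ j] and [(q / p) ^+ j.+1], since the
    sequence after a ladder time has law [nu] again; subtraction gives the geometric weight. *)
Lemma escape_index_prob j :
  nu [set y | escape_index y = j.+1] = ((q / p) ^+ j * (1 - q / p))%:E.
Proof.
have [G [mG G1] GH] := climbs_forever_prob.
have pB k : nu [set y | below k (iter k ladder y)] = ((q / p) ^+ k)%:E.
  rewrite (iter_ladder_law k (measurable_hits _ _)).
  by rewrite (hits_prob nu_iid q0 qp pq nup).
have mB := measurable_below_iter.
rewrite (_ : [set y | _] = [set y | escapes y j.+1]); last first.
  by apply/seteqP; split => y /= /escape_indexE.
rewrite -(prob_setI1 mG _ G1); last exact: measurable_escapes.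
rewrite (_ : _ `&` G = ([set y | below j (iter j ladder y)] `\`
     [set y | below j.+1 (iter j.+1 ladder y)]) `&` G); last first.
  apply/seteqP; split => y [h Gy]; split => //; case: h => h1 h2; split => //.
  - exact: h2.
  - by move=> i ij; apply: (below_iter (GH _ Gy) _ h1).
rewrite prob_setI1//; last exact: measurableD.
have E : nu [set y | below j (iter j ladder y)] =
   (nu ([set y | below j (iter j ladder y)] `\` [set y | below j.+1 (iter j.+1 ladder y)]) +
    nu [set y | below j.+1 (iter j.+1 ladder y)])%E.
  rewrite -[in LHS](prob_setI1 mG (mB j) G1) -[X in (_ + X)%E](prob_setI1 mG (mB j.+1) G1).
  rewrite -[X in (X + _)%E](prob_setI1 mG (measurableD (mB j) (mB j.+1)) G1).
  rewrite -probU; last 3 first.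
  - by apply: measurableI => //; exact: measurableD.
  - exact: measurableI.
  - by apply/seteqP; split => // y [[[_ ?] _] [? _]].
  congr (nu _); apply/seteqP; split => y.
    move=> [h1 Gy]; have [h2|h2] := pselect (below j.+1 (iter j.+1 ladder y)); [by right|by left].
  by move=> [[[h1 _] Gy]|[h1 Gy]]; split => //; apply: (below_iter (GH _ Gy) _ h1).
move: E; rewrite !pB => E.
have f : nu ([set y | below j (iter j ladder y)] `\` [set y | below j.+1 (iter j.+1 ladder y)]) \is a fin_num.
  by apply: fin_num_measure; exact: measurableD.
move: E; rewrite -(fineK f) -EFinD => -[E]; congr EFin.
by rewrite mulrBr mulr1 -exprSr E addrK.
Qed.

End LadderProb.

(** * Stable matchings and excess *)

Section Matching.
Context {R : realType}.
Implicit Types (Bl Rd : set R) (MB MR : R -> option R).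

Definition bicolored Bl Rd : bool -> set R := fun c => if c then Bl else Rd.

(** Lets facts about a blue point and its partner be applied to a red one. *)
Lemma stable_swap Bl Rd MB MR :
  is_stable_matching Bl Rd MB MR -> is_stable_matching Rd Bl MR MB.
Proof.
move=> [[m1 m2] st]; split; first by split => x y h1 h2; [exact: m2|exact: m1].
move=> [b [r [hb [hr [h1 [h2 h3]]]]]]; apply: st; exists r, b; split => //; split => //.
split; first by move=> /(m2 _ _ hb)[_]; exact: h1.
by rewrite distrC.
Qed.

(** Reflection turns a partner on the left into a partner on the right. *)
Lemma stable_opp Bl Rd MB MR :
  is_stable_matching Bl Rd MB MR ->
  is_stable_matching [set x | Bl (- x)] [set x | Rd (- x)]
    (fun x => omap -%R (MB (- x))) (fun x => omap -%R (MR (- x))).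
Proof.
move=> [[m1 m2] st].
have md (o : option R) x : mdist (omap -%R o) x = mdist o (- x).
  by case: o => //= y; rewrite opprK -[in LHS]normrN opprD.
split.
  split => x y /= hx.
    case E: (MB (- x)) => [r|]//= [<-]; have [h1 h2] := m1 _ _ hx E.
    by rewrite opprK h2 /= opprK.
  case E: (MR (- x)) => [r|]//= [<-]; have [h1 h2] := m2 _ _ hx E.
  by rewrite opprK h2 /= opprK.
move=> [b [r [/= hb [hr [h1 [h2 h3]]]]]]; apply: st; exists (- b), (- r).
split => //; split => //; split; first by move=> E; apply: h1; rewrite E/= opprK.
have E : `|- r - - b| = `|r - b| by rewrite -opprD normrN.
by rewrite E -!md.
Qed.

(** The point [b'] is closer to [r] than [b] is, so unless its partner [r'] is at distance at most
    [r - b'], the pair [b'], [r] blocks. If moreover [r'] were at or left of [b], then [b] would be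
    nearer to [r'] than both [b'] and [r] allow, and [b], [r'] would block. *)
Lemma partner_between Bl Rd MB MR b r b' :
  is_stable_matching Bl Rd MB MR -> Bl b -> MB b = Some r -> b < r ->
  Bl b' -> b < b' -> b' <= r -> exists2 r', MB b' = Some r' & b < r' < r.
Proof.
move=> [[m1 m2] st] hb Mb br hb' bb' b'r; have [hr Mr] := m1 _ _ hb Mb.
have nMr : MR r <> Some b' by rewrite Mr => -[E]; rewrite E ltxx in bb'.
have d1 : ((`|r - b'|)%:E < mdist (MR r) r)%E.
  by rewrite Mr /= lte_fin !ger0_norm; lra.
have : ~ ((`|r - b'|)%:E < mdist (MB b') b')%E.
  by move=> d2; apply: st; exists b', r.
case E: (MB b') => [r'|] /=; last by rewrite ltry.
move=> /negP; rewrite lte_fin -leNgt => d3; exists r' => //.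
have [hr' Mr'] := m1 _ _ hb' E.
have r'r : r' <> r by move=> rr; rewrite rr in Mr'.
have d3' : `|b' - r'| <= r - b' by rewrite -[leRHS]ger0_norm// subr_ge0.
move: d3'; rewrite ler_norml => /andP[d4 d5].
have lt_r : r' < r by rewrite lt_neqAle; apply/andP; split; [exact/eqP|lra].
rewrite lt_r andbT ltNge; apply/negP => r'b; apply: st; exists b, r'.
split => //; split => //; split; first by rewrite Mr' => -[E']; rewrite E' ltxx in bb'.
rewrite Mr' Mb /= !lte_fin distrC (ger0_norm (_ : 0 <= b - r')); last lra.
rewrite (distrC r' b') (ger0_norm (_ : 0 <= b' - r')); last lra.
rewrite (distrC b r) (ger0_norm (_ : 0 <= r - b)); last lra.
split; lra.
Qed.

Lemma ncard_lt_of_inj (A B : set R) (f : R -> R) r : finite_set A -> finite_set B ->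
  B r -> (forall x, A x -> B (f x)) -> (forall x, A x -> f x <> r) ->
  (forall x y, A x -> A y -> f x = f y -> x = y) -> (ncard A < ncard B)%N.
Proof.
move=> fA fB Br fAB nr finj.
have fB' : finite_set (B `\ r) by exact: finite_setD.
have -> : ncard B = (1 + ncard (B `\ r))%N.
  rewrite -(ncard1 r) -ncardU//; last by apply/seteqP; split => // x [/= -> [_]].
  congr ncard; apply/seteqP; split => x; last by move=> [/= ->//|[]].
  by move=> Bx; have [->|xr] := eqVneq x r; [left|right; split => //=; exact/eqP].
rewrite add1n ltnS; apply: (ncard_inj_le (f := f)) => // x Ax.
by split; [exact: fAB|exact: nr].
Qed.

(** By [partner_between], taking partners injects the blue points of the interval into its red
    points, and the image misses [r], which belongs to [b]. *)
Lemma matched_right_num Bl Rd MB MR b r : locfin (bicolored Bl Rd) ->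
  is_stable_matching Bl Rd MB MR -> Bl b -> MB b = Some r -> b < r ->
  (num (bicolored Bl Rd) true b r < num (bicolored Bl Rd) false b r)%N.
Proof.
move=> lf st hb Mb br; have [[m1 m2] _] := st; have [hr Mr] := m1 _ _ hb Mb.
have P x : (Bl `&` `]b, r]) x -> exists2 r', MB x = Some r' & b < r' < r.
  move=> [hx]; rewrite /= in_itv/= => /andP[bx xr].
  exact: (partner_between st hb Mb br hx bx xr).
apply: (ncard_lt_of_inj (f := fun x => odflt 0 (MB x)) (r := r)).
- exact: lf.
- exact: lf.
- by split => //=; rewrite in_itv/= br lexx.
- move=> x Ax; have [r' E /andP[r1 r2]] := P _ Ax; rewrite E/=; split.
    by case: Ax => hx _; case: (m1 _ _ hx E).
  by rewrite /= in_itv/= r1 ltW.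
- by move=> x Ax; have [r' E /andP[r1 r2]] := P _ Ax; rewrite E/= => rr; rewrite rr ltxx in r2.
- move=> x y Ax Ay; have [rx Ex _] := P _ Ax; have [ry Ey _] := P _ Ay.
  rewrite Ex Ey/= => E; case: Ax Ay => hx _ [hy _].
  have [_ Mx] := m1 _ _ hx Ex; have [_ My] := m1 _ _ hy Ey.
  by move: Mx; rewrite E My => -[].
Qed.

(** If [b] had its partner farther than [dd], every red [r] in [(b, b + dd]] would need a partner to
    the right of [b] at distance at most [r - b], for otherwise [b] and [r] block. From this an
    endpoint at or beyond [b + dd] is found up to which the red points inject into the blue ones,
    against the excess. *)
Lemma dist_le_of_excess Bl Rd MB MR b (dd : R) : locfin (bicolored Bl Rd) ->
  is_stable_matching Bl Rd MB MR -> Bl b -> 0 <= dd ->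
  (forall s, dd <= s ->
    (num (bicolored Bl Rd) true b (b + s)%R < num (bicolored Bl Rd) false b (b + s)%R)%N) ->
  (mdist (MB b) b <= dd%:E)%E.
Proof.
move=> lf st hb d0 exc; rewrite leNgt; apply/negP => dX.
have [[m1 m2] ns] := st.
have P r : Rd r -> b < r -> r <= b + dd ->
    exists b', [/\ MR r = Some b', Bl b', b < b' & b' <= b + dd + dd].
  move=> hr br rd.
  have nM : MR r <> Some b.
    move=> /(m2 _ _ hr)[_ E]; move: dX; rewrite E/= lte_fin distrC ger0_norm; lra.
  have d1 : ((`|r - b|)%:E < mdist (MB b) b)%E.
    by apply: le_lt_trans dX; rewrite lee_fin ger0_norm; lra.
  have : ~ ((`|r - b|)%:E < mdist (MR r) r)%E by move=> d2; apply: ns; exists b, r.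
  case E: (MR r) => [b'|] /=; last by rewrite ltry.
  move=> /negP; rewrite lte_fin -leNgt (ger0_norm (_ : 0 <= r - b)); last lra.
  rewrite ler_norml => /andP[d4 d5].
  have [hb' _] := m2 _ _ hr E.
  exists b'; split => //; last lra.
  rewrite lt_neqAle; apply/andP; split; last lra.
  by apply/eqP => bb; apply: nM; rewrite bb.
have inj c e : (forall r, (Rd `&` `]b, e]) r -> exists b', MR r = Some b' /\ (Bl `&` `]b, c]) b') ->
    (num (bicolored Bl Rd) false b e <= num (bicolored Bl Rd) true b c)%N.
  move=> H; apply: (ncard_inj_le (f := fun x => odflt 0 (MR x))).
  - exact: lf.
  - exact: lf.
  - by move=> x Ax; have [b' [E h]] := H _ Ax; rewrite E.
  - move=> x y Ax Ay; have [bx [Ex _]] := H _ Ax; have [b2 [Ey _]] := H _ Ay.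
    rewrite Ex Ey/= => E; case: Ax Ay => hx _ [hy _].
    have [_ Mx] := m2 _ _ hx Ex; have [_ My] := m2 _ _ hy Ey.
    by move: Mx; rewrite E My => -[].
(* Blue points beyond [b + dd] that serve red points before it. If there are none, [b + dd] itself
   is the endpoint; otherwise it is the rightmost of them, which exists since all lie within
   [b + dd + dd]. *)
pose S := [set b' | [/\ Bl b', b + dd < b', b' <= b + dd + dd &
   exists r, [/\ Rd r, b < r, r <= b + dd & MR r = Some b']]].
have fS : finite_set S.
  apply: (sub_finite_set _ (lf true (b + dd) (b + dd + dd))) => x [h1 h2 h3 _].
  by split => //=; rewrite in_itv/= h2 h3.
have [S0|nS] := pselect (exists x, S x); last first.
  have := exc _ (lexx dd); rewrite ltnNge => /negP; apply; apply: inj => r [hr].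
  rewrite /= in_itv/= => /andP[br rd]; have [b' [E hb' b1 b2]] := P _ hr br rd.
  exists b'; split => //; split => //=; rewrite in_itv/= b1/= leNgt; apply/negP => b3.
  by apply: nS; exists b'; split => //; exists r.
case: S0 => x0 Sx0; have [b1 [hb1 db1 b1d [r1 [hr1 br1 r1d M1]]] bmax] := finite_max fS Sx0.
have d1 : dd <= b1 - b by lra.
have := exc _ d1; rewrite addrC subrK ltnNge => /negP; apply; apply: inj => r [hr].
rewrite /= in_itv/= => /andP[br rb1]; have [rd|dr] := leP r (b + dd).
  have [b' [E hb' c1 c2]] := P _ hr br rd; exists b'; split => //; split => //=.
  rewrite in_itv/= c1/=; have [c3|c3] := leP b' (b + dd); first by lra.
  by apply: bmax; split => //; exists r.
(* A red point beyond [b + dd] and up to [b1] lies between the matched points [r1] and [b1], which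
   confine its partner, by [partner_between] with the colours exchanged. *)
have [b' E /andP[c1 c2]] : exists2 b', MR r = Some b' & r1 < b' < b1.
  by apply: (partner_between (stable_swap st) hr1 M1) => //; lra.
exists b'; split => //; have [hb' _] := m2 _ _ hr E; split => //=.
by rewrite in_itv/=; apply/andP; split; lra.
Qed.

End Matching.

Section Counts.
Context {R : realType}.
Implicit Types (D : bool -> set R) (x s : R) (c : bool).

Lemma num_first D x c : gap D x != 0 -> num D c x (nxt D x) = ((gap D x < 0) == c) :> nat.
Proof.
move=> g0; have F := gap_neq0 g0; have [xz [e De nDe] zmin] := F.
have col : (gap D x < 0) = e.
  rewrite /gap; case: asboolP => Dt.
    by rewrite subr_lt0 xz; case: e De nDe.
  rewrite ltNge subr_ge0 ltW//=; by case: e De nDe.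
rewrite col; have [<-|ec] := eqVneq e c.
  by apply: (num1 De xz) => // u Du xu uz; apply/eqP; rewrite eq_le uz (zmin _ _ Du xu).
have cE : c = ~~ e by case: c e ec {col De nDe} => -[].
apply: num0 => u Du xu uz; apply: nDe; rewrite -cE.
by rewrite (_ : nxt D x = u)//; apply/eqP; rewrite eq_le uz (zmin _ _ Du xu).
Qed.

Variables (D : bool -> set R) (x : R).
Hypotheses (lfD : locfin D) (g0 : forall i, gaps D x i != 0).

Lemma pos_lt n : pos D x n < pos D x n.+1.
Proof. by rewrite posS ltrDl normr_gt0. Qed.

Lemma pos_le m n : (m <= n)%N -> pos D x m <= pos D x n.
Proof.
elim: n => [|n IH]; first by rewrite leqn0 => /eqP->.
rewrite leq_eqVlt ltnS => /orP[/eqP->//|/IH h]; exact: le_trans (ltW (pos_lt n)).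
Qed.

Lemma pos_ge n : x <= pos D x n. Proof. exact: (@pos_le 0). Qed.

Lemma num_posS c n : num D c x (pos D x n.+1) =
  (num D c x (pos D x n) + ((gaps D x n < 0)%R == c))%N.
Proof.
rewrite (@numD _ D c x (pos D x n))//; [|exact: pos_ge|exact: ltW (pos_lt n)].
by congr addn; apply: num_first; exact: g0.
Qed.

Lemma zwalk_num n :
  zwalk (gaps D x) n = (num D false x (pos D x n))%:Z - (num D true x (pos D x n))%:Z.
Proof.
elim: n => [|n IH].
  rewrite zwalk0 !num0// => z _ /= xz; rewrite leNgt xz//.
rewrite zwalkS !num_posS IH /zstep; case: (ltgtP 0 (gaps D x n)) => h /=; [lia|lia|].
by have := g0 n; rewrite -h eqxx.
Qed.

Lemma num_total n : (num D true x (pos D x n) + num D false x (pos D x n))%N = n.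
Proof.
elim: n => [|n IH]; first by rewrite !num0// => z _ /= xz; rewrite leNgt xz.
rewrite !num_posS -[in RHS]IH; case: (_ < _) => /=; lia.
Qed.

Lemma num_between c n s : pos D x n <= s -> s < pos D x n.+1 ->
  num D c x s = num D c x (pos D x n).
Proof.
move=> ns sn; rewrite (@numD _ D c x (pos D x n))//; last exact: pos_ge.
rewrite [X in (_ + X)%N]num0 ?addn0// => z Dz nz zs.
have [_ _ zmin] := gap_neq0 (g0 n); have := zmin _ _ Dz nz.
by rewrite -[nxt _ _]/(pos D x n.+1) leNgt (le_lt_trans zs sn).
Qed.

(** The positions cannot accumulate: by [num_total] there are [n] points up to the [n]-th position,
    while only finitely many lie before [s]. *)
Lemma pos_locate s : x <= s -> exists n, pos D x n <= s < pos D x n.+1.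
Proof.
move=> xs; pose M := (num D true x s + num D false x s)%N.
have big n : pos D x n <= s -> (n <= M)%N.
  by move=> ns; rewrite -[n]num_total; apply: leq_add; exact: num_leq.
have ex : exists n, s < pos D x n.
  by exists M.+1; rewrite ltNge; apply/negP => /big; rewrite ltnn.
have [[|n] Hn Hmin] := ex_minnP ex; first by move: Hn; rewrite ltNge xs.
by exists n; rewrite Hn andbT leNgt; apply/negP => /Hmin; rewrite ltnn.
Qed.

Lemma pos_reached s n : pos D x n <= s -> forall m, s < pos D x m -> (n < m)%N.
Proof.
move=> ns m sm; rewrite ltnNge; apply/negP => mn.
by have := lt_le_trans sm (pos_le mn); rewrite ltNge ns.
Qed.

Lemma zwalk_locate s : x <= s -> exists n, [/\ pos D x n <= s, s < pos D x n.+1 &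
  zwalk (gaps D x) n = (num D false x s)%:Z - (num D true x s)%:Z].
Proof.
move=> /pos_locate[n /andP[h1 h2]]; exists n; split => //.
by rewrite zwalk_num !(num_between _ h1 h2).
Qed.

(** Nonzero gaps visit every point after [x], each as an [isfirst] point, which has a single
    colour. *)
Lemma no_double z : x < z -> D true z -> D false z -> False.
Proof.
move=> xz Dt Df; have [[|n] /andP[h1 h2]] := pos_locate (ltW xz).
  have [_ _ zmin] := gap_neq0 (g0 0%N); have := zmin _ _ Dt xz.
  by rewrite -[nxt _ _]/(pos D x 1) leNgt h2.
have E : z = pos D x n.+1.
  apply/eqP; rewrite eq_le h1 andbT leNgt; apply/negP => h3.
  have [_ _ zmin] := gap_neq0 (g0 n.+1); have := zmin _ _ Dt h3.
  by rewrite -[nxt _ _]/(pos D x n.+2) leNgt h2.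
by have [_ [[] _ +] _] := gap_neq0 (g0 n); rewrite -[nxt _ _]/(pos D x n.+1) -E.
Qed.

(** Steps have size one, so a positive height at the last point up to [s] means that height 1 was
    reached by then. *)
Lemma excess_ladder s : x <= s -> (num D true x s < num D false x s)%N ->
  x + ladder_len (gaps D x) <= s.
Proof.
move=> xs h; have [n [h1 h2 h3]] := zwalk_locate xs.
have [m mn hm] : exists2 m, (m <= n)%N & zwalk (gaps D x) m = 1.
  by apply: zwalk_up => //; rewrite h3; lia.
have [_ lmin] : firstup (lad (gaps D x)) (gaps D x).
  by apply: climbs_lad; exists m; rewrite hm.
have lm : (lad (gaps D x) <= m)%N by rewrite leqNgt; apply/negP => /lmin.
rewrite /ladder_len -pos_sum; apply: le_trans h1; apply: pos_le; exact: leq_trans mn.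
Qed.

Lemma ladder_excess : climbs (gaps D x) ->
  num D false x (x + ladder_len (gaps D x)) =
  (num D true x (x + ladder_len (gaps D x))).+1.
Proof.
move=> /climbs_lad[h _]; rewrite /ladder_len -pos_sum.
by move: h; rewrite zwalk_num; lia.
Qed.

Lemma escapes_excess k s : climbs_forever (gaps D x) -> escapes (gaps D x) k ->
  x + \sum_(i < k) ladder_len (iter i ladder (gaps D x)) <= s ->
  (num D true x s < num D false x s)%N.
Proof.
move=> cf es; rewrite ladder_index_len -pos_sum => ks.
have [n [h1 h2 h3]] := zwalk_locate (le_trans (pos_ge _) ks).
have kn : (ladder_index (gaps D x) k <= n)%N by have := pos_reached ks h2.
by have := escapes_walk cf es kn; rewrite h3; lia.
Qed.

End Counts.

(** * Busy periods as first ladder times *)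

Section Busy.
Context {R : realType}.
Implicit Types (D : bool -> set R) (x s : R) (c : bool).

(** Keeping one colour turns gaps into interarrival times (blue) or service times (red). *)
Definition mask (m : bool -> bool) D : bool -> set R := fun c => if m c then D c else set0.

Lemma locfin_mask m D : locfin D -> locfin (mask m D).
Proof. by move=> lfD c a b; rewrite /mask; case: (m c) => //; rewrite set0I. Qed.

Lemma num_mask (m : bool -> bool) D c a b : m c -> num (mask m D) c a b = num D c a b.
Proof. by rewrite /num /mask => ->. Qed.

Lemma num_mask0 (m : bool -> bool) D c a b : ~~ m c -> num (mask m D) c a b = 0%N.
Proof. by move=> /negbTE mc; rewrite /num /mask mc set0I ncard0. Qed.

Lemma mono_num D c x n : locfin D -> (forall i, gaps (mask (eq_op c) D) x i != 0) ->
  num D c x (pos (mask (eq_op c) D) x n) = n.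
Proof.
move=> lfD g0; rewrite -[in RHS](num_total (locfin_mask (eq_op c) lfD) g0 n).
by case: c g0 => g0; [rewrite num_mask// num_mask0// addn0|rewrite num_mask0// num_mask// add0n].
Qed.

Lemma mono_num_le D c x n s : locfin D -> (forall i, gaps (mask (eq_op c) D) x i != 0) ->
  s < pos (mask (eq_op c) D) x n.+1 -> (num D c x s <= n)%N.
Proof.
move=> lfD g0 sn; have lm := locfin_mask (eq_op c) lfD.
have [xs|sx] := leP x s; last by rewrite num0// => z _ xz; rewrite leNgt (lt_trans sx xz).
have [m /andP[h1 h2]] := pos_locate lm g0 xs.
have := num_between lm g0 c h1 h2; rewrite !num_mask// => ->.
by rewrite mono_num// -ltnS; apply: (pos_reached g0 h1 sn).
Qed.

(* The excess of red over blue points first reaches [1] at the first service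
   completion that precedes the next arrival. *)
Lemma busy_time_ladder D x : locfin D -> (forall i, gaps D x i != 0) ->
  (forall c i, gaps (mask (eq_op c) D) x i != 0) -> climbs (gaps D x) ->
  busy_time (fun i => `|gaps (mask (eq_op true) D) x i|)
            (fun i => `|gaps (mask (eq_op false) D) x i|) =
  (ladder_len (gaps D x))%:E.
Proof.
move=> lfD g0 gm cl.
pose e k := pos (mask (eq_op true) D) x k; pose f k := pos (mask (eq_op false) D) x k.
have eE k : \sum_(j < k) `|gaps (mask (eq_op true) D) x j| = e k - x.
  by rewrite /e pos_sum addrC addKr.
have fE k : \sum_(j < k) `|gaps (mask (eq_op false) D) x j| = f k - x.
  by rewrite /f pos_sum addrC addKr.
have lm c := locfin_mask (eq_op c) lfD.
have exL := ladder_excess lfD g0 cl.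
have xT : x <= x + ladder_len (gaps D x) by rewrite lerDl sumr_ge0.
set T1 := x + ladder_len _ in exL xT.
apply/eqP; rewrite eq_le; apply/andP; split.
  (* Up to [T1] there are [k] blue and [k.+1] red points, so the red point [f k.+1] is at most [T1]
     and the blue point [e k.+1] cannot precede it: [k] competes in the infimum. *)
  pose k := num D true x T1.
  have fk : f k.+1 <= T1.
    rewrite leNgt; apply/negP => h.
    have : (num D false x T1 <= k)%N by apply: mono_num_le h => //; exact: gm.
    by rewrite exL ltnn.
  apply: (@le_trans _ _ (f k.+1 - x)%:E); last by rewrite lee_fin lerBlDl.
  apply: ereal_inf_lbound; exists k; last by rewrite fE.
  rewrite /= fE eE lerD2r leNgt; apply/negP => h.
  have h1 : (num D true x (e k.+1) <= num D true x T1)%N by apply: num_leq => //; lra.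
  by move: h1; rewrite (mono_num _ lfD (gm true)) ltnn.
apply: le_ereal_inf_tmp => _ [k /= + <-]; rewrite fE eE lerD2r => h.
have xf : x < f k.+1 by exact: le_lt_trans (pos_ge (gm false) k) (pos_lt (gm false) k).
(* Strict because no point has both colours; hence at [f k.+1] there are [k.+1] red and at most [k]
   blue points, a positive excess. *)
have fe : f k.+1 < e k.+1.
  rewrite lt_neqAle h andbT; apply/eqP => E.
  have [_ [c1 D1 _] _] := gap_neq0 (gm false k).
  have [_ [c2 D2 _] _] := gap_neq0 (gm true k).
  apply: (no_double lfD g0 xf).
    by rewrite E; move: D2; rewrite /mask /=; case: c2.
  by move: D1; rewrite /mask /=; case: c1.
rewrite lee_fin lerBrDl.
apply: excess_ladder => //; first exact: ltW.
by rewrite (mono_num _ lfD (gm false)) ltnS; exact: (mono_num_le lfD (gm true)).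
Qed.

End Busy.

(** * Poisson counts on disjoint regions *)

Section Streams.
Context {R : realType}.
Implicit Types (D : bool -> set R) (x : R) (m : bool -> bool) (o : bool)
  (s : seq (R * nat * nat)).

(** Colour, region, and the number of points of that colour prescribed there. *)
Definition entry : Type := (bool * set R * nat)%type.

Definition entry0 : entry := (true, set0, 0%N).

Fixpoint allq (Q : entry -> Prop) (L : seq entry) : Prop :=
  if L is q :: L' then Q q /\ allq Q L' else True.

Fixpoint disjq (L : seq entry) : Prop :=
  if L is q :: L' then
    allq (fun q' => q.1.1 = q'.1.1 -> q.1.2 `&` q'.1.2 = set0) L' /\ disjq L'
  else True.

Definition counts_event (L : seq entry) D : Prop :=
  allq (fun q => ncard (D q.1.1 `&` q.1.2) = q.2) L.

Lemma allq_nth Q L i : allq Q L -> (i < size L)%N -> Q (nth entry0 L i).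
Proof. by elim: L i => //= q L IH [|i] [h1 h2] //=; exact: IH. Qed.

Lemma nth_allq Q L : (forall i, (i < size L)%N -> Q (nth entry0 L i)) -> allq Q L.
Proof. by elim: L => //= q L IH H; split; [exact: (H 0%N)|apply: IH => i; exact: (H i.+1)]. Qed.

Lemma allq_cat Q L1 L2 : allq Q (L1 ++ L2) <-> allq Q L1 /\ allq Q L2.
Proof. by elim: L1 => [|q L1 IH] /=; [tauto|rewrite IH; tauto]. Qed.

Lemma allq_impl (Q Q' : entry -> Prop) L : (forall q, Q q -> Q' q) -> allq Q L -> allq Q' L.
Proof. by move=> H; elim: L => //= q L IH [/H ? /IH ?]. Qed.

Lemma disjq_nth L i j : disjq L -> (i < j < size L)%N ->
  (nth entry0 L i).1.1 = (nth entry0 L j).1.1 ->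
  (nth entry0 L i).1.2 `&` (nth entry0 L j).1.2 = set0.
Proof.
elim: L i j => [|q L IH] i j; first by rewrite /= ltn0 andbF.
move=> [h1 h2]; case: i j => [|i] [|j] //= ij; last exact: IH.
exact: (allq_nth h1 ij).
Qed.

Lemma disjq_cat L1 L2 (Q1 Q2 : entry -> Prop) : disjq L1 -> disjq L2 ->
  allq Q1 L1 -> allq Q2 L2 ->
  (forall q q', Q1 q -> Q2 q' -> q.1.1 = q'.1.1 -> q.1.2 `&` q'.1.2 = set0) ->
  disjq (L1 ++ L2).
Proof.
move=> d1 d2 a1 a2 H; elim: L1 d1 a1 => //= q L1 IH [h1 h2] [h3 h4]; split; last exact: IH.
apply/allq_cat; split => //; apply: allq_impl a2 => q' h5; exact: H.
Qed.

Definition oppc D : bool -> set R := fun c => [set x | D c (- x)].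

Definition orient o D := if o then D else oppc D.

Definition stream m o D := mask m (orient o D).

(* The set of points [z] whose image under the orientation [o] lies in [(a, b]]. *)
Definition oriented_itv o (a b : R) : set R := if o then `]a, b]%classic else `[- b, - a[%classic.

(** A colour dropped by [m] keeps an entry with empty region, so a nonzero count is impossible for
    it; this agrees with the rate 0 in [srate]. *)
Fixpoint entries m o x s : seq entry :=
  if s is (d, k, l) :: s' then
    [:: (true, if m true then oriented_itv o x (x + d) else set0, k),
        (false, if m false then oriented_itv o x (x + d) else set0, l) &
        entries m o (x + d) s']
  else [::].

Lemma locfin_oppc D : locfin D -> locfin (oppc D).
Proof.
move=> lf c a b.
rewrite (_ : _ `&` _ = -%R @` (D c `&` `[- b, - a[)).
  apply: finite_image; apply: sub_finite_set (lf c (- b - 1) (- a)) => z [hz] /=.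
  by rewrite !in_itv/= => /andP[h1 h2]; split => //; apply/andP; split; lra.
apply/seteqP; split => x.
  move=> [hx]; rewrite /= in_itv/= => /andP[ax xb]; exists (- x); last by rewrite opprK.
  by split => //=; rewrite in_itv/= lerN2 xb ltrN2 ax.
move=> [z [hz]]; rewrite /= in_itv/= => /andP[bz za] <-; split.
  by rewrite /oppc /= opprK.
by rewrite /= in_itv/= ltrNr za lerNl bz.
Qed.

Lemma locfin_orient o D : locfin D -> locfin (orient o D).
Proof. by case: o => //; exact: locfin_oppc. Qed.

Lemma locfin_stream m o D : locfin D -> locfin (stream m o D).
Proof. by move=> lf; apply: locfin_mask; exact: locfin_orient. Qed.

Lemma ncard_oriented_itv D c o a b : locfin D ->
  ncard (D c `&` oriented_itv o a b) = num (orient o D) c a b.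
Proof.
case: o => //= lf; rewrite /num.
have E : D c `&` `[- b, - a[ = -%R @` (oppc D c `&` `]a, b]).
  apply/seteqP; split => x.
    move=> [hx]; rewrite /= in_itv/= => /andP[ax xb]; exists (- x); last by rewrite opprK.
    by split; [rewrite /oppc /= opprK|rewrite /= in_itv/=; apply/andP; split; lra].
  move=> [z [hz]]; rewrite /= in_itv/= => /andP[bz za] <-; split => //.
  by rewrite /= in_itv/= lerN2 za ltrN2.
have fo := locfin_oppc lf c a b.
rewrite E; apply/eqP; rewrite eqn_leq; apply/andP; split.
  apply: (ncard_inj_le (f := -%R)) => //; first exact: finite_image.
    by move=> _ [z hz <-]; rewrite opprK.
  by move=> x y _ _; exact: oppr_inj.
apply: (ncard_inj_le (f := -%R)) => //; first exact: finite_image.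
by move=> x y _ _; exact: oppr_inj.
Qed.

Lemma counts_entries m o x s D : locfin D ->
  counts_event (entries m o x s) D <-> cyl s (stream m o D) x.
Proof.
move=> lf; elim: s x => [|[[d k] l] s IH] x //=.
have E c : ncard (D c `&` (if m c then oriented_itv o x (x + d) else set0)) =
    num (stream m o D) c x (x + d).
  case: (boolP (m c)) => mc; first by rewrite num_mask// ncard_oriented_itv.
  by rewrite num_mask0// setI0 ncard0.
rewrite /counts_event /= !E -/(counts_event _ D); split.
  by move=> [h1 [h2 h3]]; split => //; exact: (IH _).1.
by move=> [h1 h2 h3]; split => //; split => //; exact: (IH _).2.
Qed.

Definition region m o x (q : entry) : Prop :=
  q.1.2 `<=` [set z | m q.1.1 /\ x < (if o then z else - z)].

Lemma entries_region m o x s : nneg s -> allq (region m o x) (entries m o x s).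
Proof.
elim: s x => [|[[d k] l] s IH] x //= /andP[d0 ns].
have H c : (if m c then oriented_itv o x (x + d) else set0) `<=`
   [set z | m c /\ x < (if o then z else - z)].
  case: (m c) => // z; rewrite /oriented_itv; case: (o); rewrite /= in_itv/= => /andP[h1 h2];
    split => //; lra.
split; first exact: (H true); split; first exact: (H false).
apply: allq_impl (IH (x + d) ns) => q h z /h[h1 h2]; split => //; lra.
Qed.

Lemma entries_disj m o x s : nneg s -> disjq (entries m o x s).
Proof.
elim: s x => [|[[d k] l] s IH] x //= /andP[d0 ns].
have H c : allq (fun q' => c = q'.1.1 ->
    (if m c then oriented_itv o x (x + d) else set0) `&` q'.1.2 = set0) (entries m o (x + d) s).
  apply: allq_impl (entries_region m o (x + d) ns) => q h _.
  apply/seteqP; split => // z [h1 /h[_ h2]]; move: h1 h2; case: (m c) => //.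
  by rewrite /oriented_itv; case: (o); rewrite /= in_itv/= => /andP[? ?] ?; lra.
split; first by split => //; exact: (H true).
by split; [exact: (H false)|exact: IH].
Qed.

End Streams.

Section PoissonCounts.
Context {R : realType} d (Omega : measurableType d) (P : probability Omega R).
Context (lam mu : R) (Bl Rd : Omega -> set R).
Hypothesis HP : indep_poisson_pair P lam mu Bl Rd.

Definition rate (c : bool) : R := if c then lam else mu.

Let Dr w : bool -> set R := bicolored (Bl w) (Rd w).

Lemma poisson_series (a : R) : (\sum_(0 <= k <oo) (poisson_pmf_R a k)%:E)%E = 1%E.
Proof.
apply/cvg_lim => //.
rewrite (_ : (fun n => _) = EFin \o (fun n => expR (- a) * series (exp_coeff a) n)); last first.
  apply/funext => n /=; rewrite sumEFin; congr EFin.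
  rewrite /series /= mulr_sumr; apply: eq_bigr => i _.
  by rewrite /poisson_pmf_R /exp_coeff /= mulrA.
apply: cvg_EFin; first exact: nearW.
rewrite -(expRxMexpNx_1 a) mulrC; apply: cvgMr.
exact: is_cvg_series_exp_coeff.
Qed.

Lemma cnt_event_measurable c (A : set R) k : measurable A -> bounded_set_R A ->
  measurable [set w | cnt (Dr w c `&` A) = (k%:R)%:E].
Proof. by move=> mA bA; have := HP.1 c A k mA bA; case: c. Qed.

Lemma cnt_event_prob (L : seq (entry (R := R))) :
  (forall i, (i < size L)%N -> measurable (nth entry0 L i).1.2) ->
  (forall i, (i < size L)%N -> bounded_set_R (nth entry0 L i).1.2) -> disjq L ->
  P (\bigcap_(i in [set: 'I_(size L)])
     [set w | cnt (Dr w (nth entry0 L i).1.1 `&` (nth entry0 L i).1.2) =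
              (((nth entry0 L i).2)%:R)%:E]) =
  (\prod_(q <- L) poisson_pmf_R (rate q.1.1 * fine (lebesgue_measure q.1.2)) q.2)%:E.
Proof.
move=> mL bL dL; pose q (i : 'I_(size L)) := nth entry0 L i.
have := HP.2 (size L) (fun i => (q i).1.1) (fun i => (q i).1.2) (fun i => (q i).2)
  (fun i => mL _ (ltn_ord i)) (fun i => bL _ (ltn_ord i)).
have dj : forall i j : 'I_(size L), i != j -> (q i).1.1 = (q j).1.1 -> (q i).1.2 `&` (q j).1.2 = set0.
  move=> i j ij E; have [h|h|h] := ltngtP (i : nat) j.
  - by apply: disjq_nth => //; rewrite h/=.
  - by rewrite setIC; apply: disjq_nth => //; rewrite h/=.
  - by move: ij; rewrite -val_eqE/= h eqxx.
move=> /(_ dj) E.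
rewrite (big_nth entry0) big_mkord -[RHS]E; congr (P _).
Qed.

End PoissonCounts.

Section Regularised.
Context {R : realType} d (Omega : measurableType d) (P : probability Omega R).
Context (lam mu : R) (Bl Rd : Omega -> set R).
Hypothesis HP : indep_poisson_pair P lam mu Bl Rd.
Implicit Types (m : bool -> bool) (o c : bool) (s : seq (R * nat * nat)).

Let Dr w : bool -> set R := bicolored (Bl w) (Rd w).

Let big (n : nat) : set R := `[- n%:R, n%:R]%classic.

Definition finite_event : set Omega :=
  \bigcap_n \bigcap_(c in [set: bool]) \bigcup_k [set w | cnt (Dr w c `&` big n) = (k%:R)%:E].

Let bounded_big n : bounded_set_R (big n).
Proof. by exists n%:R => x; rewrite /big /= in_itv/= ler_norml. Qed.

Let mbig n c k : measurable [set w | cnt (Dr w c `&` big n) = (k%:R)%:E].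
Proof. by apply: (cnt_event_measurable HP); [exact: measurable_itv|exact: bounded_big]. Qed.

Lemma measurable_finite_event : measurable finite_event.
Proof.
apply: bigcapT_measurable => n; apply: fin_bigcap_measurable => // c _.
by apply: bigcupT_measurable => k; exact: mbig.
Qed.

Lemma cnt_finite (S : set R) k : cnt S = (k%:R)%:E -> finite_set S.
Proof. by rewrite /cnt; case: asboolP. Qed.

Lemma finite_event_locfin w : finite_event w -> locfin (Dr w).
Proof.
move=> Gw c a b; pose n := Num.bound (`|a| + `|b|).
have [k _ /= /cnt_finite fS] := Gw n I c I.
apply: sub_finite_set fS => x [Dx]; rewrite /= in_itv/= => /andP[ax xb]; split => //.
have nb : `|a| + `|b| < n%:R by apply: archi_boundP; rewrite addr_ge0.
rewrite /big /= in_itv/=; have := ler_norm b; have := ler_norm (- a).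
rewrite normrN => h1 h2; have := normr_ge0 a; have := normr_ge0 b.
by move=> h3 h4; apply/andP; split; lra.
Qed.

(** An infinite set satisfies none of the equations [cnt = k], while the Poisson weights of these
    equations add up to 1. *)
Lemma finite_event_prob : P finite_event = 1%E.
Proof.
have F n c : P (\bigcup_k [set w | cnt (Dr w c `&` big n) = (k%:R)%:E]) = 1%E.
  rewrite measure_semi_bigcup; first last.
  - by apply: bigcupT_measurable => k; exact: mbig.
  - move=> i j _ _ [w [/= -> [/eqP]]]; by rewrite eqr_nat => /eqP.
  - by move=> k; exact: mbig.
  rewrite -[RHS](poisson_series (rate lam mu c * fine (lebesgue_measure (big n)))).
  apply: eq_eseriesr => k _.
  have := @cnt_event_prob _ _ _ P lam mu Bl Rd HP [:: (c, big n, k)].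
  rewrite big_seq1 /= => <-; first last.
  - by [].
  - by case=> // _; exact: bounded_big.
  - by case=> // _; exact: measurable_itv.
  congr (P _); apply/seteqP; split => w /=; last by move=> /(_ ord0 I).
  by move=> H i _; rewrite ord1.
have mF n c : measurable (\bigcup_k [set w | cnt (Dr w c `&` big n) = (k%:R)%:E]).
  by apply: bigcupT_measurable => k; exact: mbig.
have E n : \bigcap_(c in [set: bool]) \bigcup_k [set w | cnt (Dr w c `&` big n) = (k%:R)%:E] =
   \bigcup_k [set w | cnt (Dr w true `&` big n) = (k%:R)%:E] `&`
   \bigcup_k [set w | cnt (Dr w false `&` big n) = (k%:R)%:E].
  by apply/seteqP; split => [w H|w [h1 h2] [] _ //]; split; exact: H.
apply: prob_bigcap1 => n; rewrite E; first exact: measurableI.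
by rewrite prob_setI1.
Qed.

(* the configuration, emptied on the null event where it is not locally finite *)
Definition regular_conf w : bool -> set R :=
  if `[< finite_event w >] then Dr w else fun=> set0.

Lemma regular_confE w : finite_event w -> regular_conf w = Dr w.
Proof. by move=> h; rewrite /regular_conf asboolT. Qed.

Lemma locfin0 : locfin (fun=> set0 : set R).
Proof. by move=> c a b; rewrite set0I. Qed.

Lemma regular_conf_locfin w : locfin (regular_conf w).
Proof. by rewrite /regular_conf; case: asboolP => [/finite_event_locfin//|_]; exact: locfin0. Qed.

(** On [finite_event] the counts are those of the hypothesis; off it the configuration is empty and
    the event is everything or nothing. This keeps it measurable without completing [P]. *)
Lemma regular_conf_counts (L : seq (entry (R := R))) :
  (forall i, (i < size L)%N -> measurable (nth entry0 L i).1.2) ->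
  (forall i, (i < size L)%N -> bounded_set_R (nth entry0 L i).1.2) ->
  measurable [set w | counts_event L (regular_conf w)] /\
  (disjq L -> P [set w | counts_event L (regular_conf w)] =
    (\prod_(q <- L) poisson_pmf_R (rate lam mu q.1.1 * fine (lebesgue_measure q.1.2)) q.2)%:E).
Proof.
move=> mL bL; have mG := measurable_finite_event.
pose C := \bigcap_(i in [set: 'I_(size L)])
     [set w | cnt (Dr w (nth entry0 L i).1.1 `&` (nth entry0 L i).1.2) =
              (((nth entry0 L i).2)%:R)%:E].
have mC : measurable C.
  apply: fin_bigcap_measurable => // i _; apply: (cnt_event_measurable HP).
    exact: mL.
  exact: bL.
have EC w : finite_event w -> counts_event L (regular_conf w) <-> C w.
  move=> Gw; rewrite regular_confE//.
  have fS i : (i < size L)%N -> finite_set (Dr w (nth entry0 L i).1.1 `&` (nth entry0 L i).1.2).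
    move=> iL; have [M hM] := bL _ iL.
    apply: sub_finite_set (finite_event_locfin Gw (nth entry0 L i).1.1 (- M - 1) M).
    move=> x [Dx /hM /=]; rewrite ler_norml => /andP[h1 h2]; split => //=.
    by rewrite in_itv/= h2 andbT; lra.
  split.
    by move=> /allq_nth H i _ /=; rewrite cnt_eqE; [exact: H|exact: fS].
  move=> H; apply: nth_allq => i iL; have /= := H (Ordinal iL) I.
  by rewrite cnt_eqE//; exact: fS.
have E : [set w | counts_event L (regular_conf w)] `&` finite_event = C `&` finite_event.
  by apply/seteqP; split => w [h Gw]; split => //; apply/EC.
have m : measurable [set w | counts_event L (regular_conf w)].
  rewrite (_ : [set w | _] = (C `&` finite_event) `|`
     ([set w | counts_event L (fun=> set0 : set R)] `&` ~` finite_event)).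
    apply: measurableU; first exact: measurableI.
    apply: measurableI; last exact: measurableC.
    have [h|h] := pselect (counts_event L (fun=> set0 : set R)).
      by rewrite (_ : [set w | _] = setT)//; apply/seteqP; split.
    by rewrite (_ : [set w | _] = set0)//; apply/seteqP; split.
  apply/seteqP; split => w.
    move=> h; have [Gw|nGw] := pselect (finite_event w).
      by left; rewrite -E.
    by right; split => //; move: h; rewrite /regular_conf /= asboolF.
  rewrite -E => -[[]//|[h nGw]].
  by rewrite /regular_conf /= asboolF.
split => // dL; rewrite -(prob_setI1 mG m finite_event_prob) E prob_setI1//.
  exact: cnt_event_prob.
exact: finite_event_prob.
Qed.

Definition srate m : bool -> R := fun c => if m c then rate lam mu c else 0.

Lemma oriented_itv_ok o (a b : R) : a <= b -> measurable (oriented_itv o a b) /\ bounded_set_R (oriented_itv o a b) /\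
  fine (lebesgue_measure (oriented_itv o a b)) = b - a.
Proof.
move=> ab; have bnd (I : set R) (c e : R) : I `<=` `[c, e]%classic -> bounded_set_R I.
  move=> H; exists (`|c| + `|e|) => x /H; rewrite /= in_itv/= => /andP[cx xe].
  have := ler_norm e; have := ler_norm (- c); rewrite normrN => h1 h2.
  have := normr_ge0 e; have := normr_ge0 c => h3 h4.
  by rewrite ler_norml; apply/andP; split; lra.
rewrite /oriented_itv; case: o; (split; [exact: measurable_itv|split]).
- by apply: (bnd _ a b) => x; rewrite /= !in_itv/= => /andP[/ltW -> ->].
- rewrite lebesgue_measure_itv/= lte_fin; case: ltP => // ba.
  by rewrite (_ : a = b) ?subrr//; apply/eqP; rewrite eq_le ab ba.
- by apply: (bnd _ (- b) (- a)) => x; rewrite /= !in_itv/= => /andP[-> /ltW ->].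
- rewrite lebesgue_measure_itv/= lte_fin ltrN2; case: ltP => [_|ba].
    by rewrite /= opprK addrC.
  by rewrite (_ : a = b) ?subrr//; apply/eqP; rewrite eq_le ab ba.
Qed.

Lemma entries_ok m o x s : nneg s ->
  allq (fun q => measurable q.1.2 /\ bounded_set_R q.1.2) (entries m o x s) /\
  \prod_(q <- entries m o x s)
     poisson_pmf_R (rate lam mu q.1.1 * fine (lebesgue_measure q.1.2)) q.2 =
  cylpr (srate m) s.
Proof.
elim: s x => [|[[e k] l] s IH] x /=; first by rewrite /cylpr !big_nil.
move=> /andP[e0 ns]; have [h1 h2] := IH (x + e) ns.
have H c : measurable (if m c then oriented_itv o x (x + e) else set0) /\
    bounded_set_R (if m c then oriented_itv o x (x + e) else set0) /\
    rate lam mu c * fine (lebesgue_measure (if m c then oriented_itv o x (x + e) else set0)) =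
      srate m c * e.
  rewrite /srate; case: (m c); last first.
    by split => //; split; [exists 0 => z|rewrite measure0/= mulr0 mul0r].
  have xe : x <= x + e by rewrite lerDl.
  have [v1 [v2 v3]] := oriented_itv_ok o xe.
  by split => //; split => //; rewrite v3 addrC addKr.
have [a1 [a2 a3]] := H true; have [b1 [b2 b3]] := H false.
split; first by split => //; split.
by rewrite !big_cons h2 /cylpr big_cons /= a3 b3 mulrA.
Qed.

Definition spos o (x : R) : R := if o then x else - x.

(* [m] selects colours and [o] the half-line; two such streams are disjoint if they
   look at different half-lines or at different colours. *)
Definition compatible m1 o1 m2 o2 := o1 <> o2 \/ forall c, ~~ (m1 c && m2 c).

(** Each stream starts at the end of the cell on its own side, which is [- lo] in reflected
    coordinates. The cell with its single blue point and the two streams then occupy disjoint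
    regions. *)
Definition cell_entries m1 o1 s1 m2 o2 s2 (lo hi : R) : seq entry :=
  (true, `]lo, hi]%classic, 1%N) ::
  entries m1 o1 (if o1 then hi else - lo) s1 ++ entries m2 o2 (if o2 then hi else - lo) s2.

Lemma cell_counts m1 o1 s1 m2 o2 s2 (lo hi : R) : compatible m1 o1 m2 o2 ->
  nneg s1 -> nneg s2 -> lo <= hi ->
  measurable [set w | counts_event (cell_entries m1 o1 s1 m2 o2 s2 lo hi) (regular_conf w)] /\
  P [set w | counts_event (cell_entries m1 o1 s1 m2 o2 s2 lo hi) (regular_conf w)] =
  (poisson_pmf_R (lam * (hi - lo)) 1 * (cylpr (srate m1) s1 * cylpr (srate m2) s2))%:E.
Proof.
move=> cmp n1 n2 lohi.
set x1 := if o1 then hi else - lo; set x2 := if o2 then hi else - lo.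
have [a1 p1] := entries_ok m1 o1 x1 n1; have [a2 p2] := entries_ok m2 o2 x2 n2.
have [c1 [c2 c3]] := oriented_itv_ok true lohi.
have A : allq (fun q => measurable q.1.2 /\ bounded_set_R q.1.2)
    (cell_entries m1 o1 s1 m2 o2 s2 lo hi).
  by split => //; apply/allq_cat.
have dj : disjq (cell_entries m1 o1 s1 m2 o2 s2 lo hi).
  have r1 := entries_region m1 o1 x1 n1; have r2 := entries_region m2 o2 x2 n2.
  split.
    have far m o (q : entry (R := R)) : region m o (if o then hi else - lo) q ->
        true = q.1.1 -> `]lo, hi]%classic `&` q.1.2 = set0.
      move=> hq _; apply/seteqP; split => // z [/= + /hq[_]]; rewrite in_itv/=.
      by case: (o) => /andP[? ?] ?; lra.
    apply/allq_cat; split; [apply: allq_impl r1 => q|apply: allq_impl r2 => q]; exact: far.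
  apply: disjq_cat r1 r2 _; [exact: entries_disj|exact: entries_disj|].
  move=> q q' h1 h2 E; apply/seteqP; split => // z [/h1[m1q z1] /h2[m2q z2]].
  case: cmp => [oo|/(_ q.1.1)]; last by rewrite m1q E m2q.
  by move: z1 z2 oo; rewrite /x1 /x2; case: (o1); case: (o2) => //; lra.
have [mm pp] := regular_conf_counts (fun i h => (allq_nth A h).1) (fun i h => (allq_nth A h).2).
split => //; rewrite pp// big_cons big_cat /= p1 p2 /= -[X in fine (_ X)]/(oriented_itv true lo hi) c3.
by [].
Qed.

Lemma cell_countsE m1 o1 s1 m2 o2 s2 (lo hi : R) w :
  counts_event (cell_entries m1 o1 s1 m2 o2 s2 lo hi) (regular_conf w) <->
  [/\ num (regular_conf w) true lo hi = 1%N,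
      cyl s1 (stream m1 o1 (regular_conf w)) (if o1 then hi else - lo) &
      cyl s2 (stream m2 o2 (regular_conf w)) (if o2 then hi else - lo)].
Proof.
have lf := regular_conf_locfin w; rewrite /counts_event /= -[ncard _]/(num (regular_conf w) true lo hi).
split.
  by move=> [h1 /allq_cat[/(counts_entries _ _ _ _ lf) h2 /(counts_entries _ _ _ _ lf) h3]].
by move=> [h1 h2 h3]; split => //; apply/allq_cat; split; apply/(counts_entries _ _ _ _ lf).
Qed.

Lemma stream_measurable m o (x : R) : cyl_measurable (fun w => stream m o (regular_conf w)) (cst x).
Proof.
move=> s ns; have [a1 _] := entries_ok m o x ns.
have [mm _] := regular_conf_counts (fun i h => (allq_nth a1 h).1) (fun i h => (allq_nth a1 h).2).
rewrite (_ : cylset _ _ _ = [set w | counts_event (entries m o x s) (regular_conf w)])//.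
apply/seteqP; split => w /=; have lf := regular_conf_locfin w.
  by move=> h; apply/(counts_entries _ _ _ _ lf).
by move=> /(counts_entries _ _ _ _ lf).
Qed.

End Regularised.

(** * The Palm measure *)

Section BluePoints.
Context {R : realType} (D : bool -> set R) (lfD : locfin D).

(** Counted from 0: [blue_pos 0] is the first blue point after the origin. *)
Definition blue_pos k : R := pos (mask (eq_op true) D) 0 k.+1.

Let M := mask (eq_op true) D.

Let lfM : locfin M. Proof. exact: locfin_mask. Qed.

Lemma mono_first (y z : R) : D true z -> y < z -> isfirst M y (nxt M y) /\ nxt M y <= z.
Proof.
move=> Dz yz.
have Sz : (M true `&` `]y, z]) z by split => //=; rewrite in_itv/= yz lexx.
have [u [Mu +] umin] := finite_min (lfM true y z) Sz; rewrite /= in_itv/= => /andP[yu uz].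
have F : isfirst M y u.
  split => //; first by exists true.
  move=> [] v Mv yv //; have [vz|/ltW zv] := leP v z; last exact: le_trans zv.
  by apply: umin; split => //=; rewrite in_itv/= yv vz.
by rewrite (isfirst_nxt F).
Qed.

Lemma isfirst_gap (C : bool -> set R) y : isfirst C y (nxt C y) -> gap C y != 0.
Proof. by move=> [h _ _]; rewrite -normr_gt0 normr_gap subr_gt0. Qed.

Lemma isfirst_mask y : isfirst M y (nxt M y) -> D true (nxt M y) /\ gap M y < 0.
Proof.
move=> F; have [h [[] Mc _] _] := F; last by [].
by split => //; rewrite /gap asboolT// subr_lt0.
Qed.

Lemma blue_count k : (k <= num D true 0 1)%N ->
  [/\ 0 <= pos M 0 k, pos M 0 k <= 1, num D true 0 (pos M 0 k) = k &
   forall j, (j < k)%N -> isfirst M (pos M 0 j) (nxt M (pos M 0 j))].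
Proof.
elim: k => [|k IH] kn.
  by split; rewrite ?ler01//= num0// => z _ z0; rewrite leNgt z0.
have [p0 p1 pk pj] := IH (ltnW kn).
have [z [Dz kz z1]] : exists z, [/\ D true z, pos M 0 k < z & z <= 1].
  apply: contrapT => H; move: kn; rewrite (@numD _ D true 0 (pos M 0 k))// pk.
  rewrite num0 ?addn0 ?ltnn// => z Dz kz z1; apply: H; by exists z.
have [F Fz] := mono_first Dz kz; have [_ g0] := isfirst_mask F.
have kk : pos M 0 k <= pos M 0 k.+1 by exact: nxt_ge.
split.
- exact: le_trans kk.
- exact: le_trans Fz z1.
- rewrite (@numD _ D true 0 (pos M 0 k))// pk -[num D _ _ _]/(num M true _ _).
  by rewrite [num M _ _ _]num_first ?g0 ?addn1// isfirst_gap.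
- by move=> j; rewrite ltnS leq_eqVlt => /orP[/eqP->//|]; exact: pj.
Qed.

Lemma blue_posP k : (k < num D true 0 1)%N ->
  [/\ D true (blue_pos k), 0 < blue_pos k & blue_pos k <= 1].
Proof.
move=> kn; have [_ p1 _ pj] := blue_count kn; have F := pj k (ltnSn k).
have [p0 _ _ _] := blue_count (ltnW kn); have [Dk _] := isfirst_mask F.
by split => //; have [h _ _] := F; exact: le_lt_trans h.
Qed.

Lemma blue_pos_num k : (k < num D true 0 1)%N -> num D true 0 (blue_pos k) = k.+1.
Proof. by move=> kn; have [] := blue_count kn. Qed.

Lemma blue_pos_inj k l : (k < num D true 0 1)%N -> (l < num D true 0 1)%N ->
  blue_pos k = blue_pos l -> k = l.
Proof.
by move=> kn ln E; apply/eqP; rewrite -eqSS -(blue_pos_num kn) E (blue_pos_num ln).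
Qed.

Lemma blue_pos_surj z : D true z -> 0 < z -> z <= 1 ->
  exists2 k, (k < num D true 0 1)%N & blue_pos k = z.
Proof.
move=> Dz z0 z1; have inc (a b : R) : D true b -> 0 <= a -> a < b -> (num D true 0 a < num D true 0 b)%N.
  move=> Db a0 ab; rewrite (@numD _ D true 0 a b)//; last exact: ltW.
  rewrite -[X in (X < _)%N]addn0 ltn_add2l lt0n; apply/eqP => /(num_eq0 lfD)/(_ _ Db ab).
  by rewrite lexx => /(_ isT).
have n0 := inc 0 z Dz (lexx _) z0.
have nz : (num D true 0 z <= num D true 0 1)%N by apply: num_leq.
case E : (num D true 0 z) n0 nz => [|k] // n0 kn; exists k => //.
have [Dk k0 k1] := blue_posP kn; have nk := blue_pos_num kn.
have [h|h|//] := ltgtP (blue_pos k) z.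
  by have := inc _ _ Dz (ltW k0) h; rewrite nk E ltnn.
by have := inc _ _ Dk (ltW z0) h; rewrite nk E ltnn.
Qed.

End BluePoints.

Section Slices.
Context d (Omega : measurableType d).

Lemma measurable_slices (Z : set (Omega * nat)) :
  (forall k, measurable [set w | Z (w, k)]) -> measurable Z.
Proof.
move=> H; rewrite (_ : Z = \bigcup_k ([set w | Z (w, k)] `*` [set k])).
  by apply: bigcupT_measurable => k; apply: measurableX.
apply/seteqP; split => [[w k] Zwk|[w k] [l _ [/= h ->]]//].
by exists k.
Qed.

Lemma measurable_pairk (k : nat) : measurable_fun setT (fun w : Omega => (w, k)).
Proof. exact: pair2_measurable. Qed.

Lemma measurable_fun_slices d' (U : measurableType d') (f : Omega * nat -> U) :
  (forall k, measurable_fun setT (fun w => f (w, k))) -> measurable_fun setT f.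
Proof.
move=> H _ S mS; rewrite setTI; apply: measurable_slices => k.
exact: (measurable_preimage (H k)).
Qed.

End Slices.

Section Palm.
Context {R : realType} d (Omega : measurableType d) (P : probability Omega R).
Context (lam mu : R) (Bl Rd : Omega -> set R).
Hypothesis HP : indep_poisson_pair P lam mu Bl Rd.
Hypothesis lam0 : 0 < lam.
Implicit Types (m : bool -> bool) (o c : bool) (s : seq (R * nat * nat)).

Let D := regular_conf Bl Rd.

Let lfD w : locfin (D w). Proof. exact: regular_conf_locfin. Qed.

Definition nblue w : nat := num (D w) true 0 1.

Definition bpt k w : R := blue_pos (D w) k.

Lemma measurable_nblue n : measurable [set w | nblue w = n].
Proof.
have [c1 [c2 _]] := oriented_itv_ok true (@ler01 R).
have [mm _] := @regular_conf_counts _ _ _ P lam mu Bl Rd HP [:: (true, `]0, 1]%classic : set R, n)]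
  (ltac:(by case)) (ltac:(by case)).
rewrite (_ : [set w | _] = [set w | counts_event [:: (true, `]0, 1]%classic : set R, n)] (D w)])//.
by apply/seteqP; split => w //= [].
Qed.

Lemma measurable_lt_nblue k : measurable [set w | (k < nblue w)%N].
Proof.
rewrite (_ : [set w | _] = \bigcup_n [set w | nblue w = n /\ (k < n)%N]).
  apply: bigcupT_measurable => n; case: (ltnP k n) => kn.
    rewrite (_ : [set w | _] = [set w | nblue w = n]); first exact: measurable_nblue.
    by apply/seteqP; split => w //= [].
  by rewrite (_ : [set w | _] = set0)//; apply/seteqP; split => w //= [].
apply/seteqP; split => w /=; first by move=> h; exists (nblue w).
by move=> [n _ [/= ->]].
Qed.

Lemma measurable_bpt k : measurable_fun setT (bpt k).
Proof.
have mc : cyl_measurable (fun w => stream (eq_op true) true (D w)) (cst (0 : R)).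
  exact: (stream_measurable HP).
have lfS w : locfin (stream (eq_op true) true (D w)) by exact: locfin_stream.
exact: (cyl_measurable_pos lfS k.+1 mc (measurable_cst _)).2.
Qed.

Let nnlam : 0 <= lam^-1. Proof. by rewrite invr_ge0 ltW. Qed.

Definition palm_part k : {measure set (Omega * nat) -> \bar R} :=
  mscale (NngNum nnlam) (restricted_law P (measurable_lt_nblue k) (@measurable_pairk _ Omega k)).

(** The expected sum over the blue points of [(0, 1]], divided by the intensity; that its mass is 1
    comes out only in [palm_setT]. *)
Definition palm_measure : {measure set (Omega * nat) -> \bar R} := mseries palm_part 0.

Lemma palm_measureE (Z : set (Omega * nat)) : palm_measure Z =
  (\sum_(0 <= k <oo) lam^-1%:E * P [set w | (k < nblue w)%N /\ Z (w, k)])%E.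
Proof. by []. Qed.

Definition supp : set (Omega * nat) := [set wk | (wk.2 < nblue wk.1)%N].

Lemma measurable_supp : measurable supp.
Proof. by apply: measurable_slices => k; exact: measurable_lt_nblue. Qed.

Section TwoStreams.
Variables (m1 : bool -> bool) (o1 : bool) (m2 : bool -> bool) (o2 : bool).
Hypothesis cmp : compatible m1 o1 m2 o2.

Definition lo (n j : nat) : R := j%:R * grid n.
Definition hi (n j : nat) : R := j%:R * grid n + grid n.

Definition cell_ok s1 s2 n j : set Omega :=
  [set w | counts_event (cell_entries m1 o1 s1 m2 o2 s2 (lo n j) (hi n j)) (D w)].

Definition cell_approx s1 s2 n j : set (Omega * nat) :=
  [set wk | [/\ (wk.2 < nblue wk.1)%N, lo n j < bpt wk.2 wk.1 <= hi n j
     & cell_ok s1 s2 n j wk.1]].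

Definition palm_cyl s1 s2 : set (Omega * nat) :=
  [set wk | [/\ (wk.2 < nblue wk.1)%N,
     cyl s1 (stream m1 o1 (D wk.1)) (spos o1 (bpt wk.2 wk.1)) &
     cyl s2 (stream m2 o2 (D wk.1)) (spos o2 (bpt wk.2 wk.1))]].

Lemma lo_hi n j : lo n j <= hi n j.
Proof. by rewrite lerDl ltW// grid_gt0. Qed.

Lemma measurable_cell_slice s1 s2 n j k : nneg s1 -> nneg s2 ->
  measurable [set w | cell_approx s1 s2 n j (w, k)].
Proof.
move=> n1 n2.
rewrite (_ : [set w | _] = [set w | (k < nblue w)%N] `&`
   ([set w | `]lo n j, hi n j]%classic (bpt k w)] `&` cell_ok s1 s2 n j)); last first.
  by apply/seteqP; split => w /=; rewrite in_itv/=; [move=> [? ? ?]|move=> [? [? ?]]].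
apply: measurableI; first exact: measurable_lt_nblue.
apply: measurableI; last exact: (cell_counts HP cmp n1 n2 (lo_hi n j)).1.
by apply: (measurable_preimage (measurable_bpt k)); exact: measurable_itv.
Qed.

(** A cell inside [(0, 1]] with exactly one blue point contributes exactly one index [k]. The sum
    over [k] collapses to the probability of a count event on disjoint regions, where Poisson
    independence applies. *)
Lemma cell_approx_measure s1 s2 n j : nneg s1 -> nneg s2 -> (j < n.+1)%N ->
  palm_measure (cell_approx s1 s2 n j) =
  (lam^-1 * (poisson_pmf_R (lam * grid n) 1 * (cylpr (srate lam mu m1) s1 * cylpr (srate lam mu m2) s2)))%:E.
Proof.
move=> n1 n2 jn; rewrite palm_measureE nneseriesZl//.
have [mc pc] := cell_counts HP cmp n1 n2 (lo_hi n j).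
rewrite (_ : lam * grid n = lam * (hi n j - lo n j)); last by rewrite /hi /lo addrAC subrr add0r.
rewrite EFinM -pc; congr (_ * _)%E.
have mS k : measurable [set w | (k < nblue w)%N /\ cell_approx s1 s2 n j (w, k)].
  rewrite (_ : [set w | _] = [set w | cell_approx s1 s2 n j (w, k)]).
    exact: measurable_cell_slice.
  by apply/seteqP; split => w /=; [move=> []|move=> h; split => //; case: h].
have uniq_cell w z z' : cell_ok s1 s2 n j w -> D w true z -> D w true z' ->
    lo n j < z <= hi n j -> lo n j < z' <= hi n j -> z = z'.
  move=> /cell_countsE[/(num_eq1 (lfD w))[u [_ _ _ uu]] _ _] Dz Dz' /andP[a1 a2] /andP[b1 b2].
  by rewrite (uu z)// (uu z').
rewrite -measure_semi_bigcup//; first last.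
- exact: bigcupT_measurable.
- move=> k l _ _ [w [[kn [_ k1 ck]] [ln [_ l1 _]]]].
  have [Dk _ _] := blue_posP (lfD w) kn; have [Dl _ _] := blue_posP (lfD w) ln.
  exact: (blue_pos_inj (lfD w) kn ln (uniq_cell w _ _ ck Dk Dl k1 l1)).
congr (P _); apply/seteqP; split => w; first by move=> [k _ [_ []]].
move=> cw; have /cell_countsE[/(num_eq1 (lfD w))[u [Du u1 u2 _]] _ _] := cw.
have d0 := grid_gt0 n (R := R).
have l0 : 0 <= lo n j by rewrite mulr_ge0// ltW.
have h1 : hi n j <= 1.
  rewrite /hi -[X in _ + X]mul1r -mulrDl natr1 /grid ler_pdivrMr ?ltr0n// mul1r ler_nat.
  exact: jn.
have [k kn E] := blue_pos_surj (lfD w) Du (le_lt_trans l0 u1) (le_trans u2 h1).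
exists k => //; split => //; split => //; by rewrite /bpt /= E u1 u2.
Qed.

Definition approx s1 s2 n := \bigcup_(j in `I_n.+1) cell_approx s1 s2 n j.

Lemma measurable_cell_approx s1 s2 n j : nneg s1 -> nneg s2 ->
  measurable (cell_approx s1 s2 n j).
Proof. by move=> n1 n2; apply: measurable_slices => k; exact: measurable_cell_slice. Qed.

Lemma measurable_approx s1 s2 n : nneg s1 -> nneg s2 -> measurable (approx s1 s2 n).
Proof.
by move=> n1 n2; apply: bigcup_measurable => j _; exact: measurable_cell_approx.
Qed.

(** Each of the [n.+1] cells contributes [grid n * expR (- (lam * grid n))] times the two pattern
    probabilities, and [n.+1 * grid n] is 1. *)
Lemma approx_measure s1 s2 n : nneg s1 -> nneg s2 ->
  palm_measure (approx s1 s2 n) =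
  (expR (- (lam * grid n)) * (cylpr (srate lam mu m1) s1 * cylpr (srate lam mu m2) s2))%:E.
Proof.
move=> n1 n2; rewrite /approx bigcup_mkord.
rewrite measure_semi_additive_ord; first last.
- by apply: bigsetU_measurable => i _; exact: measurable_cell_approx.
- move=> i j _ _ [[w k] [[_ /andP[a1 a2] _] [_ /andP[b1 b2] _]]].
  apply/val_inj => /=; have d0 := grid_gt0 n (R := R); apply/eqP; rewrite eqn_leq; apply/andP; split.
    have : i%:R * @grid R n < j.+1%:R * grid n.
      by rewrite -natr1 mulrDl mul1r; exact: lt_le_trans a1 b2.
    by rewrite ltr_pM2r// ltr_nat ltnS.
  have : j%:R * @grid R n < i.+1%:R * grid n.
    by rewrite -natr1 mulrDl mul1r; exact: lt_le_trans b1 a2.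
  by rewrite ltr_pM2r// ltr_nat ltnS.
- by move=> i; exact: measurable_cell_approx.
rewrite (eq_bigr _ (fun i _ => cell_approx_measure n1 n2 (ltn_ord i))).
rewrite sumEFin sumr_const card_ord; congr EFin.
rewrite /poisson_pmf_R expr1 factS fact0 muln1 divr1 -mulr_natl.
have l1 : lam != 0 by rewrite gt_eqF.
have nn : n.+1%:R != 0 :> R by rewrite pnatr_eq0.
move: (expR _) (_ * cylpr _ _) => E X; rewrite /grid.
by move: (n.+1%:R) nn => z zz; field; rewrite zz l1.
Qed.

(** On a fine mesh a blue point is alone among the blue points of its cell, and the ends of the cell
    are so close to it that both streams show the same patterns from there as from the point. *)
Lemma approx_eventually_equal s1 s2 : eventually_equal (approx s1 s2) (palm_cyl s1 s2).
Proof.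
move=> [w k]; have [kn|kn] := ltnP k (nblue w); last first.
  exists 0%N => n _; split; first by move=> [j _ [/=]]; rewrite ltnNge kn.
  by move=> [/=]; rewrite ltnNge kn.
have [Db b0 b1] := blue_posP (lfD w) kn; set b := blue_pos (D w) k in Db b0 b1.
have [e1 e1p H1] := locfin_gap true b (lfD w).
(* A free stretch after [- b] in the reflected configuration is one to the left of [b]. *)
have [e2 e2p H2] := locfin_gap true (- b) (locfin_oppc (lfD w)).
have [e3 e3p H3] := cyl_right_cont s1 (spos o1 b) (locfin_stream m1 o1 (lfD w)).
have [e4 e4p H4] := cyl_right_cont s2 (spos o2 b) (locfin_stream m2 o2 (lfD w)).
have [n0 Hn0] : exists n0, forall n, (n0 <= n)%N ->
    @grid R n < Num.min (Num.min e1 e2) (Num.min e3 e4).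
  by apply: grid_lt; rewrite !lt_min e1p e2p e3p e4p.
exists n0 => n /Hn0; rewrite !lt_min => /andP[/andP[l1 l2] /andP[l3 l4]].
have d0 := grid_gt0 n (R := R).
have base o (e : R) j : grid n < e -> lo n j < b <= hi n j ->
    spos o b <= (if o then hi n j else - lo n j) /\
    (if o then hi n j else - lo n j) < spos o b + e.
  by move=> ne /andP[]; rewrite /lo /hi /spos; case: o => h1 h2; split; lra.
split.
  move=> [j _ [/= _ bj /cell_countsE[_ c1 c2]]]; split => //=.
    have [p1 p2] := base o1 e3 j l3 bj; by rewrite -(H3 _ p1 p2).
  have [p1 p2] := base o2 e4 j l4 bj; by rewrite -(H4 _ p1 p2).
move=> [/= _ c1 c2]; have [j /andP[j1 j2]] := ceil_cell b0 d0.
have bj : lo n j < b <= hi n j by rewrite j1 j2.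
exists j.
  rewrite /= ltnNge; apply/negP => nj.
  have : 1 < b; last by rewrite ltNge b1.
  apply: le_lt_trans j1; rewrite /grid ler_pdivlMr ?ltr0n// mul1r ler_nat//.
split => //; apply/cell_countsE; split.
- apply: (num1 Db j1 j2) => u Du u1 u2; have [ub|bu|//] := ltgtP u b.
    exfalso; apply: (H2 (- u)); rewrite /oppc /= ?opprK ?ltrN2//.
    by move: u1 u2 j2; rewrite /lo /hi; lra.
  by exfalso; apply: (H1 u) => //; move: u1 u2 j1; rewrite /lo /hi; lra.
- have [p1 p2] := base o1 e3 j l3 bj; by rewrite (H3 _ p1 p2).
- have [p1 p2] := base o2 e4 j l4 bj; by rewrite (H4 _ p1 p2).
Qed.

Lemma measurable_palm_cyl s1 s2 : nneg s1 -> nneg s2 -> measurable (palm_cyl s1 s2).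
Proof.
move=> n1 n2; apply: eventually_equal_measurable (approx_eventually_equal s1 s2) => n.
exact: measurable_approx.
Qed.

(** Passing to the limit in measure requires finiteness first. A Fatou argument gives it: [supp] is
    the increasing union of tail intersections of the unconstrained approximations, each of mass at
    most 1. *)
Lemma palm_measure_supp_le1 : (palm_measure supp <= 1)%E.
Proof.
have E : supp = \bigcup_i \bigcap_k approx [::] [::] (i + k)%N.
  apply/seteqP; split => wk.
    move=> kn; have [n0 H] := approx_eventually_equal [::] [::] wk; exists n0 => // k _.
    by apply/H => //; exact: leq_addr.
  move=> [i _ /(_ 0%N I)]; by move=> [j _ []].
have m i : measurable (\bigcap_k approx [::] [::] (i + k)%N).
  by apply: bigcapT_measurable => k; exact: measurable_approx.
have cv : palm_measure (\bigcap_k approx [::] [::] (i + k)%N) @[i --> \oo] --> palm_measure supp.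
  rewrite E; apply: nondecreasing_cvg_mu => //.
    exact: bigcupT_measurable.
  move=> i j ij; apply/subsetPset => wk h k _.
  by have := h (j - i + k)%N I; rewrite addnA subnKC.
rewrite -(cvg_lim _ cv)//; apply: lime_le; first by apply/cvg_ex; exists (palm_measure supp).
apply: nearW => i; apply: (@le_trans _ _ (palm_measure (approx [::] [::] i))).
  apply: le_measure; [exact: mem_set|by apply: mem_set; exact: measurable_approx|].
  by move=> wk /(_ 0%N I); rewrite addn0.
rewrite approx_measure// /cylpr !big_nil !mulr1 lee_fin -expR0 ler_expR.
by rewrite oppr_le0 mulr_ge0// ltW// grid_gt0.
Qed.

Lemma palm_measure_fin : (palm_measure setT < +oo)%E.
Proof.
apply: (@le_lt_trans _ _ 1%E); last exact: ltry.
apply: le_trans palm_measure_supp_le1; rewrite !palm_measureE.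
apply: lee_nneseries => [k _ _|k _].
  by rewrite mule_ge0.
apply: lee_wpmul2l; first by rewrite lee_fin.
apply: le_measure; [apply: mem_set|apply: mem_set|by move=> w [h _]; split].
  rewrite (_ : [set w | _] = [set w | (k < nblue w)%N]); first exact: measurable_lt_nblue.
  by apply/seteqP; split => w //= [].
rewrite (_ : [set w | _] = [set w | (k < nblue w)%N]); first exact: measurable_lt_nblue.
by apply/seteqP; split => w //= [].
Qed.

(** Slivnyak's theorem on finite patterns: seen from the typical blue point, which neither stream
    counts, the two streams are independent Poisson processes with their original rates. *)
Lemma palm_cyl_measure s1 s2 : nneg s1 -> nneg s2 ->
  palm_measure (palm_cyl s1 s2) = (cylpr (srate lam mu m1) s1 * cylpr (srate lam mu m2) s2)%:E.
Proof.
move=> n1 n2.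
have c1 := eventually_equal_measure palm_measure_fin (fun n => measurable_approx n n1 n2) (approx_eventually_equal s1 s2).
have c2 : palm_measure (approx s1 s2 n) @[n --> \oo] -->
    (cylpr (srate lam mu m1) s1 * cylpr (srate lam mu m2) s2)%:E.
  under eq_fun do rewrite approx_measure//.
  apply: cvg_EFin; first exact: nearW.
  rewrite -[X in _ --> X]mul1r; apply: cvgMl.
  apply: (@squeeze_cvgr _ _ _ _ (fun n => 1 - lam * grid n) (fun=> 1)); last exact: cvg_cst.
    apply: nearW => n; rewrite expR_ge1Dx/= -expR0 ler_expR.
    by rewrite oppr_le0 mulr_ge0// ltW// grid_gt0.
  rewrite -[X in _ --> X]subr0 -(mulr0 lam); apply: cvgB; first exact: cvg_cst.
  apply: cvgMr; exact: grid_cvg.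
exact: (cvg_unique _ c1 c2).
Qed.

End TwoStreams.
End Palm.

(** * Joint law of the gaps of two independent streams *)

Section TwoStreamLaw.
Context {R : realType} d (T : measurableType d) (P : probability T R).

Definition rcyl_law (a : bool -> R) (nu : probability (seqT R) R) :=
  forall l, all rvalid l -> nu [set y | rcyl l y] = (\prod_(r <- l) rprob a r)%:E.

Context (D1 D2 : T -> bool -> set R) (tau1 tau2 : T -> R) (a1 a2 : bool -> R).
Hypotheses (lf1 : forall w, locfin (D1 w)) (lf2 : forall w, locfin (D2 w)).
Hypotheses (mc1 : cyl_measurable D1 tau1) (mc2 : cyl_measurable D2 tau2).
Hypotheses (mt1 : measurable_fun setT tau1) (mt2 : measurable_fun setT tau2).
Hypotheses (a1_gt0 : 0 < a1 true + a1 false) (a2_gt0 : 0 < a2 true + a2 false).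
Hypothesis indep : forall s1 s2, nneg s1 -> nneg s2 ->
  P (cylset D1 tau1 s1 `&` cylset D2 tau2 s2) = (cylpr a1 s1 * cylpr a2 s2)%:E.

Let G1 w : seqT R := gaps (D1 w) (tau1 w).
Let G2 w : seqT R := gaps (D2 w) (tau2 w).

Let cyl0 (D : T -> bool -> set R) tau : cylset D tau [::] = setT.
Proof. by apply/seteqP; split. Qed.

Let P1 s : nneg s -> P (cylset D1 tau1 s) = (cylpr a1 s)%:E.
Proof.
move=> n; have := indep n (isT : nneg [::]).
by rewrite cyl0 setIT /cylpr big_nil mulr1.
Qed.

Let P2 s : nneg s -> P (cylset D2 tau2 s) = (cylpr a2 s)%:E.
Proof.
move=> n; have := indep (isT : nneg [::]) n.
by rewrite cyl0 setTI /cylpr big_nil mul1r.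
Qed.

(** [chain_prob] twice: for the first stream with a count pattern of the second as the event carried
    along, then for the second stream with the gap event of the first in that place. *)
Lemma two_stream_rcyl l1 l2 : all rvalid l1 -> all rvalid l2 ->
  P ([set w | rcyl l1 (G1 w)] `&` [set w | rcyl l2 (G2 w)]) =
  ((\prod_(r <- l1) rprob a1 r) * (\prod_(r <- l2) rprob a2 r))%:E.
Proof.
move=> v1 v2.
have mG1 : measurable [set w | rcyl l1 (G1 w)].
  by apply: (measurable_preimage (measurable_gaps lf1 mc1 mt1)); exact: measurable_rcyl.
have E s : nneg s -> P (cylset D2 tau2 s `&` [set w | rcyl l1 (G1 w)]) =
    (cylpr a2 s * \prod_(r <- l1) rprob a1 r)%:E.
  move=> ns; rewrite (chain_prob lf1 (a := a1) (mc2 ns) mc1)//; first by rewrite P2// EFinM.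
  by move=> s1 ns1; rewrite setIC indep// P2// -EFinM mulrC.
have E0 : P [set w | rcyl l1 (G1 w)] = (\prod_(r <- l1) rprob a1 r)%:E.
  by have := E [::] isT; rewrite cyl0 setTI /cylpr big_nil mul1r.
rewrite (chain_prob lf2 (a := a2) mG1 mc2)//; first by rewrite E0 EFinM.
by move=> s ns; rewrite setIC E// E0 -EFinM mulrC.
Qed.

Lemma two_stream_law nu1 nu2 : rcyl_law a1 nu1 -> rcyl_law a2 nu2 ->
  forall S1 S2 : set (seqT R), measurable S1 -> measurable S2 ->
  P ([set w | S1 (G1 w)] `&` [set w | S2 (G2 w)]) = (nu1 S1 * nu2 S2)%E.
Proof.
move=> n1 n2 S1 S2 mS1 mS2.
have m1 := measurable_gaps lf1 mc1 mt1; have m2 := measurable_gaps lf2 mc2 mt2.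
have E0 l1 : all rvalid l1 -> P [set w | rcyl l1 (G1 w)] = (\prod_(r <- l1) rprob a1 r)%:E.
  move=> v1; have := two_stream_rcyl v1 (isT : all rvalid [::]).
  by rewrite big_nil mulr1 (_ : [set w | rcyl [::] _] = setT) ?setIT//; apply/seteqP.
have mr1 l1 : all rvalid l1 -> measurable [set w | rcyl l1 (G1 w)].
  by move=> v; apply: (measurable_preimage m1); exact: measurable_rcyl.
have H2 l1 : all rvalid l1 -> P ([set w | rcyl l1 (G1 w)] `&` [set w | S2 (G2 w)]) =
    (P [set w | rcyl l1 (G1 w)] * nu2 S2)%E.
  move=> v1.
  apply: (indep_pi_lambda (mr1 _ v1) m2 (P := P) (Q := nu2) (G := rcylsys)) => //.
  - exact: rcylsys_setI.
  - exact: rcylsysT.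
  move=> _ [->|[l2 v2 ->]]; first by rewrite preimage_set0 setI0 !measure0 mule0.
  by rewrite [LHS](two_stream_rcyl v1 v2) E0// EFinM; congr (_ * _)%E; exact/esym/n2.
have mS : measurable [set w | S2 (G2 w)] by exact: (measurable_preimage m2).
have ES : P [set w | S2 (G2 w)] = nu2 S2.
  have := H2 [::] isT; rewrite (_ : [set w | rcyl [::] _] = setT); last by apply/seteqP.
  by rewrite setTI probability_setT mul1e.
rewrite setIC muleC -ES.
apply: (indep_pi_lambda mS m1 (P := P) (Q := nu1) (G := rcylsys)) => //.
- exact: rcylsys_setI.
- exact: rcylsysT.
move=> _ [->|[l1 v1 ->]]; first by rewrite preimage_set0 setI0 !measure0 mule0.
by rewrite setIC [LHS](H2 _ v1) ES E0// muleC; congr (_ * _)%E; exact/esym/n1.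
Qed.

End TwoStreamLaw.

Section PalmStreams.
Context {R : realType} d (Omega : measurableType d) (P : probability Omega R).
Context (lam mu : R) (Bl Rd : Omega -> set R).
Hypothesis HP : indep_poisson_pair P lam mu Bl Rd.
Hypotheses (lam0 : 0 < lam) (mu0 : 0 < mu).
Implicit Types (m : bool -> bool) (o c : bool) (s : seq (R * nat * nat)).

Local Notation T := (Omega * nat)%type.
Local Notation D := (regular_conf Bl Rd).
Local Notation supp := (supp Bl Rd).
Local Notation pm := (palm_measure HP lam0).

Lemma palm_setI_supp (Z : set T) : pm Z = pm (Z `&` supp).
Proof.
rewrite !palm_measureE; apply: eq_eseriesr => k _; congr (_ * P _)%E.
by apply/seteqP; split => w /= => [[? ?]|[? []]].
Qed.

(** A stream without colours is compatible with every stream, which reduces statements about one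
    stream to those about two. *)
Definition compat0 m o : compatible m o (fun=> false) true :=
  or_intror (fun c => negbT (andbF (m c))).

Lemma palm_setT : pm setT = 1%E.
Proof.
rewrite palm_setI_supp setTI.
have := palm_cyl_measure HP lam0 (compat0 (fun=> true) true) (isT : nneg [::]) (isT : nneg [::]).
rewrite /cylpr !big_nil mulr1 => <-; congr (pm _).
by apply/seteqP; split => wk //= [].
Qed.

(* The Palm measure is a priori only a measure; the alias lets [palm_setT] turn it
   into a probability. *)
Definition palm_fun (Z : set T) : \bar R := pm Z.

HB.instance Definition _ := isMeasure.Build _ _ _ palm_fun
  (measure0 pm) (measure_ge0 pm) (@measure_semi_sigma_additive _ _ _ pm).

HB.instance Definition _ := Measure_isProbability.Build _ _ _ palm_fun palm_setT.

Definition palm : probability T R := palm_fun.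

Lemma palmE Z : palm Z = (\sum_(0 <= k <oo) lam^-1%:E * P [set w | (k < nblue Bl Rd w)%N /\ Z (w, k)])%E.
Proof. by []. Qed.

(** Off the support [bpt] need not be a blue point of the window; configuration and base get
    constant values there, on a set that the Palm measure does not charge. *)
Definition sconf m o (wk : T) : bool -> set R :=
  if (wk.2 < nblue Bl Rd wk.1)%N then stream m o (D wk.1) else fun=> set0.

Definition sbase o (wk : T) : R :=
  if (wk.2 < nblue Bl Rd wk.1)%N then spos o (bpt Bl Rd wk.2 wk.1) else 0.

Lemma sconf_locfin m o wk : locfin (sconf m o wk).
Proof.
rewrite /sconf; case: ifP => _; last exact: locfin0.
by apply: locfin_stream; exact: regular_conf_locfin.
Qed.

Lemma sconf_measurable m o : cyl_measurable (sconf m o) (sbase o).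
Proof.
move=> s ns; have ms := measurable_supp HP.
rewrite (_ : cylset _ _ _ = palm_cyl Bl Rd m o (fun=> false) true s [::] `|`
   ([set wk | cyl s (fun=> set0 : set R) 0] `&` ~` supp)).
  apply: measurableU; first exact: (measurable_palm_cyl HP (compat0 m o) ns (isT : nneg [::])).
  apply: measurableI; last exact: measurableC.
  have [h|h] := pselect (cyl s (fun=> set0 : set R) 0).
    by rewrite (_ : [set wk | _] = setT)//; apply/seteqP; split.
  by rewrite (_ : [set wk | _] = set0)//; apply/seteqP; split.
apply/seteqP; split => wk; rewrite /cylset /sconf /sbase /supp /palm_cyl /=; case: ifP => h.
- by move=> c; left.
- by move=> c; right; split.
- by move=> [[]|[_ []]].
- by move=> [[]|[]].
Qed.

Lemma measurable_sbase o : measurable_fun setT (sbase o).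
Proof.
apply: measurable_fun_slices => k; rewrite /sbase /=.
apply: (measurable_fun_ifT (f := fun w => (k < nblue Bl Rd w)%N)).
- apply: (measurable_fun_bool true); rewrite setTI.
  exact: (measurable_lt_nblue HP).
- have mb := measurable_bpt HP k; rewrite /spos; case: o => //.
  by apply: measurableT_comp.
- exact: measurable_cst.
Qed.

Definition sgaps m o (wk : T) : seqT R := gaps (sconf m o wk) (sbase o wk).

Lemma measurable_sgaps m o : measurable_fun setT (sgaps m o).
Proof.
apply: measurable_gaps; [exact: sconf_locfin|exact: sconf_measurable|exact: measurable_sbase].
Qed.

Lemma sconf_indep m1 o1 m2 o2 s1 s2 : compatible m1 o1 m2 o2 -> nneg s1 -> nneg s2 ->
  palm (cylset (sconf m1 o1) (sbase o1) s1 `&` cylset (sconf m2 o2) (sbase o2) s2) =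
  (cylpr (srate lam mu m1) s1 * cylpr (srate lam mu m2) s2)%:E.
Proof.
move=> cmp n1 n2; rewrite -(palm_cyl_measure HP lam0 cmp n1 n2).
rewrite -[LHS]/(pm _) palm_setI_supp; congr (pm _).
apply/seteqP; split => wk; rewrite /cylset /sconf /sbase /supp /palm_cyl /=.
  by move=> [[+ +] h]; rewrite h.
by move=> [h c1 c2]; rewrite h.
Qed.

Lemma srate_gt0 m c : m c -> 0 < srate lam mu m true + srate lam mu m false.
Proof.
rewrite /srate /rate; case: c => ->; case: ifP => _; rewrite ?addr0 ?add0r ?addr_gt0//.
Qed.

Lemma sgaps_law m1 o1 m2 o2 c1 c2 nu1 nu2 : compatible m1 o1 m2 o2 -> m1 c1 -> m2 c2 ->
  rcyl_law (srate lam mu m1) nu1 -> rcyl_law (srate lam mu m2) nu2 ->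
  forall S1 S2 : set (seqT R), measurable S1 -> measurable S2 ->
  palm ([set w | S1 (sgaps m1 o1 w)] `&` [set w | S2 (sgaps m2 o2 w)]) = (nu1 S1 * nu2 S2)%E.
Proof.
move=> cmp h1 h2; apply: two_stream_law.
- exact: sconf_locfin.
- exact: sconf_locfin.
- exact: sconf_measurable.
- exact: sconf_measurable.
- exact: measurable_sbase.
- exact: measurable_sbase.
- exact: srate_gt0 h1.
- exact: srate_gt0 h2.
- by move=> s1 s2; exact: sconf_indep.
Qed.

Definition sgaps_nu m o : probability (seqT R) R := law palm (measurable_sgaps m o).

Lemma sgaps_rcyl m o c : m c -> rcyl_law (srate lam mu m) (sgaps_nu m o).
Proof.
move=> mc l v; rewrite /sgaps_nu -[LHS]/(palm [set w | rcyl l (sgaps m o w)]).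
rewrite -[X in palm X]setTI (chain_prob (sconf_locfin m o) (a := srate lam mu m) measurableT)//.
- by rewrite probability_setT mul1e.
- exact: sconf_measurable.
- move=> s ns; have := sconf_indep (compat0 m o) ns (isT : nneg [::]).
  rewrite setTI probability_setT mul1e /cylpr big_nil mulr1 => <-; congr (palm _).
  by apply/seteqP; split => wk //= [].
- exact: srate_gt0 mc.
Qed.

End PalmStreams.

(** * Mutual independence of two families from finite prefixes *)

Section MutualIndep.
Context {R : realType} d (T : measurableType d) (P : probability T R).
Context d' (V : measurableType d') (X X' : nat -> T -> V).
Hypotheses (mX : forall i, measurable_fun setT (X i)) (mX' : forall i, measurable_fun setT (X' i)).
Hypothesis prefix : forall m (D D' : nat -> set V),
  (forall i, measurable (D i)) -> (forall i, measurable (D' i)) ->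
  P ([set w | forall i, (i < m)%N -> D i (X i w)] `&`
     [set w | forall i, (i < m)%N -> D' i (X' i w)]) =
  ((\prod_(i < m) P (X i @^-1` D i)) * (\prod_(i < m) P (X' i @^-1` D' i)))%E.

Let code (x : nat + nat) : nat := match x with inl i => i | inr i => i end.

(** Finitely many indices of the two families lie in a common initial stretch, and positions that
    are not selected receive the whole space. *)
Lemma mutual_indep_prefix : mutual_indep P (pair_family X X').
Proof.
split; first by case => i /=; [exact: mX|exact: mX'].
move=> s A us mA.
pose sel (t : seq (nat + nat)) x := if x \in t then A x else setT.
pose f t i := P (X i @^-1` sel t (inl i)); pose f' t i := P (X' i @^-1` sel t (inr i)).
have mS t x : measurable (sel t x) by rewrite /sel; case: ifP.
have [m sm] : exists m, forall x, x \in s -> (code x < m)%N.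
  exists (\max_(x <- s) code x).+1 => x xs; rewrite ltnS.
  by rewrite (big_rem x) //= leq_max leqnn.
have -> : \big[setI/setT]_(i <- s) (pair_family X X' i @^-1` A i) =
    [set w | forall i, (i < m)%N -> sel s (inl i) (X i w)] `&`
    [set w | forall i, (i < m)%N -> sel s (inr i) (X' i w)].
  rewrite -bigcap_seq; apply/seteqP; split => w.
    by move=> H; split => i im; rewrite /sel; case: ifP => // /H.
  move=> [h1 h2] [i|i] /= xs.
    by have := h1 i (sm _ xs); rewrite /sel xs.
  by have := h2 i (sm _ xs); rewrite /sel xs.
rewrite (@prefix m (fun i => sel s (inl i)) (fun i => sel s (inr i)))//.
have E0 t x : x \notin t -> P (pair_family X X' x @^-1` sel t x) = 1%E.
  by move=> /negbTE xt; rewrite /sel xt preimage_setT probability_setT.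
(* Dropping [x] from [t] changes the single factor at [x], which becomes 1. *)
have key t : uniq t -> {subset t <= s} ->
    ((\prod_(i < m) f t i) * (\prod_(i < m) f' t i) =
     \prod_(x <- t) P (pair_family X X' x @^-1` A x))%E.
  elim: t => [_ _|x t IH /= /andP[xt ut] ts].
    rewrite big_nil !big1 ?mule1// => i _; exact: (E0 [::] (inr (i : nat)))||exact: (E0 [::] (inl (i : nat))).
  rewrite big_cons -IH//; last by move=> y yt; apply: ts; rewrite inE yt orbT.
  have neq y : y != x -> sel (x :: t) y = sel t y by move=> yx; rewrite /sel inE (negbTE yx).
  have xm := sm x (ts x (mem_head _ _)).
  have Ex : sel (x :: t) x = A x by rewrite /sel mem_head.
  case: x xt xm Ex neq {ts} => k kt /= km Ek neq.
    rewrite [X in (_ * X = _)%E](eq_bigr (fun i : 'I_m => f' t i)); last by move=> i _; rewrite /f' neq.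
    rewrite (bigD1 (Ordinal km))//= [in RHS](bigD1 (Ordinal km))//= {1}/f Ek.
    rewrite [f t k](E0 t (inl k) kt) mul1e !muleA; congr (_ * _ * _)%E.
    apply: eq_bigr => i ik; rewrite /f neq//; apply: contraNneq ik => -[ik].
  rewrite [X in (X * _ = _)%E](eq_bigr (fun i : 'I_m => f t i)); last by move=> i _; rewrite /f neq.
  rewrite [X in (_ * X = _)%E](bigD1 (Ordinal km))//= [X in (_ = _ * (_ * X))%E](bigD1 (Ordinal km))//=.
  have -> : f' (inr k :: t) k = P (X' k @^-1` A (inr k)) by rewrite /f' Ek.
  rewrite [f' t k](E0 t (inr k) kt) mul1e muleCA; congr (_ * (_ * _))%E.
  apply: eq_bigr => i ik; rewrite /f' neq//; apply: contraNneq ik => -[ik].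
exact: key.
Qed.

End MutualIndep.

(** * Measurable selection of the matching distance *)

Section Selection.
Context {R : realType} d (Omega : measurableType d).
Context (n : Omega -> nat) (blue_dist : Omega -> nat -> \bar R) (G : set Omega).
Context (low high : nat -> Omega -> \bar R).
Hypotheses (mn : forall k, measurable [set w | n w = k]) (mG : measurable G).
Hypotheses (ml : forall k, measurable_fun setT (low k)) (mh : forall k, measurable_fun setT (high k)).

(* Only the counts of matching distances in a given set are assumed measurable, not
   the distance of the [k]-th blue point.  Its values are therefore sorted and
   reassigned to the indices by a measurable permutation that keeps the bounds. *)
Definition value_seq w : seq (\bar R) := [seq blue_dist w k | k <- iota 0 (n w)].

Hypothesis mcount : forall (A : set (\bar R)) j, measurable A ->
  measurable [set w | G w /\ (j < count (fun y => `[< A y >]) (value_seq w))%N].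
Hypothesis between : forall w k, G w -> (k < n w)%N ->
  (low k w <= blue_dist w k)%E /\ (blue_dist w k <= high k w)%E.

Definition order_stat j w : \bar R :=
  if `[< G w >] then nth +oo%E (sort <=%O (value_seq w)) j else 0%E.

Lemma nth_sorted_lt (s : seq (\bar R)) j x : sorted <=%O s ->
  (nth +oo%E s j < x)%O = (j < count (fun y => (y < x)%O) s)%N.
Proof.
elim: s j => [|a s IH] j /=; first by rewrite nth_nil ltn0 ltNge leey.
move=> pas; have ss := path_sorted pas; have am := order_path_min le_trans pas.
have [ax|xa] := ltP a x.
  by case: j => [|j] /=; [rewrite ax|rewrite IH].
have c0 : count (fun y => (y < x)%O) s = 0%N.
  apply/eqP; rewrite -leqn0 leqNgt -has_count; apply/hasPn => y ys.
  by rewrite -leNgt; apply: le_trans xa _; exact: (allP am).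
rewrite c0 add0n ltn0; case: j => [|j] /=; first by rewrite ltNge xa.
by rewrite IH// c0.
Qed.

(** The value of rank [j] is below [r] exactly when more than [j] values are, and that is a count
    event. *)
Lemma measurable_order_stat j : measurable_fun setT (order_stat j).
Proof.
apply: (measurability _ (ErealGenInftyO.measurableE R)) => _ [_ [r ->] <-].
rewrite setTI (_ : _ @^-1` _ =
  [set w | G w /\ (j < count (fun y => `[< [set y | (y < r%:E)%E] y >]) (value_seq w))%N] `|`
  (if (0 < r)%R then ~` G else set0)).
  apply: measurableU; last by case: ifP => // _; exact: measurableC.
  apply: mcount; rewrite -[X in measurable X]set_itvNyo; exact: emeasurable_itv.
have E w : G w -> (order_stat j w < r%:E)%O =
    (j < count (fun y => `[< [set y | (y < r%:E)%E] y >]) (value_seq w))%N.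
  move=> Gw; rewrite /order_stat asboolT// nth_sorted_lt//; last exact: sort_le_sorted.
  rewrite (@eq_count _ _ (fun y => (y < r%:E)%O)); last by move=> y /=; rewrite asboolb.
  by congr (_ < _)%N; apply/permP; rewrite perm_sort.
apply/seteqP; split => w /=; rewrite in_itv/=.
  have [Gw|nGw] := pselect (G w); first by rewrite E// => h; left.
  rewrite /order_stat asboolF//; rewrite lte_fin => ->; by right.
move=> [[Gw h]|]; first by rewrite E.
by case: ifP => // r0 nGw; rewrite /order_stat asboolF// lte_fin.
Qed.

Definition good_perm (s : seq nat) : set Omega :=
  [set w | perm_eq s (iota 0 (n w)) /\ forall k, (k < n w)%N ->
    (low k w <= order_stat (nth 0%N s k) w)%E /\ (order_stat (nth 0%N s k) w <= high k w)%E].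

Lemma measurable_good_perm s : measurable (good_perm s).
Proof.
rewrite (_ : good_perm s = \bigcup_m ([set w | n w = m] `&`
   (if perm_eq s (iota 0 m) then \bigcap_k (if (k < m)%N then
     (setT `&` [set w | (low k w <= order_stat (nth 0%N s k) w)%E]) `&`
     (setT `&` [set w | (order_stat (nth 0%N s k) w <= high k w)%E]) else setT) else set0))).
  apply: bigcupT_measurable => m; apply: measurableI => //; case: ifP => // _.
  apply: bigcapT_measurable => k; case: ifP => // _.
  by apply: measurableI; apply: measurable_lee => //; exact: measurable_order_stat.
apply/seteqP; split => w.
  move=> [ps H]; exists (n w) => //; split => //; rewrite ps => k _; case: ifP => // kn.
  by have [h1 h2] := H k kn.
move=> [m _ [/= nm]]; case: ifP => // ps H; split; first by rewrite nm.
by move=> k; rewrite nm => km; have := H k I; rewrite km => -[[_ ?] [_ ?]].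
Qed.

(** The true assignment of distances to points is itself such a permutation, although it may depend
    on [w] in a nonmeasurable way. *)
Lemma exists_good_perm w : G w -> exists s, good_perm s w.
Proof.
move=> Gw; have /(perm_iotaP +oo%E)[Is pIs E] : perm_eq (value_seq w) (sort <=%O (value_seq w)).
  by rewrite perm_sym perm_sort.
have szv : size (value_seq w) = n w by rewrite size_map size_iota.
rewrite size_sort szv in pIs.
have szI : size Is = n w by rewrite (perm_size pIs) size_iota.
exists Is; split => // k kn.
have -> : order_stat (nth 0%N Is k) w = blue_dist w k.
  rewrite /order_stat asboolT//.
  rewrite -(nth_map 0%N +oo%E (fun i => nth +oo%E (sort <=%O (value_seq w)) i)) ?szI// -E.
  by rewrite (nth_map 0%N) ?size_iota// nth_iota// add0n.
exact: between.
Qed.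

Definition decode_perm (i : nat) : seq nat := odflt [::] (choice.unpickle i).

(** Lists of naturals are countable, so taking the least admissible code is a measurable choice. *)
Definition perm_code w : nat :=
  xget 0%N [set i | good_perm (decode_perm i) w /\
    forall j, (j < i)%N -> ~ good_perm (decode_perm j) w].

Lemma perm_codeP w : G w -> good_perm (decode_perm (perm_code w)) w.
Proof.
move=> Gw; have [s gs] := exists_good_perm Gw.
have ex : exists i, `[< good_perm (decode_perm i) w >].
  by exists (choice.pickle s); rewrite /decode_perm choice.pickleK; exact/asboolP.
have [i /asboolP gi imin] := ex_minnP ex.
rewrite /perm_code; case: xgetP => [j _ [gj _]//|/(_ i)]; case.
split => // j ji gj; have := imin j; rewrite leqNgt ji => h.
by have : false; first (apply: h; exact/asboolP).
Qed.

Lemma measurable_perm_code i : measurable [set w | perm_code w = i].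
Proof.
pose first i := good_perm (decode_perm i) `&` \bigcap_j (if (j < i)%N then ~` good_perm (decode_perm j) else setT).
have mf l : measurable (first l).
  apply: measurableI; first exact: measurable_good_perm.
  apply: bigcapT_measurable => j; case: ifP => // _.
  by apply: measurableC; exact: measurable_good_perm.
have fE w l : first l w <-> good_perm (decode_perm l) w /\
    forall j, (j < l)%N -> ~ good_perm (decode_perm j) w.
  split => -[h1 h2]; split => // j; first by move=> jl; have := h2 j I; rewrite jl.
  by move=> _; case: ifP => // /h2.
have fu w k l : first k w -> first l w -> k = l.
  move=> /fE[k1 kmin] /fE[l1 lmin]; apply/eqP; rewrite eqn_leq; apply/andP; split.
    by rewrite leqNgt; apply/negP => /kmin.
  by rewrite leqNgt; apply/negP => /lmin.
have fcode w l : first l w -> perm_code w = l.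
  move=> fl; rewrite /perm_code; case: xgetP => [j _ /fE fj|/(_ l)]; first exact: fu fj fl.
  by case; apply/fE.
rewrite (_ : [set w | _] = first i `|` (if i == 0%N then ~` \bigcup_l first l else set0)).
  apply: measurableU => //; case: ifP => // _.
  by apply: measurableC; exact: bigcupT_measurable.
apply/seteqP; split => w /=.
  move=> ci; have [[l fl]|nf] := pselect (exists l, first l w).
    by left; rewrite -ci (fcode _ _ fl).
  right; have -> : i = 0%N.
    rewrite -ci /perm_code; case: xgetP => // j _ /fE fj; exfalso; apply: nf; by exists j.
  by move=> [l _ fl]; apply: nf; exists l.
case=> [/fcode//|]; case: eqP => // -> nf.
rewrite /perm_code; case: xgetP => // j _ /fE fj; exfalso; apply: nf; by exists j.
Qed.

Definition selected k w : \bar R := order_stat (nth 0%N (decode_perm (perm_code w)) k) w.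

Lemma measurable_selected k : measurable_fun setT (selected k).
Proof.
apply: (measurable_fun_natindex (N := perm_code)
  (F := fun i w => order_stat (nth 0%N (decode_perm i) k) w)).
- exact: measurable_perm_code.
- by move=> i; exact: measurable_order_stat.
Qed.

Lemma selected_between w k : G w -> (k < n w)%N ->
  (low k w <= selected k w)%E /\ (selected k w <= high k w)%E.
Proof. by move=> /perm_codeP[_ H] /H. Qed.

(** Sorting and permuting preserve the multiset of distances in the window; the law of the typical
    distance depends on these counts only. *)
Lemma selected_count w (a : pred (\bar R)) : G w ->
  count a [seq selected k w | k <- iota 0 (n w)] = count a (value_seq w).
Proof.
move=> Gw; have [ps _] := perm_codeP Gw; set s := decode_perm _ in ps.
have szs : size s = n w by rewrite (perm_size ps) size_iota.
rewrite (_ : [seq selected k w | k <- _] = [seq order_stat j w | j <- s]); last first.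
  by rewrite -[in RHS](mkseq_nth 0%N s) szs -map_comp.
have -> : count a [seq order_stat j w | j <- s] = count a [seq order_stat j w | j <- iota 0 (n w)].
  by apply/permP; exact: perm_map.
rewrite -(permP (permEl (perm_sort <=%O (value_seq w))) a).
congr (count a _); rewrite -[in RHS](mkseq_nth +oo%E (sort <=%O (value_seq w))).
rewrite size_sort size_map size_iota /mkseq; apply: eq_map => j.
by rewrite /order_stat asboolT.
Qed.

End Selection.

Section SeqLaw.
Context {R : realType} (nu : probability (seqT R) R) (a : bool -> R).
Hypotheses (hnu : rcyl_law a nu) (a0 : 0 < a true + a false).

Lemma seq_iid : iid_law nu. Proof. exact: rcyl_iid hnu. Qed.

Lemma nu_ray c (t : R) : 0 <= t -> nu [set y | ray c t (y 0%N)] =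
  (expR (- ((a true + a false) * t)) * (a c / (a true + a false)))%:E.
Proof.
move=> t0; have := hnu (l := [:: Some (c, t)]); rewrite /= t0 big_seq1/= => /(_ isT) <-.
by congr (nu _); apply/seteqP; split => y //= [].
Qed.

Lemma measurable_coord_set (D : set R) i : measurable D -> measurable [set y : seqT R | D (y i)].
Proof. by move=> mD; apply: (measurable_preimage (measurable_coord i)). Qed.

Lemma nu_coord (D : set R) i : measurable D -> nu [set y | D (y i)] = nu [set y | D (y 0%N)].
Proof.
move=> mD; have m0 := @measurable_coord_set D 0 mD.
have e : <<s prefixsys i >> [set: seqT R].
  exact: (@measurableT _ (prefT i)).
have := block_prob seq_iid e m0; rewrite setTI probability_setT mul1e => <-.
by congr (nu _); apply/seteqP; split => y /=; rewrite /shift addn0.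
Qed.

Lemma nu_prefix n (D : nat -> set R) : (forall i, measurable (D i)) ->
  nu (prefix_set n D) = (\prod_(i < n) nu [set y | D i (y i)])%E.
Proof.
move=> mD; have := prefix_prob seq_iid n mD measurableT.
rewrite preimage_setT setIT probability_setT mule1 => ->.
by apply: eq_bigr => i _; exact/esym/(nu_coord i (mD i)).
Qed.

Definition all_neq0 : set (seqT R) := \bigcap_i [set y | y i != 0].

Lemma measurable_all_neq0 : measurable all_neq0.
Proof.
apply: bigcapT_measurable => i.
rewrite (_ : [set y | _] = [set y : seqT R | (~` [set 0]) (y i)]); last first.
  by apply/seteqP; split => y /= /eqP.
by apply: measurable_coord_set; exact: measurableC.
Qed.

Lemma nu_abs_gt (t : R) : 0 <= t ->
  nu [set y | t < `|y 0%N|] = (expR (- ((a true + a false) * t)))%:E.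
Proof.
move=> t0; rewrite (_ : [set y | _] = [set y | ray true t (y 0%N)] `|` [set y | ray false t (y 0%N)]).
  rewrite probU; last 3 first.
  - by apply: measurable_coord_set; exact: measurable_ray.
  - by apply: measurable_coord_set; exact: measurable_ray.
  - by apply/seteqP; split => y //= [h1 h2]; lra.
  rewrite !nu_ray// -EFinD -mulrDr -mulrDl divff ?mulr1// gt_eqF//.
apply/seteqP; split => y /=; rewrite lter_normr ltrNr.
  by move=> /orP[|]; [right|left].
by move=> [->|->]//; rewrite orbT.
Qed.

Lemma all_neq0_prob : nu all_neq0 = 1%E.
Proof.
have m (D : set R) i : measurable D -> measurable [set y : seqT R | D (y i)].
  exact: measurable_coord_set.
have E i : [set y : seqT R | y i != 0] = [set y | (~` [set 0]) (y i)].
  by apply/seteqP; split => y /= /eqP.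
apply: prob_bigcap1 => i; rewrite E; first by apply: m; exact: measurableC.
rewrite nu_coord; last exact: measurableC.
have := nu_abs_gt (lexx 0); rewrite mulr0 oppr0 expR0 => <-.
congr (nu _); apply/seteqP; split => y /=; rewrite normr_gt0; first by move/eqP.
by move=> /eqP.
Qed.

End SeqLaw.

Section MergedLaw.
Context {R : realType} (nu : probability (seqT R) R) (lam mu : R).
Hypotheses (lam0 : 0 < lam) (lammu : lam < mu).
Hypothesis hnu : rcyl_law (srate lam mu (fun=> true)) nu.

Let mu0 : 0 < mu. Proof. exact: lt_trans lammu. Qed.
Let s0 : 0 < lam + mu. Proof. exact: addr_gt0. Qed.
Let p := mu / (lam + mu).
Let q := lam / (lam + mu).
Let q0 : 0 < q. Proof. exact: divr_gt0. Qed.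
Let qp : q < p. Proof. by rewrite ltr_pM2r// invr_gt0. Qed.
Let pq : p + q = 1. Proof. by rewrite /p /q -mulrDl addrC divff// gt_eqF. Qed.
Let iid : iid_law nu. Proof. exact: seq_iid hnu. Qed.

Let nup : nu [set y | half true (y 0%N)] = p%:E.
Proof.
have := nu_ray hnu false (lexx 0); rewrite mulr0 oppr0 expR0 mul1r.
by rewrite /srate /rate /= => <-.
Qed.

Let qpE : q / p = lam / mu.
Proof. by rewrite /p /q; field; rewrite !gt_eqF. Qed.

Definition good_seq : set (seqT R) :=
  all_neq0 `&` (\bigcap_i [set y | climbs (iter i ladder y)]) `&` [set y | escape_index y <> 0%N].

Lemma measurable_good_seq : measurable good_seq.
Proof.
apply: measurableI.
  apply: measurableI; first exact: measurable_all_neq0.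
  apply: bigcapT_measurable => i.
  by apply: (measurable_preimage (measurable_iter_ladder i)); exact: measurable_climbs.
by apply: measurableC; exact: measurable_escape_index.
Qed.

Lemma merged_escape_index j :
  nu [set y | escape_index y = j.+1] = ((lam / mu) ^+ j * (1 - lam / mu))%:E.
Proof. by rewrite (escape_index_prob iid q0 qp pq nup) qpE. Qed.

Lemma escape_index_pos_prob : nu [set y | escape_index y <> 0%N] = 1%E.
Proof.
have m k := @measurable_escape_index R k.
rewrite (_ : [set y | _] = \bigcup_j [set y | escape_index y = j.+1]); last first.
  apply/seteqP; split => y /=.
    by case E : (escape_index y) => [//|n] _; exists n.
  by move=> [j _ /= ->].
rewrite measure_semi_bigcup; first last.
- exact: bigcupT_measurable.
- by move=> i j _ _ [y [/= -> []]].
- by move=> j; exact: m.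
have r1 : 0 <= lam / mu < 1 by rewrite divr_ge0 ?ltW//= ltr_pdivrMr// mul1r.
rewrite (eq_eseriesr (g := fun j => ((1 - lam / mu) * (lam / mu) ^+ j)%:E)).
  rewrite geometric_eseries//; congr EFin; rewrite divff// gt_eqF// subr_gt0.
  by case/andP: r1.
by move=> j _; rewrite [LHS](merged_escape_index j) mulrC.
Qed.

Lemma good_seq_prob : nu good_seq = 1%E.
Proof.
have m := @measurable_escape_index R 0.
have a0 : 0 < srate lam mu (fun=> true) true + srate lam mu (fun=> true) false by [].
rewrite /good_seq prob_setI1; first last.
- exact: escape_index_pos_prob.
- apply: measurableI; first exact: measurable_all_neq0.
  apply: bigcapT_measurable => i.
  by apply: (measurable_preimage (measurable_iter_ladder i)); exact: measurable_climbs.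
- exact: measurableC.
have mc i : measurable [set y : seqT R | climbs (iter i ladder y)].
  by apply: (measurable_preimage (measurable_iter_ladder i)); exact: measurable_climbs.
rewrite prob_setI1; first exact: (all_neq0_prob hnu).
- exact: bigcapT_measurable.
- exact: measurable_all_neq0.
apply: prob_bigcap1 => // i.
by rewrite (iter_ladder_law iid q0 qp pq nup i (@measurable_climbs R)) (climbs_prob iid q0 qp pq nup).
Qed.

Lemma merged_ladder_prefix m (D : nat -> set R) : (forall i, measurable (D i)) ->
  nu [set y | forall i, (i < m)%N -> D i (ladder_len (iter i ladder y))] =
  (\prod_(i < m) nu [set y | D i (ladder_len y)])%E.
Proof. exact: (ladder_prefix iid q0 qp pq nup). Qed.

Lemma merged_iter_ladder i S : measurable S -> nu [set y | S (iter i ladder y)] = nu S.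
Proof. exact: (iter_ladder_law iid q0 qp pq nup). Qed.

End MergedLaw.

(** * The typical blue point *)

Section SimplePoints.
Context {R : realType} d (Omega : measurableType d) (P : probability Omega R).
Context (lam mu : R) (Bl Rd : Omega -> set R).
Hypothesis HP : indep_poisson_pair P lam mu Bl Rd.
Hypotheses (lam0 : 0 < lam) (mu0 : 0 < mu).

Local Notation D := (regular_conf Bl Rd).

(** Excludes points of both colours to the right of 0, and a blue point at 0, which the closed
    window of [blue_in_window] counts but the indices over [(0, 1]] miss. *)
Definition simple_event : set Omega :=
  [set w | all_neq0 (gaps (D w) 0) /\ ~ D w true 0].

Let both : bool -> bool := fun=> true.

Let lfD w : locfin (D w). Proof. exact: regular_conf_locfin. Qed.

Let mc : cyl_measurable D (cst (0 : R)).
Proof. exact: (stream_measurable HP both true 0). Qed.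

Let mg : measurable_fun setT (fun w => gaps (D w) (0 : R)).
Proof. exact: (measurable_gaps lfD mc (measurable_cst _)). Qed.

Let point_ok : (forall i, (i < 1)%N -> measurable (nth (entry0 (R := R)) [:: (true, [set 0 : R], 0%N)] i).1.2) /\
  (forall i, (i < 1)%N -> bounded_set_R (nth (entry0 (R := R)) [:: (true, [set 0 : R], 0%N)] i).1.2).
Proof. by split => -[|//] _ //=; exists 0 => x /= ->; rewrite normr0. Qed.

Let noblue0E : [set w | ~ D w true 0] =
  [set w | counts_event [:: (true, [set (0 : R)], 0%N)] (D w)].
Proof.
have f w : finite_set (D w true `&` [set 0]) by apply: sub_finite_set (finite_set1 0) => x [].
apply/seteqP; split => w /=.
  move=> h; split => //; rewrite (_ : _ `&` _ = set0) ?ncard0//.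
  by apply/seteqP; split => // x [+ xE]; rewrite xE.
move=> [/(ncard_eq0 (f w)) E _] h.
by have : set0 (0 : R) by rewrite -E.
Qed.

Lemma measurable_simple_event : measurable simple_event.
Proof.
apply: measurableI; first by apply: (measurable_preimage mg); exact: measurable_all_neq0.
have [m _] := regular_conf_counts HP (L := [:: (true, [set (0 : R)], 0%N)]) point_ok.1 point_ok.2.
by rewrite -/([set w | ~ D w true 0]) noblue0E.
Qed.

Lemma simple_event_prob : P simple_event = 1%E.
Proof.
have [m pr] := regular_conf_counts HP (L := [:: (true, [set (0 : R)], 0%N)]) point_ok.1 point_ok.2.
have n1 : P [set w | ~ D w true 0] = 1%E.
  rewrite noblue0E pr//= big_seq1/= lebesgue_measure_set1/= mulr0.
  by rewrite /poisson_pmf_R oppr0 expR0 expr0 fact0 divr1 mulr1.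
have a0 : 0 < srate lam mu both true + srate lam mu both false by rewrite addr_gt0.
have pa : pois_at P D setT (cst 0) (srate lam mu both).
  move=> s ns; rewrite setTI probability_setT mul1e.
  have [a1 p1] := entries_ok lam mu both true 0 ns.
  have [_ pp] := regular_conf_counts HP (fun i h => (allq_nth a1 h).1) (fun i h => (allq_nth a1 h).2).
  rewrite -p1 -pp; last exact: entries_disj.
  congr (P _); apply/seteqP; split => w /=.
    by move=> h; apply/(counts_entries both true 0 s (lfD w)).
  by move=> /(counts_entries both true 0 s (lfD w)).
have hl : rcyl_law (srate lam mu both) (law P mg).
  move=> l v; rewrite -[LHS]/(P [set w | rcyl l (gaps (D w) 0)]).
  by rewrite -[X in P X]setTI (chain_prob lfD measurableT mc pa a0 v) probability_setT mul1e.
rewrite -(all_neq0_prob hl a0) /simple_event.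
have me : measurable [set w | ~ D w true 0] by rewrite noblue0E.
rewrite -[LHS]/(P ([set w | all_neq0 (gaps (D w) 0)] `&` [set w | ~ D w true 0])).
rewrite prob_setI1//.
by apply: (measurable_preimage mg); exact: measurable_all_neq0.
Qed.

Lemma simple_event_disjoint w z : simple_event w -> 0 < z -> D w true z -> D w false z -> False.
Proof. by move=> [g0 _]; apply: no_double => // i; exact: (g0 i I). Qed.

End SimplePoints.

Lemma measurable_busy_time (R : realType) d (T : measurableType d) (E S : nat -> T -> R) :
  (forall n, measurable_fun setT (E n)) -> (forall n, measurable_fun setT (S n)) ->
  measurable_fun setT (fun w => busy_time (E ^~ w) (S ^~ w)).
Proof.
move=> mE mS; apply: (measurability _ (ErealGenInftyO.measurableE R)) => _ [_ [r ->] <-].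
have msum (F : nat -> T -> R) k : (forall n, measurable_fun setT (F n)) ->
    measurable_fun setT (fun w => \sum_(j < k) F j w) by move=> mF; exact: measurable_sum.
rewrite setTI (_ : _ @^-1` _ = \bigcup_k (
  (setT `&` [set w | ((\sum_(j < k.+1) S j w)%:E <= (\sum_(j < k.+1) E j w)%:E)%E]) `&`
  ([set w | `]-oo, r[%classic (\sum_(j < k.+1) S j w)]))).
  apply: bigcupT_measurable => k; apply: measurableI.
    by apply: measurable_lee => //; apply/measurable_EFinP; exact: msum.
  by apply: (measurable_preimage (msum S k.+1 mS)); exact: measurable_itv.
apply/seteqP; split => w /=.
  rewrite in_itv/= => /ereal_inf_lt[_ [k /= h <-] h2]; by exists k.
move=> [k _ [[_ h] h2]]; move: h h2; rewrite /= lee_fin => h h2.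
have {}h2 : \sum_(j < k.+1) S j w < r by move: h2; rewrite in_itv.
rewrite in_itv/=; apply: le_lt_trans (_ : (\sum_(j < k.+1) S j w)%:E < _)%E; last by rewrite lte_fin.
by apply: ereal_inf_lbound; exists k.
Qed.

Lemma ncard_seq (R : realType) (s : seq R) : uniq s -> ncard [set x | x \in s] = size s.
Proof.
move=> us; rewrite /ncard (_ : fset_set _ = [fset x in s]%fset).
  by rewrite card_fseq undup_id.
apply/fsetP => x; rewrite in_fset_set; last exact: finite_seq.
apply/idP/idP => [/set_mem /= xs|]; first by rewrite in_fset.
by rewrite in_fset /= => xs; exact/mem_set.
Qed.

Lemma eseries_finite (R : realType) (f : nat -> \bar R) n : (forall k, (n <= k)%N -> f k = 0%E) ->
  (\sum_(0 <= k <oo) f k = \sum_(0 <= k < n) f k)%E.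
Proof.
move=> f0; apply/cvg_lim => //; apply: cvg_near_cst.
exists n => // m /= nm; rewrite (big_cat_nat _ nm)//= [X in (_ + X)%E]big1_seq ?adde0//.
by move=> k /andP[_]; rewrite mem_index_iota => /andP[nk _]; exact: f0.
Qed.

Section TypicalBluePoint.
Context {R : realType} d (Omega : measurableType d) (P : probability Omega R).
Context (lam mu : R) (Bl Rd : Omega -> set R) (MB MR : Omega -> R -> option R).
Hypotheses (lam0 : 0 < lam) (lammu : lam < mu).
Hypothesis HP : indep_poisson_pair P lam mu Bl Rd.

Let mu0 : 0 < mu. Proof. exact: lt_trans lammu. Qed.

Local Notation T := (Omega * nat)%type.
Local Notation D := (regular_conf Bl Rd).
Local Notation Pm := (palm HP lam0).
Local Notation supp := (supp Bl Rd).
Local Notation nblue := (nblue Bl Rd).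
Local Notation bpt := (bpt Bl Rd).
Local Notation both := (fun=> true : bool).

Definition gaps_right : T -> seqT R := sgaps Bl Rd both true.
Definition gaps_left : T -> seqT R := sgaps Bl Rd both false.
Definition gaps_color c : T -> seqT R := sgaps Bl Rd (eq_op c) true.

Let measurable_gaps_right : measurable_fun setT gaps_right. Proof. exact: measurable_sgaps HP _ _. Qed.
Let measurable_gaps_left : measurable_fun setT gaps_left. Proof. exact: measurable_sgaps HP _ _. Qed.
Let measurable_gaps_color c : measurable_fun setT (gaps_color c). Proof. exact: measurable_sgaps HP _ _. Qed.

Let nu := sgaps_nu HP lam0 both true.

Let hnu : rcyl_law (srate lam mu both) nu.
Proof. exact: (@sgaps_rcyl _ _ _ _ _ _ _ _ HP lam0 mu0 both true true). Qed.

Lemma joint_law (S1 S2 : set (seqT R)) : measurable S1 -> measurable S2 ->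
  Pm ([set w | S1 (gaps_right w)] `&` [set w | S2 (gaps_left w)]) = (nu S1 * nu S2)%E.
Proof.
apply: (@sgaps_law _ _ _ _ _ _ _ _ HP lam0 mu0 both true both false true true) => //.
by left.
Qed.

Lemma gaps_right_law S : measurable S -> Pm [set w | S (gaps_right w)] = nu S.
Proof. by []. Qed.

Lemma gaps_left_law S : measurable S -> Pm [set w | S (gaps_left w)] = nu S.
Proof.
move=> mS; have := joint_law measurableT mS.
rewrite probability_setT mul1e => <-; congr (Pm _).
by apply/seteqP; split => w //= [].
Qed.

Let nuc c := sgaps_nu HP lam0 (eq_op c) true.

Let hnuc c : rcyl_law (srate lam mu (eq_op c)) (nuc c).
Proof. exact: (@sgaps_rcyl _ _ _ _ _ _ _ _ HP lam0 mu0 (eq_op c) true c). Qed.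

Lemma mono_joint_law (S1 S2 : set (seqT R)) : measurable S1 -> measurable S2 ->
  Pm ([set w | S1 (gaps_color true w)] `&` [set w | S2 (gaps_color false w)]) = (nuc true S1 * nuc false S2)%E.
Proof.
apply: (@sgaps_law _ _ _ _ _ _ _ _ HP lam0 mu0 (eq_op true) true (eq_op false) true true false) => //.
by right; case.
Qed.

Let srate_mono c : srate lam mu (eq_op c) true + srate lam mu (eq_op c) false = rate lam mu c.
Proof. by rewrite /srate; case: c; rewrite /= ?addr0 ?add0r. Qed.

Let rate_gt0 c : 0 < rate lam mu c. Proof. by rewrite /rate; case: c. Qed.

Definition good_point : set T :=
  supp `&` [set w | good_seq (gaps_right w)] `&` [set w | good_seq (gaps_left w)] `&`
  [set w | all_neq0 (gaps_color true w)] `&` [set w | all_neq0 (gaps_color false w)].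

Lemma supp_prob : Pm supp = 1%E.
Proof.
have := palm_setT HP lam0; rewrite palm_setI_supp setTI => <-; by [].
Qed.

Lemma good_point_ae : measurable good_point /\ Pm good_point = 1%E.
Proof.
have m0 := measurable_supp HP.
have m1 : measurable [set w | good_seq (gaps_right w)].
  by apply: (measurable_preimage measurable_gaps_right); exact: measurable_good_seq.
have m2 : measurable [set w | good_seq (gaps_left w)].
  by apply: (measurable_preimage measurable_gaps_left); exact: measurable_good_seq.
have m3 c : measurable [set w | all_neq0 (gaps_color c w)].
  by apply: (measurable_preimage (measurable_gaps_color c)); exact: measurable_all_neq0.
have p1 : Pm [set w | good_seq (gaps_right w)] = 1%E.
  by rewrite gaps_right_law ?(good_seq_prob lam0 lammu hnu)//; exact: measurable_good_seq.
have p2 : Pm [set w | good_seq (gaps_left w)] = 1%E.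
  by rewrite gaps_left_law ?(good_seq_prob lam0 lammu hnu)//; exact: measurable_good_seq.
have p3 c : Pm [set w | all_neq0 (gaps_color c w)] = 1%E.
  by rewrite -(all_neq0_prob (hnuc c))// srate_mono rate_gt0.
have m4 := measurableI _ _ m0 m1; have m5 := measurableI _ _ m4 m2.
have m6 := measurableI _ _ m5 (m3 true); have m7 := measurableI _ _ m6 (m3 false).
split => //; rewrite /good_point prob_setI1// prob_setI1// prob_setI1// prob_setI1//.
exact: supp_prob.
Qed.

Definition busy_right i (wk : T) : \bar R := (ladder_len (iter i ladder (gaps_right wk)))%:E.
Definition busy_left i (wk : T) : \bar R := (ladder_len (iter i ladder (gaps_left wk)))%:E.
Definition count_right (wk : T) : nat := escape_index (gaps_right wk).
Definition count_left (wk : T) : nat := escape_index (gaps_left wk).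
(** The queue of [busy_right 0]: blue points right of the typical point are arrivals, red points are
    ends of services. *)
Definition arrival_gap i (wk : T) : R := `|gaps_color true wk i|.
Definition service_gap i (wk : T) : R := `|gaps_color false wk i|.

Lemma measurable_ladder_iter_len i : measurable_fun setT (fun y : seqT R => ladder_len (iter i ladder y)).
Proof. exact: measurableT_comp measurable_ladder_len (measurable_iter_ladder i). Qed.

Lemma measurable_busy_right i : measurable_fun setT (busy_right i).
Proof.
apply/measurable_EFinP; exact: (measurableT_comp (measurable_ladder_iter_len i) measurable_gaps_right).
Qed.

Lemma measurable_busy_left i : measurable_fun setT (busy_left i).
Proof.
apply/measurable_EFinP; exact: (measurableT_comp (measurable_ladder_iter_len i) measurable_gaps_left).
Qed.

Lemma measurable_arrival_gap i : measurable_fun setT (arrival_gap i).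
Proof.
apply: measurableT_comp => //.
exact: (measurableT_comp (measurable_coord i) (measurable_gaps_color true)).
Qed.

Lemma measurable_service_gap i : measurable_fun setT (service_gap i).
Proof.
apply: measurableT_comp => //.
exact: (measurableT_comp (measurable_coord i) (measurable_gaps_color false)).
Qed.

Lemma good_point_gaps w k : good_point (w, k) ->
  [/\ (k < nblue w)%N, gaps (D w) (bpt k w) = gaps_right (w, k),
      gaps (oppc (D w)) (- bpt k w) = gaps_left (w, k) &
      forall c, gaps (mask (eq_op c) (D w)) (bpt k w) = gaps_color c (w, k)].
Proof.
move=> [[[[kn _] _] _] _]; rewrite /supp /= in kn; split => //.
- by rewrite /gaps_right /sgaps /sconf /sbase /= kn.
- by rewrite /gaps_left /sgaps /sconf /sbase /= kn.
- by move=> c; rewrite /gaps_color /sgaps /sconf /sbase /= kn.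
Qed.

Let lfD w : locfin (D w). Proof. exact: regular_conf_locfin. Qed.

Lemma busy_time_good wk : good_point wk -> busy_time (arrival_gap ^~ wk) (service_gap ^~ wk) = busy_right 0 wk.
Proof.
case: wk => w k g; have [kn eP eM eC] := good_point_gaps g.
have [[[[_ [[g0 cl] _]] _] b0] r0] := g.
have := @busy_time_ladder _ (D w) (bpt k w) (lfD w); rewrite eP !eC; apply.
- by move=> i; exact: (g0 i I).
- by move=> c i; rewrite eC; case: c; [exact: (b0 i I)|exact: (r0 i I)].
- exact: (cl 0%N I).
Qed.

(** Defined as the law of a busy time, so that [busy_law] only asks for independent exponential
    gaps; the ladder lengths are then identified with it ([busy_distE]). *)
Definition busy_dist (A : set (\bar R)) : \bar R :=
  Pm ((fun w => busy_time (arrival_gap ^~ w) (service_gap ^~ w)) @^-1` A).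

Lemma busy_distE (A : set (\bar R)) : measurable A -> busy_dist A = nu [set y | A (ladder_len y)%:E].
Proof.
move=> mA; have [mg pg] := good_point_ae.
have mZ : measurable ((fun w => busy_time (arrival_gap ^~ w) (service_gap ^~ w)) @^-1` A).
  apply: (measurable_preimage _ mA).
  by apply: measurable_busy_time; [exact: measurable_arrival_gap|exact: measurable_service_gap].
have mB : measurable (busy_right 0 @^-1` A) by exact: (measurable_preimage (measurable_busy_right 0)).
rewrite /busy_dist -(prob_setI1 mg mZ pg) -[RHS]/(Pm (busy_right 0 @^-1` A)) -(prob_setI1 mg mB pg).
by congr (Pm _); apply/seteqP; split => wk [/= h g]; split => //=; move: h; rewrite busy_time_good.
Qed.

Let mlen (A : set (\bar R)) : measurable A -> measurable [set x : R | A x%:E].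
Proof. by move=> mA; exact: (measurable_preimage (@EFin_measurable R setT)). Qed.

Let mladder i (A : set (\bar R)) : measurable A ->
  measurable [set y : seqT R | A (ladder_len (iter i ladder y))%:E].
Proof.
move=> mA; exact: (measurable_preimage (S := [set x : R | A x%:E]) (measurable_ladder_iter_len i) (mlen mA)).
Qed.

Lemma busy_right_law i (A : set (\bar R)) : measurable A -> Pm (busy_right i @^-1` A) = busy_dist A.
Proof.
move=> mA; rewrite busy_distE// -(merged_iter_ladder lam0 lammu hnu i (mladder 0 mA)).
exact: (gaps_right_law (mladder i mA)).
Qed.

Lemma busy_left_law i (A : set (\bar R)) : measurable A -> Pm (busy_left i @^-1` A) = busy_dist A.
Proof.
move=> mA; rewrite busy_distE// -(merged_iter_ladder lam0 lammu hnu i (mladder 0 mA)).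
exact: (gaps_left_law (mladder i mA)).
Qed.

Lemma prefix_measurable m (D' : nat -> set (\bar R)) : (forall i, measurable (D' i)) ->
  measurable [set y : seqT R | forall i, (i < m)%N -> D' i (ladder_len (iter i ladder y))%:E].
Proof.
move=> mD; rewrite (_ : [set y | _] = \bigcap_i (if (i < m)%N then
   [set y : seqT R | D' i (ladder_len (iter i ladder y))%:E] else setT)).
  apply: bigcapT_measurable => i; case: ifP => // _.
  exact: mladder.
apply/seteqP; split => y H i; first by move=> _; case: ifP => // /H.
by move=> im; have := H i I; rewrite im.
Qed.

(** Within a half-line by the strong Markov property at ladder times, across the half-lines by
    [joint_law]. *)
Lemma busy_indep : mutual_indep Pm (pair_family busy_right busy_left).
Proof.
apply: mutual_indep_prefix; [exact: measurable_busy_right|exact: measurable_busy_left|].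
move=> m D1 D2 mD1 mD2.
rewrite (joint_law (prefix_measurable m mD1) (prefix_measurable m mD2)).
have E (D' : nat -> set (\bar R)) : (forall i, measurable (D' i)) ->
    nu [set y : seqT R | forall i, (i < m)%N -> D' i (ladder_len (iter i ladder y))%:E] =
    (\prod_(i < m) busy_dist (D' i))%E.
  move=> mD; rewrite (merged_ladder_prefix lam0 lammu hnu m (D := fun i => [set x | D' i x%:E])).
    by apply: eq_bigr => i _; rewrite busy_distE.
  by move=> i; exact: mlen.
rewrite !E//; congr (_ * _)%E; apply: eq_bigr => i _; [by rewrite busy_right_law|by rewrite busy_left_law].
Qed.

Lemma abs_preimage (D' : set R) : measurable D' -> measurable [set x : R | D' `|x|].
Proof. by move=> mD; apply: (measurable_preimage (S := D') _ mD); exact: normr_measurable. Qed.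

Lemma arrival_service_indep : mutual_indep Pm (ES_family arrival_gap service_gap).
Proof.
change (mutual_indep Pm (pair_family arrival_gap service_gap)).
apply: mutual_indep_prefix; [exact: measurable_arrival_gap|exact: measurable_service_gap|].
move=> m D1 D2 mD1 mD2.
have mP (D' : nat -> set R) : (forall i, measurable (D' i)) ->
    measurable (prefix_set m (fun i => [set x | D' i `|x|])).
  by move=> mD; apply: measurable_prefix_set => i; exact: abs_preimage.
rewrite (mono_joint_law (mP _ mD1) (mP _ mD2)).
rewrite (nu_prefix (hnuc true)); last by move=> i; exact: abs_preimage.
by rewrite (nu_prefix (hnuc false)); last by move=> i; exact: abs_preimage.
Qed.

Lemma gap_exp_law c i : exp_law Pm (rate lam mu c) (fun wk => `|gaps_color c wk i|).
Proof.
split; first by case: c; [exact: measurable_arrival_gap|exact: measurable_service_gap].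
move=> t t0; rewrite -[LHS]/(nuc c [set y | [set x : R | t < `|x|] (y i)]).
have mt : measurable [set x : R | t < `|x|].
  have : measurable [set x : R | t < x] by rewrite -set_itvoy; exact: measurable_itv.
  by move=> /abs_preimage.
by rewrite (nu_coord (hnuc c) i mt) (nu_abs_gt (hnuc c))// srate_mono.
Qed.

Lemma busy_dist_law : busy_law lam mu busy_dist.
Proof.
exists _, T, Pm, arrival_gap, service_gap; split; first exact: arrival_service_indep.
split; first by move=> n; exact: (gap_exp_law true n).
by split; first by move=> n; exact: (gap_exp_law false n).
Qed.

Lemma measurable_count_right k : measurable [set w | count_right w = k].
Proof. exact: (measurable_preimage measurable_gaps_right (@measurable_escape_index R k)). Qed.

Lemma measurable_count_left k : measurable [set w | count_left w = k].
Proof. exact: (measurable_preimage measurable_gaps_left (@measurable_escape_index R k)). Qed.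

Lemma measurable_nat_fun (N : T -> nat) : (forall k, measurable [set w | N w = k]) ->
  measurable_fun setT N.
Proof.
move=> mN; by apply: (measurable_fun_natindex (N := N) (F := fun n _ => n)).
Qed.

Lemma count_right_geom : geom_law Pm (1 - lam / mu) count_right.
Proof.
split; first exact: measurable_nat_fun measurable_count_right.
by move=> j; rewrite subKr; exact: (merged_escape_index lam0 lammu hnu).
Qed.

Lemma count_left_geom : geom_law Pm (1 - lam / mu) count_left.
Proof.
split; first exact: measurable_nat_fun measurable_count_left.
move=> j; rewrite subKr -(merged_escape_index lam0 lammu hnu) -gaps_left_law//.
exact: measurable_escape_index.
Qed.

Lemma count_indep j j' : Pm [set w | count_right w = j /\ count_left w = j'] =
  (Pm [set w | count_right w = j] * Pm [set w | count_left w = j'])%E.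
Proof.
have mj k := @measurable_escape_index R k.
have := joint_law (mj j) (mj j'); rewrite -(gaps_left_law (mj j')) -(gaps_right_law (mj j)).
by [].
Qed.

Definition dist_lower (wk : T) : \bar R := Order.min (busy_right 0 wk) (busy_left 0 wk).
Definition dist_upper (wk : T) : \bar R :=
  Order.max (\sum_(i < (2 * count_right wk).-1) busy_right i wk)%E (\sum_(i < (2 * count_left wk).-1) busy_left i wk)%E.

Lemma measurable_dist_lower : measurable_fun setT dist_lower.
Proof. by apply: measurable_mine; [exact: measurable_busy_right|exact: measurable_busy_left]. Qed.

Lemma measurable_dist_upper : measurable_fun setT dist_upper.
Proof.
apply: measurable_maxe.
  apply: (measurable_fun_natindex (N := count_right) (F := fun n wk => (\sum_(i < (2 * n).-1) busy_right i wk)%E)).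
    exact: measurable_count_right.
  by move=> n; apply: emeasurable_sum => i; exact: measurable_busy_right.
apply: (measurable_fun_natindex (N := count_left) (F := fun n wk => (\sum_(i < (2 * n).-1) busy_left i wk)%E)).
  exact: measurable_count_left.
by move=> n; apply: emeasurable_sum => i; exact: measurable_busy_left.
Qed.

Lemma bicolored_opp w c : bicolored [set x | Bl w (- x)] [set x | Rd w (- x)] c = oppc (bicolored (Bl w) (Rd w)) c.
Proof. by rewrite /oppc /bicolored; case: c. Qed.

(** A partner on the right means positive excess there, so a ladder time has been passed; a partner
    on the left is the same after reflection. A partner at the point itself would be a point of both
    colours, and an unmatched point has infinite distance. *)
Lemma dist_lower_le w k : finite_event Bl Rd w -> simple_event Bl Rd w ->
  is_stable_matching (Bl w) (Rd w) (MB w) (MR w) -> good_point (w, k) ->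
  (dist_lower (w, k) <= mdist (MB w (bpt k w)) (bpt k w))%E.
Proof.
move=> fw sw st g; have [kn eP eM _] := good_point_gaps g.
have [[[[_ [[g0 _] _]] [[gm0 _] _]] _] _] := g.
have [Db b0 b1] := blue_posP (lfD w) kn.
have DE : D w = bicolored (Bl w) (Rd w) by rewrite regular_confE.
have lf := lfD w; rewrite DE in lf.
have hb : Bl w (bpt k w) by have : D w true (bpt k w) := Db; rewrite DE.
case E : (MB w (bpt k w)) => [r|] /=; last by rewrite leey.
have [br|rb|br] := ltgtP (bpt k w) r.
- have := matched_right_num lf st hb E br; rewrite -DE => h.
  have := excess_ladder (lfD w) (x := bpt k w); rewrite eP.
  move=> /(_ (fun i => g0 i I) r (ltW br) h) h2.
  rewrite /dist_lower ge_min; apply/orP; left; rewrite /busy_right lee_fin distrC ger0_norm; lra.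
- have st' := stable_opp st.
  have hb' : [set x | Bl w (- x)] (- bpt k w) by rewrite /= opprK.
  have E' : omap -%R (MB w (- - bpt k w)) = Some (- r) by rewrite opprK E.
  have br' : - bpt k w < - r by rewrite ltrN2.
  have cE : bicolored [set x | Bl w (- x)] [set x | Rd w (- x)] = oppc (D w).
    by rewrite DE; apply/funext => c; exact: bicolored_opp.
  have lf' : locfin (bicolored [set x | Bl w (- x)] [set x | Rd w (- x)]).
    by rewrite cE; exact: locfin_oppc.
  have := matched_right_num lf' st' hb' E' br'; rewrite cE => h.
  have := excess_ladder (locfin_oppc (lfD w)) (x := - bpt k w); rewrite eM.
  move=> /(_ (fun i => gm0 i I) (- r) (ltW br') h) h2.
  rewrite /dist_lower ge_min; apply/orP; right; rewrite /busy_left lee_fin ger0_norm; lra.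
- exfalso; have [[m1 _] _] := st; have [hr _] := m1 _ _ hb E.
  have Dr : D w false (bpt k w) by rewrite DE br.
  exact: simple_event_disjoint sw b0 Db Dr.
Qed.

Lemma dist_le_upper w k : finite_event Bl Rd w ->
  is_stable_matching (Bl w) (Rd w) (MB w) (MR w) -> good_point (w, k) ->
  (mdist (MB w (bpt k w)) (bpt k w) <= dist_upper (w, k))%E.
Proof.
move=> fw st g; have [kn eP _ _] := good_point_gaps g.
have [[[[_ [[g0 cl] en]] _] _] _] := g.
have [Db b0 b1] := blue_posP (lfD w) kn.
have DE : D w = bicolored (Bl w) (Rd w) by rewrite regular_confE.
have lf := lfD w; rewrite DE in lf.
have hb : Bl w (bpt k w) by have : D w true (bpt k w) := Db; rewrite DE.
have [n En] : exists n, count_right (w, k) = n.+1.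
  by move: en; rewrite /count_right /=; case: (escape_index _) => // n _; exists n.
have es : escapes (gaps_right (w, k)) n.+1 by apply/escape_indexE.
have cf : climbs_forever (gaps_right (w, k)) by move=> i; exact: (cl i I).
have l0 i : 0 <= ladder_len (iter i ladder (gaps_right (w, k))) by apply: sumr_ge0.
pose tot := \sum_(i < n.+1) ladder_len (iter i ladder (gaps_right (w, k))).
apply: (@le_trans _ _ tot%:E).
  apply: (dist_le_of_excess lf st hb); first by apply: sumr_ge0.
  move=> s ts; rewrite -DE; apply: (@escapes_excess _ _ _ (lfD w) _ n.+1); rewrite ?eP//.
    by move=> i; exact: (g0 i I).
  by rewrite lerD2l.
rewrite /dist_upper le_max; apply/orP; left; rewrite En /busy_right sumEFin lee_fin /tot.
rewrite -!(big_mkord xpredT (fun i => ladder_len (iter i ladder (gaps_right (w, k))))).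
(* With [N = n.+1], [N <= 2 * N - 1] holds since [N >= 1]; the extra terms are nonnegative. *)
rewrite (@big_cat_nat _ _ _ n.+1 0 (2 * n.+1).-1)//=; last by lia.
by rewrite lerDl sumr_ge0.
Qed.

End TypicalBluePoint.

(** * The typical matching distance and its law *)

Section TypicalDistance.
Context {R : realType} d (Omega : measurableType d) (P : probability Omega R).
Context (lam mu : R) (Bl Rd : Omega -> set R) (MB MR : Omega -> R -> option R).
Hypotheses (lam0 : 0 < lam) (lammu : lam < mu).
Hypothesis HP : indep_poisson_pair P lam mu Bl Rd.
Hypothesis Hm : forall A : set (\bar R), measurable A ->
     measurable_fun setT (fun w => cnt (blue_in_window (Bl w) (MB w) A)).
Context (U : set Omega).
Hypotheses (mU : measurable U) (U1 : P U = 1%E)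
  (stU : forall w, U w -> is_stable_matching (Bl w) (Rd w) (MB w) (MR w)).

Local Notation T := (Omega * nat)%type.
Local Notation D := (regular_conf Bl Rd).
Local Notation Pm := (palm HP lam0).
Local Notation nblue := (nblue Bl Rd).
Local Notation bpt := (bpt Bl Rd).
Local Notation good := (good_point Bl Rd).

Let mu0 : 0 < mu. Proof. exact: lt_trans lammu. Qed.

Let ilam0 : (0 <= lam^-1%:E)%E. Proof. by rewrite lee_fin invr_ge0 ltW. Qed.

Lemma palm_null (Z : set T) : (forall k, P [set w | (k < nblue w)%N /\ Z (w, k)] = 0%E) ->
  Pm Z = 0%E.
Proof. by move=> Z0; rewrite palmE eseries0// => k _ _; rewrite Z0 mule0. Qed.

Lemma palm_null_slice (Z : set T) k : Pm Z = 0%E -> P [set w | (k < nblue w)%N /\ Z (w, k)] = 0%E.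
Proof.
rewrite palmE => Z0.
have t0 i : (0 <= lam^-1%:E * P [set w | (i < nblue w)%N /\ Z (w, i)])%E by exact: mule_ge0.
have := @nneseries_lim_ge R (fun i => lam^-1%:E * P [set w | (i < nblue w)%N /\ Z (w, i)])%E
  xpredT 0 k.+1 (fun i _ _ => t0 i).
rewrite Z0 big_nat_recr//= => H.
have : (lam^-1%:E * P [set w | (k < nblue w)%N /\ Z (w, k)] <= 0)%E.
  by apply: le_trans H; rewrite leeDr// sume_ge0.
move=> H0; have /eqP : (lam^-1%:E * P [set w | (k < nblue w)%N /\ Z (w, k)] = 0)%E.
  by apply/eqP; rewrite eq_le H0 t0.
by rewrite mule_eq0 eqe invr_eq0 gt_eqF//= => /eqP.
Qed.

Lemma measurable_slice (Z : set T) k : measurable Z -> measurable [set w | Z (w, k)].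
Proof. exact: (measurable_preimage (@measurable_pairk _ Omega k)). Qed.

(** Every blue point of the window must be good, since the selection moves distances between them. A
    Palm-null set of bad pairs leaves a null set of bad [w] for each [k], so this still has
    probability 1. *)
Definition base_event : set Omega :=
  finite_event Bl Rd `&` simple_event Bl Rd `&` U `&`
  \bigcap_k [set w | (k < nblue w)%N -> good (w, k)].

Let good_slice k : measurable [set w | (k < nblue w)%N -> good (w, k)] /\
  P [set w | (k < nblue w)%N -> good (w, k)] = 1%E.
Proof.
have [mg g1] := good_point_ae lam0 lammu HP.
have mk := measurable_lt_nblue HP k; have mgk := measurable_slice k mg.
rewrite (_ : [set w | _ -> _] = ~` [set w | (k < nblue w)%N /\ (~` good) (w, k)]).
  have mN : measurable [set w | (k < nblue w)%N /\ (~` good) (w, k)].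
    apply: measurableI => //; exact: measurable_slice (measurableC mg).
  split; first exact: measurableC.
  apply: prob_setC0; first exact: measurableC.
  rewrite setCK; apply: palm_null_slice; exact: prob_setC1.
apply/seteqP; split => w /= H; first by move=> [kn]; apply; exact: H.
by move=> kn; apply: contrapT => ng; apply: H.
Qed.

Lemma measurable_base_event : measurable base_event.
Proof.
apply: measurableI; last by apply: bigcapT_measurable => k; exact: (good_slice k).1.
apply: measurableI => //; apply: measurableI; first exact: measurable_finite_event HP.
exact: measurable_simple_event HP.
Qed.

Lemma base_event_prob : P base_event = 1%E.
Proof.
have m1 := measurable_finite_event HP; have m2 := measurable_simple_event HP.
have m3 : measurable (finite_event Bl Rd `&` simple_event Bl Rd) by exact: measurableI.
have m4 : measurable (\bigcap_k [set w | (k < nblue w)%N -> good (w, k)]).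
  by apply: bigcapT_measurable => k; exact: (good_slice k).1.
rewrite /base_event prob_setI1//; last 2 first.
- by apply: measurableI.
- by apply: prob_bigcap1 => k; [exact: (good_slice k).1|exact: (good_slice k).2].
by rewrite prob_setI1// prob_setI1// ?(finite_event_prob HP)// (simple_event_prob HP lam0 mu0).
Qed.

Definition blue_dist w k : \bar R := mdist (MB w (bpt k w)) (bpt k w).

Local Notation low := (fun k w => dist_lower Bl Rd (w, k)).
Local Notation high := (fun k w => dist_upper Bl Rd (w, k)).

Lemma blue_dist_between w k : base_event w -> (k < nblue w)%N ->
  (low k w <= blue_dist w k)%E /\ (blue_dist w k <= high k w)%E.
Proof.
move=> [[[fw sw] /stU st] H] kn; have g := H k I kn.
by split; [exact: dist_lower_le fw sw st g|exact: (dist_le_upper lam0 lammu fw st g)].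
Qed.

Lemma window_count w (A : set (\bar R)) : base_event w ->
  cnt (blue_in_window (Bl w) (MB w) A) =
  ((count (fun y => `[< A y >]) (value_seq nblue blue_dist w))%:R)%:E.
Proof.
move=> [[[fw [_ n0]] _] _]; have lf := regular_conf_locfin Bl Rd w.
have DE : D w true = Bl w by rewrite regular_confE.
pose s := [seq k <- iota 0 (nblue w) | `[< A (blue_dist w k) >]].
have sn k : k \in s = `[< A (blue_dist w k) >] && (k < nblue w)%N.
  by rewrite mem_filter mem_iota.
have E : blue_in_window (Bl w) (MB w) A = [set x | x \in [seq bpt k w | k <- s]].
  apply/seteqP; split => [b [hb [/andP[b0 b1] hA]]|b /mapP[k + ->]] /=; last first.
    rewrite sn => /andP[/asboolP hA kn]; have [h1 h2 h3] := blue_posP lf kn.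
    split; first by rewrite -DE.
    by rewrite (ltW h2) h3.
  have b0' : 0 < b.
    by rewrite lt_neqAle b0 andbT; apply/eqP => b00; apply: n0; rewrite b00 DE.
  rewrite -DE in hb; have [k kn bk] := blue_pos_surj lf hb b0' b1.
  apply/mapP; exists k => //; rewrite sn kn andbT.
  by apply/asboolP; rewrite /blue_dist -[bpt k w]/(blue_pos (D w) k) bk.
have us : uniq [seq bpt k w | k <- s].
  rewrite map_inj_in_uniq; first by rewrite filter_uniq// iota_uniq.
  by move=> k l; rewrite !sn => /andP[_ kn] /andP[_ ln]; exact: blue_pos_inj.
rewrite E cntE; last exact: finite_seq.
by rewrite ncard_seq// size_map size_filter /value_seq count_map.
Qed.

Let mn k : measurable [set w | nblue w = k]. Proof. exact: measurable_nblue HP k. Qed.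

Let mlow k : measurable_fun setT (low k).
Proof. exact: measurableT_comp (measurable_dist_lower HP) (@measurable_pairk _ Omega k). Qed.

Let mhigh k : measurable_fun setT (high k).
Proof. exact: measurableT_comp (measurable_dist_upper HP) (@measurable_pairk _ Omega k). Qed.

Lemma measurable_window_count (A : set (\bar R)) j : measurable A ->
  measurable [set w | base_event w /\
    (j < count (fun y => `[< A y >]) (value_seq nblue blue_dist w))%N].
Proof.
move=> mA; rewrite (_ : [set w | _] = base_event `&`
  (setT `&` [set w | ((j.+1)%:R%:E <= cnt (blue_in_window (Bl w) (MB w) A))%E])).
  apply: measurableI; first exact: measurable_base_event.
  by apply: measurable_lee => //; exact: Hm.
apply/seteqP; split => w /= [bw].
  by move=> h; split => //; split => //; rewrite window_count// lee_fin ler_nat.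
by move=> [_]; rewrite window_count// lee_fin ler_nat.
Qed.

Definition typical_dist (wk : T) : \bar R :=
  selected nblue blue_dist base_event low high wk.2 wk.1.

Lemma measurable_typical_dist : measurable_fun setT typical_dist.
Proof.
apply: measurable_fun_slices => k.
exact: (measurable_selected mn measurable_base_event mlow mhigh measurable_window_count k).
Qed.

(** Summed over [k], the probabilities become the expected number of selected distances in [A],
    which almost surely equals the number of matching distances in [A] by [selected_count] and
    [window_count]. *)
Lemma typical_dist_lawE (A : set (\bar R)) : measurable A ->
  Pm (typical_dist @^-1` A) = typical_dist_law P lam Bl MB A.
Proof.
move=> mA; pose Z k := [set w | (k < nblue w)%N /\ A (typical_dist (w, k))].
have mZ k : measurable (Z k).
  apply: measurableI; first exact: measurable_lt_nblue HP k.
  exact: (measurable_slice k (measurable_preimage measurable_typical_dist mA)).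
have mI k : measurable_fun setT (fun w => (\1_(Z k) w)%:E : \bar R).
  by apply/measurable_EFinP; exact: measurable_indic.
have I0 k w : (0 <= ((\1_(Z k) w)%:E : \bar R))%E by rewrite lee_fin.
rewrite palmE nneseriesZl//; congr (_ * _)%E.
transitivity (\int[P]_w \sum_(0 <= k <oo) ((\1_(Z k) w)%:E : \bar R))%E.
  rewrite integral_nneseries//; apply: eq_eseriesr => k _.
  by rewrite integral_indic// setIT.
apply: ge0_ae_eq_integral => //.
- exact: ge0_emeasurable_sum.
- exact: Hm.
- by move=> w _; apply: nneseries_ge0.
- by move=> w _; rewrite /cnt; case: ifP => _; rewrite ?leey// lee_fin.
exists (~` base_event); split.
- exact: measurableC measurable_base_event.
- exact: prob_setC1 measurable_base_event base_event_prob.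
move=> w /= nE bw; apply: nE => _; rewrite window_count//.
rewrite -(selected_count blue_dist_between (fun y => `[< A y >]) bw) count_map.
rewrite (@eseries_finite _ _ (nblue w)); last first.
  move=> k nk; rewrite indicE memNset// => -[/=]; rewrite ltnNge nk//.
rewrite sumEFin -sum1_count natr_sum; congr EFin.
rewrite [RHS]big_mkcond /index_iota subn0; apply: eq_big_seq => k.
rewrite mem_iota /= => kn; rewrite indicE; case: ifP => h.
  by rewrite mem_set//; split => //; exact/asboolP.
by rewrite memNset// => -[_ /asboolP]; rewrite /= h.
Qed.

Lemma typical_dist_between : {ae Pm, forall wk,
  (dist_lower Bl Rd wk <= typical_dist wk)%E /\ (typical_dist wk <= dist_upper Bl Rd wk)%E}.
Proof.
pose Z : set T := [set wk | (wk.2 < nblue wk.1)%N /\ base_event wk.1].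
have mZ : measurable Z.
  apply: measurable_slices => k; apply: measurableI; last exact: measurable_base_event.
  exact: measurable_lt_nblue HP k.
exists (~` Z); split; first exact: measurableC.
  apply: palm_null => k; apply: (prob_sub0 _ _ _ (prob_setC1 measurable_base_event base_event_prob)).
  - apply: measurableI; first exact: measurable_lt_nblue HP k.
    exact: measurable_slice (measurableC mZ).
  - exact: measurableC measurable_base_event.
  - by move=> w /= [kn nz] bw; apply: nz.
move=> [w k] /= nb [kn bw]; apply: nb; exact: (selected_between blue_dist_between bw kn).
Qed.

End TypicalDistance.

Theorem theorem4p5 (R : realType) (lam mu : R) (d : measure_display)
  (Omega : measurableType d) (P : probability Omega R)
  (Bl Rd : Omega -> set R) (MB MR : Omega -> R -> option R) :
  0 < lam -> lam < mu ->
  indep_poisson_pair P lam mu Bl Rd ->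
  {ae P, forall w, is_stable_matching (Bl w) (Rd w) (MB w) (MR w)} ->
  (forall A : set (\bar R), measurable A ->
     measurable_fun setT (fun w => cnt (blue_in_window (Bl w) (MB w) A))) ->
  exists (d' : measure_display) (T : measurableType d') (P' : probability T R)
         (X : T -> \bar R) (B B' : nat -> T -> \bar R) (N N' : T -> nat)
         (QB : set (\bar R) -> \bar R),
    [/\ busy_law lam mu QB,
        measurable_fun setT X /\
        (forall A : set (\bar R), measurable A ->
           P' (X @^-1` A) = typical_dist_law P lam Bl MB A),
        mutual_indep P' (pair_family B B') /\
        (forall (i : nat + nat) (A : set (\bar R)), measurable A ->
           P' (pair_family B B' i @^-1` A) = QB A),
        [/\ geom_law P' (1 - lam / mu) N, geom_law P' (1 - lam / mu) N' &
            forall j j' : nat,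
              P' [set w | N w = j /\ N' w = j'] =
              (P' [set w | N w = j] * P' [set w | N' w = j'])%E] &
        {ae P', forall w,
           (Order.min (B 0%N w) (B' 0%N w) <= X w)%E /\
           (X w <= Order.max (\sum_(i < (2 * N w).-1) B i w)
                             (\sum_(i < (2 * N' w).-1) B' i w))%E}].
Proof.
move=> lam0 lammu HP [N0 [mN0 N00 stN0]] Hm.
have mU : measurable (~` N0) by exact: measurableC.
have U1 : P (~` N0) = 1%E by apply: prob_setC0; rewrite ?setCK//; exact: mU.
have stU w : (~` N0) w -> is_stable_matching (Bl w) (Rd w) (MB w) (MR w).
  by move=> nw; apply: contrapT => ns; apply: nw; exact: (stN0 w ns).
exists _, (Omega * nat)%type, (palm HP lam0), (typical_dist Bl Rd MB (~` N0)),
  (busy_right Bl Rd), (busy_left Bl Rd), (count_right Bl Rd), (count_left Bl Rd), (busy_dist lam0 HP); split.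
- exact: busy_dist_law.
- split; first exact: (measurable_typical_dist lam0 lammu HP Hm mU).
  by move=> A; exact: (typical_dist_lawE lam0 lammu HP Hm mU U1 stU).
- split; first exact: busy_indep.
  by move=> [i|i] A mA; [exact: busy_right_law|exact: busy_left_law].
- split; [exact: count_right_geom|exact: count_left_geom|exact: count_indep].
- exact: (typical_dist_between lam0 lammu HP mU U1 stU).
Qed.
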